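(* Let $s\in(0,1)$, let $\Omega\subset\mathbb{H}^n$ be a bounded domain, and let $u\in H^s(\mathbb{H}^n)$ be a weak supersolution to $$(-\Delta_{\mathbb{H}^n})^su=0\ \text{ in }\Omega,\qquad u=g\ \text{ in }\mathbb{H}^n\smallsetminus\Omega,$$ such that $u\ge0$ in $B_R\equiv B_R(\xi_0)\subseteq\Omega$. Then, for any $B_r\equiv B_r(\xi_0)$ such that $B_{6r}\equiv B_{6r}(\xi_0)\subset B_R$, and any $0<t<Q/(Q-2s)$, $$\left(\frac1{|B_r|}\int_{B_r}u^t\,d\xi\right)^{\frac1t}\ \le\ c\,\inf_{B_{\frac{3r}2}}u+c\,(1-s)\left(\frac rR\right)^{2s}\mathrm{Tail}(u_-;\xi_0,R),$$ where $u_-:=\max\{-u,0\}$ and $c=c(n,s)$.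
   Context: Heisenberg group: $\mathbb{H}^n$ is $\mathbb{R}^{2n+1}$ with points $\xi=(z,t)=(x_1,\dots,x_n,y_1,\dots,y_n,t)$, group law $\xi\circ\xi'=(x+x',\,y+y',\,t+t'+2\langle y,x'\rangle-2\langle x,y'\rangle)$, homogeneous dimension $Q=2n+2$, standard homogeneous norm $|\xi|_{\mathbb{H}^n}=(|z|^4+t^2)^{1/4}$, and $B_\rho\equiv B_\rho(\xi_0)=\{\xi:|\xi_0^{-1}\circ\xi|_{\mathbb{H}^n}<\rho\}$; integrals and $|\cdot|$ of sets are with respect to Lebesgue measure. $H^s(\mathbb{H}^n)=W^{s,2}(\mathbb{H}^n)$ is the set of $u\in L^2(\mathbb{H}^n)$ with $[u]^2=\int_{\mathbb{H}^n}\int_{\mathbb{H}^n}\frac{|u(\xi)-u(\eta)|^2}{|\eta^{-1}\circ\xi|_{\mathbb{H}^n}^{Q+2s}}\,d\xi\,d\eta<\infty$, with norm $(\|u\|_{L^2}^2+[u]^2)^{1/2}$; $W_0^{s,2}(\Omega)$ is the closure of $C_0^\infty(\Omega)$ in $H^s(\mathbb{H}^n)$. The boundary datum is $g\in H^s(\mathbb{H}^n)$. The fractional subLaplacian is $(-\Delta_{\mathbb{H}^n})^su(\xi)=C(n,s)\,\mathrm{P.V.}\int_{\mathbb{H}^n}\frac{u(\xi)-u(\eta)}{|\eta^{-1}\circ\xi|_{\mathbb{H}^n}^{Q+2s}}\,d\eta$, with $C(n,s)>0$ a normalizing constant depending only on $n,s$ (its value plays no role since the right-hand side is zero). Weak supersolutions: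 $u\in H^s(\mathbb{H}^n)$ with $(g-u)_+\in W_0^{s,2}(\Omega)$ is a weak supersolution if $$\int_{\mathbb{H}^n}\int_{\mathbb{H}^n}\frac{(u(\xi)-u(\eta))(\psi(\xi)-\psi(\eta))}{|\eta^{-1}\circ\xi|_{\mathbb{H}^n}^{Q+2s}}\,d\xi\,d\eta\ \ge\ 0$$ for every nonnegative $\psi\in W_0^{s,2}(\Omega)$. Nonlocal tail ($p=2$): $\mathrm{Tail}(u;\xi_0,R)=R^{2s}\int_{\mathbb{H}^n\smallsetminus B_R(\xi_0)}|u(\eta)|\,|\eta^{-1}\circ\xi_0|_{\mathbb{H}^n}^{-Q-2s}\,d\eta$. Infima of $u$ are essential ones.
   Formalization: The constant c is allowed to depend on t as well as on n and s; a constant c(n,s) uniform over all 0<t<Q/(Q-2s) is impossible, since mollified fundamental solutions make the left side blow up as t tends to Q/(Q-2s). *)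

(* Defs.v *)
From HB Require Import structures.
From mathcomp Require Import all_boot all_order all_algebra.
From mathcomp Require Import all_classical all_reals all_analysis.
From mathcomp Require Import ess_sup_inf.

Set Implicit Arguments.
Unset Strict Implicit.
Unset Printing Implicit Defensive.

Import Order.TTheory GRing.Theory Num.Theory.
Import numFieldNormedType.Exports.

Local Open Scope classical_set_scope.
Local Open Scope ring_scope.

(* The sigma-algebra on R^m generated by the coordinates, i.e. the Borel one;
   same construction as the library's instance on tuples. *)
Section measurable_rV.
Context {R : realType}.
Variable m : nat.

Let coord_rV (i : 'I_m) (v : 'rV[R]_m) : R := v ord0 i.

Let rV_set0 : g_sigma_preimage coord_rV set0.
Proof. exact: sigma_algebra0. Qed.

Let rV_setC A : g_sigma_preimage coord_rV A -> g_sigma_preimage coord_rV (~` A).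
Proof. exact: sigma_algebraC. Qed.

Let rV_bigcup (F : (set 'rV[R]_m)^nat) :
  (forall i, g_sigma_preimage coord_rV (F i)) ->
  g_sigma_preimage coord_rV (\bigcup_i F i).
Proof. exact: sigma_algebra_bigcup. Qed.

HB.instance Definition _ := @isMeasurable.Build default_measure_display
  'rV[R]_m (g_sigma_preimage coord_rV) rV_set0 rV_setC rV_bigcup.

Lemma measurable_coord (i : 'I_m) :
  measurable_fun [set: 'rV[R]_m] (fun v : 'rV[R]_m => v ord0 i).
Proof.
move=> _ Y mY; rewrite setTI; apply: sub_sigma_algebra => /=.
rewrite -bigcup_seq/=; exists i => /=; first by rewrite mem_index_enum.
by exists Y => //; rewrite setTI.
Qed.

Lemma measurable_fun_rVP d (T : measurableType d) (f : T -> 'rV[R]_m) :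
  measurable_fun [set: T] f <->
  forall i, measurable_fun [set: T] (fun x => f x ord0 i).
Proof.
split=> [mf i|mf].
  exact: (measurableT_comp (measurable_coord i) mf).
apply: (measurability (\big[setU/set0]_(i < m)
  preimage_set_system setT (coord_rV i) measurable)) => //.
move=> _ [A + <-]; rewrite -bigcup_seq => /= -[i _ [B mB <-]].
rewrite !setTI -comp_preimage; have := mf i measurableT B mB; rewrite setTI.
exact.
Qed.

End measurable_rV.

Section lebesgue_rV.
Context {R : realType}.

Definition cons_rV m (p : R * 'rV[R]_m) : 'rV[R]_m.+1 :=
  row_mx p.1%:M p.2 : 'rV[R]_(1 + m).

Definition uncons_rV m (v : 'rV[R]_m.+1) : R * 'rV[R]_m :=
  (v ord0 ord0, \row_j v ord0 (lift ord0 j)).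

Lemma cons_rV0 m (p : R * 'rV[R]_m) : cons_rV p ord0 ord0 = p.1.
Proof.
by rewrite mxE; case: splitP => // k _; rewrite !ord1 mxE eqxx mulr1n.
Qed.

Lemma cons_rVS m (p : R * 'rV[R]_m) (j : 'I_m) :
  cons_rV p ord0 (lift ord0 j) = p.2 ord0 j.
Proof.
rewrite mxE; case: splitP => k /= jk; first by move: jk; rewrite ord1.
by congr (p.2 _ _); apply/val_inj; move: jk => /= [].
Qed.

Lemma cons_rVK m : cancel (@cons_rV m) (@uncons_rV m).
Proof.
move=> [x v]; rewrite /uncons_rV cons_rV0; congr (_, _).
by apply/rowP => j; rewrite mxE cons_rVS.
Qed.

Lemma measurable_cons_rV m : measurable_fun [set: R * 'rV[R]_m] (@cons_rV m).
Proof.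
apply/measurable_fun_rVP => i; case: (unliftP ord0 i) => [j|] ->.
  under eq_fun do rewrite cons_rVS.
  exact: (measurableT_comp (measurable_coord j) measurable_snd).
under eq_fun do rewrite cons_rV0; exact: measurable_fst.
Qed.

Lemma measurable_uncons_rV m : measurable_fun [set: 'rV[R]_m.+1] (@uncons_rV m).
Proof.
apply/measurable_fun_pair; first exact: measurable_coord.
apply/measurable_fun_rVP => i; under eq_fun do rewrite mxE.
exact: measurable_coord.
Qed.

Definition leb_cons m (mu : {sigma_finite_measure set 'rV[R]_m -> \bar R}) :
    set 'rV[R]_m.+1 -> \bar R :=
  pushforward (@lebesgue_measure R \x mu)%E (@cons_rV m).

Section leb_cons_measure.
Variables (m : nat) (mu : {sigma_finite_measure set 'rV[R]_m -> \bar R}).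


Let leb_cons0 : leb_cons mu set0 = 0%E.
Proof. by rewrite /leb_cons /pushforward preimage_set0 measure0. Qed.

Let leb_cons_ge0 A : (0 <= leb_cons mu A)%E.
Proof. by rewrite /leb_cons /pushforward measure_ge0. Qed.

Let leb_cons_sigma_additive : semi_sigma_additive (leb_cons mu).
Proof.
have mpre (A : set 'rV[R]_m.+1) : measurable A -> measurable (@cons_rV m @^-1` A).
  by move=> mA; rewrite -[X in measurable X]setTI; exact: measurable_cons_rV.
move=> F mF tF mUF; rewrite /leb_cons /pushforward preimage_bigcup.
apply: measure_semi_sigma_additive.
- by move=> k; exact: mpre.
- apply/trivIsetP => /= i j _ _ ij; rewrite -preimage_setI.
  by move/trivIsetP : tF => /(_ _ _ _ _ ij) ->//; rewrite preimage_set0.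
- by rewrite -preimage_bigcup; exact: mpre.
Qed.

HB.instance Definition _ := isMeasure.Build _ _ _ (leb_cons mu)
  leb_cons0 leb_cons_ge0 leb_cons_sigma_additive.

Let leb_cons_sigma_finite : sigma_finite setT (leb_cons mu).
Proof.
have sf : sigma_finite setT (@lebesgue_measure R \x mu)%E.
  have /sigma_finiteP[F [TF ndF Foo]] := sigma_finiteT (@lebesgue_measure R).
  have /sigma_finiteP[G [TG ndG Goo]] := sigma_finiteT mu.
  exists (fun k => F k `*` G k).
    rewrite -setXTT TF TG; apply/seteqP; split => [[x y]|[x y]] /=.
      move=> [[k _ Fkx] [l _ Gly]]; exists (maxn k l) => //; split.
        by move: x Fkx; exact/subsetPset/ndF/leq_maxl.
      by move: y Gly; exact/subsetPset/ndG/leq_maxr.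
    by move=> [k _ [/= ? ?]]; split; exists k.
  move=> k; have [? ?] := Foo k; have [? ?] := Goo k.
  split; first exact: measurableX.
  by rewrite product_measure1E// lte_mul_pinfty// ge0_fin_numE.
have [F TF Foo] := sf.
exists (fun k => @uncons_rV m @^-1` F k).
  by rewrite -preimage_bigcup -TF preimage_setT.
move=> k; have [mF Fk] := Foo k; split.
  by rewrite -[X in measurable X]setTI; exact: measurable_uncons_rV.
rewrite /leb_cons /pushforward -comp_preimage.
rewrite (_ : @uncons_rV m \o _ = id) ?preimage_id//.
by apply/funext => p /=; rewrite cons_rVK.
Qed.

HB.instance Definition _ := Measure_isSigmaFinite.Build _ _ _ (leb_cons mu)
  leb_cons_sigma_finite.

End leb_cons_measure.

Fixpoint lebesgue_rV m : {sigma_finite_measure set 'rV[R]_m -> \bar R} :=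
  match m with
  | 0 => dirac (0 : 'rV[R]_0)
  | m'.+1 => leb_cons (lebesgue_rV m')
  end.

Lemma lebesgue_rV_box m (A : 'I_m -> set R) : (forall i, measurable (A i)) ->
  lebesgue_rV m [set v | forall i, A i (v ord0 i)] =
  (\prod_(i < m) lebesgue_measure (A i))%E.
Proof.
elim: m A => [|m IH] A mA.
  by rewrite big_ord0 /= diracE mem_set//= => -[].
rewrite big_ord_recl.
pose B := [set v : 'rV[R]_m | forall i, A (lift ord0 i) (v ord0 i)].
transitivity ((@lebesgue_measure R \x lebesgue_rV m)%E (A ord0 `*` B)).
  congr ((_ \x _)%E _); apply/seteqP; split => [p /= Ap|p /= [A0 AS] i].
    split; first by have := Ap ord0; rewrite cons_rV0.
    by move=> i; have := Ap (lift ord0 i); rewrite cons_rVS.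
  by case: (unliftP ord0 i) => [j|] ->; rewrite ?cons_rVS ?cons_rV0.
have mB : measurable B.
  rewrite (_ : B = \bigcap_(i in [set: 'I_m])
    (fun v : 'rV[R]_m => v ord0 i) @^-1` A (lift ord0 i)); last first.
    by apply/seteqP; split => v /= Bv i; [move=> _; exact: Bv|exact: Bv].
  apply: fin_bigcap_measurable => // i _.
  by rewrite -[X in measurable X]setTI; exact: measurable_coord.
rewrite -(IH (fun i => A (lift ord0 i)))//.
by rewrite -[RHS]product_measure1E; [by []|exact: mA|exact: mB].
Qed.

End lebesgue_rV.

(* A point of H^n is a row vector (x_1..x_n, y_1..y_n, t). *)
Notation heis R n := 'rV[R]_(n + n + 1).

Definition hQ (R : realType) (n : nat) : R := (2 * n + 2)%:R.

Section heisenberg.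
Context {R : realType} {n : nat}.
Implicit Types (xi eta : heis R n) (u g psi : heis R n -> R).

Definition hx xi : 'rV[R]_n := lsubmx (lsubmx xi).
Definition hy xi : 'rV[R]_n := rsubmx (lsubmx xi).
Definition ht xi : R := rsubmx xi ord0 ord0.

Definition dotv (v w : 'rV[R]_n) : R := \sum_i v ord0 i * w ord0 i.

Definition hmul xi eta : heis R n :=
  row_mx (row_mx (hx xi + hx eta) (hy xi + hy eta))
    (ht xi + ht eta + 2 * dotv (hy xi) (hx eta) - 2 * dotv (hx xi) (hy eta))%:M.

Definition hinv xi : heis R n := - xi.

Lemma hmulVg xi : hmul (hinv xi) xi = 0.
Proof.
have hxN : hx (- xi) = - hx xi by apply/rowP => i; rewrite !mxE.
have hyN : hy (- xi) = - hy xi by apply/rowP => i; rewrite !mxE.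
have htN : ht (- xi) = - ht xi by rewrite /ht !mxE.
rewrite /hmul /hinv hxN hyN htN !addNr add0r -mulrBr.
rewrite (_ : dotv _ _ - _ = 0) ?mulr0 ?raddf0 ?row_mx0//.
rewrite /dotv -sumrB big1// => i _.
by rewrite !mxE !mulNr [X in - X]mulrC subrr.
Qed.

Definition hnorm xi : R :=
  ((dotv (hx xi) (hx xi) + dotv (hy xi) (hy xi)) ^+ 2 + ht xi ^+ 2) `^ 4^-1.

Definition hdist xi eta : R := hnorm (hmul (hinv eta) xi).

Definition hball (xi0 : heis R n) (rho : R) : set (heis R n) :=
  [set xi | hdist xi xi0 < rho].

Definition hleb : {sigma_finite_measure set (heis R n) -> \bar R} :=
  lebesgue_rV (n + n + 1).

Definition partial (i : 'I_(n + n + 1)) u : heis R n -> R :=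
  fun xi => 'D_(delta_mx ord0 i : heis R n) u xi.

Fixpoint Ck (k : nat) u : Prop :=
  match k with
  | 0 => continuous u
  | k'.+1 => forall i,
      (forall xi, derivable u xi (delta_mx ord0 i : heis R n)) /\
      Ck k' (partial i u)
  end.

Definition smooth u : Prop := forall k, Ck k u.

Definition Cc_infty (Omega : set (heis R n)) u : Prop :=
  [/\ smooth u, compact (closure [set xi | u xi != 0]) &
      closure [set xi | u xi != 0] `<=` Omega].

Section fractional.
Variable s : R.
Local Open Scope ereal_scope.

(* On the (null) diagonal the kernel is 0, because 0^-1 = 0. *)
Definition hkernel xi eta : R := ((hdist xi eta `^ (hQ R n + 2 * s))^-1)%R.

Definition gagliardo2 u : \bar R :=
  \int[hleb \x hleb]_p
    (`|u p.1 - u p.2| ^+ 2 * hkernel p.1 p.2)%:E.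

Definition Hs_norm u : \bar R :=
  ('N[hleb]_2%:E[EFin \o u] ^+ 2 + gagliardo2 u) `^ 2^-1.

Definition Hs u : Prop :=
  [/\ measurable_fun setT u, 'N[hleb]_2%:E[EFin \o u] < +oo &
      gagliardo2 u < +oo].

(* W_0^{s,2}(Omega): the closure of C_0^infty(Omega) in H^s. *)
Definition Hs0 (Omega : set (heis R n)) u : Prop :=
  Hs u /\ forall e : R, (0 < e)%R ->
    exists phi, Cc_infty Omega phi /\ Hs_norm (u \- phi)%R < e%:E.

Definition hform u psi : \bar R :=
  \int[hleb \x hleb]_p
    ((u p.1 - u p.2) * (psi p.1 - psi p.2) * hkernel p.1 p.2)%:E.

Definition weak_supersolution (Omega : set (heis R n)) g u : Prop :=
  [/\ Hs u, Hs0 Omega ((g \- u)^\+)%R &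
      forall psi, Hs0 Omega psi -> {ae hleb, forall xi, (0 <= psi xi)%R} ->
        0 <= hform u psi].

Definition htail u (xi0 : heis R n) (rho : R) : \bar R :=
  (rho `^ (2 * s))%:E *
  \int[hleb]_(eta in ~` hball xi0 rho) (`|u eta| * hkernel xi0 eta)%:E.

End fractional.

(* Off D the function is set to +oo, so only its values on D count. *)
Definition ess_inf_on (D : set (heis R n)) u : \bar R :=
  ess_inf hleb (fun xi => if xi \in D then (u xi)%:E else +oo%E).

Definition power_mean (t : R) (D : set (heis R n)) u : \bar R :=
  (((hleb D)^-1 * \int[hleb]_(xi in D) (u xi `^ t)%:E) `^ t^-1)%E.

End heisenberg.

(* Main.v *)
(* Test the supersolution with [w = (l eta - u_+)_+], where [l > 0] is a level and
   [eta = (1 - |xi0^-1 xi|^4 / (2r)^4)_+]. Put [p = min (u_+, l eta)] and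
   [a = u_+ - p]; then [a w = 0], [l eta = p + w] and, primes denoting values at
   the second point,
     [(u - u')(w - w') <= (p - p')(w - w') - (a w' + a' w) + (u_-' w + u_- w')].
   The symmetric second differences of [eta] along [x h], [x h^-1] are bounded by
   [C (|h| / r)^2], hence the energy form satisfies [E(f, eta) <= C r^-2s int f]
   for [0 <= f <= l eta].
   (i) From [(p - p')(w - w') <= l (eta - eta')(w - w')] one gets
   [iint (a w' + a' w) K <= (C l r^-2s + tail) int w]; as [K >= c r^(-Q-2s)] on
   [B_2r x B_2r], either [w = 0] a.e., i.e. [u >= l / 2] on [B_(3r/2)], or the mean
   of [u_+] on [B_2r] is at most [C l + C r^2s tail]. So this mean is bounded by
   [C (inf u + r^2s tail)].
   (ii) From [(p - p')(w - w') = l (p - p')(eta - eta') - (p - p')^2] one gets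
   [[p]^2 <= C l r^(Q-2s) (inf u + r^2s tail)], and the fractional Sobolev
   inequality turns this into the weak-type estimate
   [|{u >= l} cap B_r| <= C r^Q ((inf u + r^2s tail) / l)^(Q / (Q - 2s))], which is
   summed over dyadic levels.
   Since [w] is not smooth, it is first replaced by averages of its left translates:
   these do not increase the energy, and they converge to [w] in [L^2], because
   averages of right translates are [L^2]-close to [w] by the energy alone. *)
Require Import Defs.
From HB Require Import structures.
From mathcomp Require Import all_boot all_order all_algebra.
From mathcomp Require Import all_classical all_reals all_analysis.
From mathcomp Require Import measurable_realfun ess_sup_inf lebesgue_integral_under.
From mathcomp Require Import ring lra.
Set Implicit Arguments.
Unset Strict Implicit.
Unset Printing Implicit Defensive.
Import Order.TTheory GRing.Theory Num.Theory.
Import numFieldNormedType.Exports.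
Local Open Scope classical_set_scope.
Local Open Scope ring_scope.

(** * Change of variables for the Lebesgue measure on row vectors *)

(** Against [|h|^(-Q-2s)] a first difference of a bump is integrable at [h = 0] only if [s < 1/2];
    second differences serve all [s] in [(0,1)]. The products in the expansion of
    [(f - f')(eta - eta')] diverge separately near the diagonal, so the kernel is first cut to
    [|h| >= e], where they may be split and regrouped; the bound does not see [e], and a limit
    theorem removes the cut. The fourth power in [eta] makes it a polynomial on its ball, so that
    its second differences can be computed exactly. The supersolution inequality is available for
    limits of smooth functions in the full norm, while the mollified [w] is only shown to converge
    in [L^2] with bounded energy. This suffices: [E(u, v)] is small once [v] is small in [L^2] and
    bounded in energy. The constant is chosen after [n], [s] and [t], so the factor [1 - s] of the
    tail term is absorbed by dividing by it. The infimum and the tail may both vanish while the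
    levels must be positive: the estimate is proved for their sum plus [d > 0], and [d] tends to 0
    at the end. *)

Section affine.
Context {R : realType}.
Local Notation mu := (@lebesgue_measure R).

Definition affine_map (a c : R) : measurableTypeR R -> measurableTypeR R :=
  fun x => a * x + c.

Lemma measurable_affine (a c : R) :
  measurable_fun [set: measurableTypeR R] (affine_map a c).
Proof.
by apply: measurable_funD => //; exact: measurable_funM.
Qed.

HB.instance Definition _ a c := @isMeasurableFun.Build _ _ _ _ (affine_map a c) (measurable_affine a c).

(** By uniqueness of the Lebesgue measure it is enough to compare both sides on half-open intervals.
    For [a < 0] the preimage is closed on the other side, which leaves its length unchanged. *)
Lemma lebesgue_measure_affine (a c : R) (A : set R) : a != 0 -> measurable A ->
  mu A = (`|a|%:nng%:num%:E * pushforward mu (affine_map a c) A)%E.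
Proof.
move=> a0 mA.
apply: (@lebesgue_measure_unique _ (mscale (`|a|%:nng) (pushforward mu ((affine_map a c))))) => //= _ [[u v]] _ <-.
rewrite /mscale/= /pushforward.
have [a_gt|a_lt|/eqP] := ltgtP a 0; last by rewrite (negPf a0).
- rewrite (_ : _ @^-1` _ = `[((v - c) / a), ((u - c) / a)[%classic); last first.
    apply/seteqP; split => x /=; rewrite /affine_map/=; rewrite !in_itv/= => /andP[h1 h2]; apply/andP; split.
    + by rewrite ler_ndivrMr// mulrC; lra.
    + by rewrite ltr_ndivlMr// mulrC; lra.
    + by move: h2; rewrite ltr_ndivlMr// mulrC; lra.
    + by move: h1; rewrite ler_ndivrMr// mulrC; lra.
  rewrite !lebesgue_measure_itv/= !lte_fin ltr_nM2r ?invr_lt0// ltrD2r.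
  case: ifPn => uv; last by rewrite mule0.
  rewrite -EFinM; congr EFin; rewrite ltr0_norm// -mulrBl mulrCA mulNr divff//; lra.
- rewrite (_ : _ @^-1` _ = `]((u - c) / a), ((v - c) / a)]%classic); last first.
    apply/seteqP; split => x /=; rewrite /affine_map/=; rewrite !in_itv/= => /andP[h1 h2]; apply/andP; split.
    + by rewrite ltr_pdivrMr// mulrC; lra.
    + by rewrite ler_pdivlMr// mulrC; lra.
    + by move: h1; rewrite ltr_pdivrMr// mulrC; lra.
    + by move: h2; rewrite ler_pdivlMr// mulrC; lra.
  rewrite !lebesgue_measure_itv/= !lte_fin ltr_pM2r ?invr_gt0// ltrD2r.
  case: ifPn => uv; last by rewrite mule0.
  rewrite -EFinM; congr EFin; rewrite gtr0_norm// -mulrBl mulrCA divff//; lra.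
Qed.

Lemma ge0_integral_affine (a c : R) (f : R -> \bar R) : a != 0 ->
  measurable_fun [set: R] f -> (forall x, 0 <= f x)%E ->
  (\int[mu]_x f (a * x + c)%R = (`|a|^-1)%:E * \int[mu]_x f x)%E.
Proof.
move=> a0 mf f0.
have -> : (\int[mu]_x f x = `|a|%:nng%:num%:E * \int[mu]_x f (a * x + c)%R)%E.
  have := ge0_integral_pushforward (measurable_affine a c) mu measurableT mf (fun x _ => f0 x).
  rewrite preimage_setT => <-.
  rewrite -ge0_integral_mscale//.
  by apply: eq_measure_integral => A mA _; exact: lebesgue_measure_affine.
by rewrite muleA -EFinM mulVf ?normr_eq0//= mul1e.
Qed.

Lemma ge0_integralZl_affine (C a c : R) (f : measurableTypeR R -> \bar R) :
  0 <= C -> a != 0 ->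
  measurable_fun [set: measurableTypeR R] f -> (forall x, 0 <= f x)%E ->
  (\int[mu]_x (C%:E * f (a * x + c)%R) = (C * `|a|^-1)%:E * \int[mu]_x f x)%E.
Proof.
move=> C0 a0 mf f0; rewrite ge0_integralZl//.
- by rewrite (ge0_integral_affine _ a0 mf f0) muleA -EFinM.
- exact: (measurableT_comp mf (measurable_affine a c)).
Qed.
End affine.

Section triangular.
Context {R : realType}.

Lemma ge0_integral_rVS m (f : 'rV[R]_m.+1 -> \bar R) :
  measurable_fun [set: 'rV[R]_m.+1] f -> (forall x, 0 <= f x)%E ->
  (\int[lebesgue_rV m.+1]_x f x =
   \int[lebesgue_measure]_x \int[lebesgue_rV m]_v f (cons_rV (x, v)))%E.
Proof.
move=> mf f0 /=; rewrite /leb_cons ge0_integral_pushforward//; last first.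
  exact: measurable_cons_rV.
rewrite preimage_setT fubini_tonelli1//; last by move=> x; exact: f0.
by apply: measurableT_comp => //; exact: measurable_cons_rV.
Qed.

Lemma cons_rV_eta m (v : 'rV[R]_m.+1) : 
  v = cons_rV (v ord0 ord0, \row_j v ord0 (lift ord0 j)).
Proof.
apply/rowP => i; case: (unliftP ord0 i) => [j|] ->.
  by rewrite cons_rVS mxE.
by rewrite cons_rV0.
Qed.

(** A triangular map has the product of its diagonal coefficients as Jacobian, with no regularity
    asked of the off-diagonal part beyond measurability. The induction peels off the first
    coordinate: it is mapped affinely, and once it is frozen the remaining ones undergo a triangular
    map in one dimension less. As the coordinate [t] comes last, the group maps used here have this
    shape. *)
Lemma ge0_integral_triangular m (a : 'I_m -> R) (T : 'rV[R]_m -> 'rV[R]_m)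
    (f : 'rV[R]_m -> \bar R) :
  (forall i, a i != 0) ->
  (forall (i : 'I_m) (x y : 'rV[R]_m), (forall j : 'I_m, (j < i)%N -> x ord0 j = y ord0 j) ->
     T x ord0 i - a i * x ord0 i = T y ord0 i - a i * y ord0 i) ->
  measurable_fun [set: 'rV[R]_m] T ->
  measurable_fun [set: 'rV[R]_m] f -> (forall x, 0 <= f x)%E ->
  (\int[lebesgue_rV m]_x f (T x) =
   (\prod_i `|a i|^-1)%:E * \int[lebesgue_rV m]_x f x)%E.
Proof.
elim: m a T f => [|m IH] a T f a0 aT mT mf f0.
  rewrite big_ord0 mul1e; apply: eq_integral => x _; congr (f _).
  by apply/rowP => -[].
have mfT : measurable_fun [set: 'rV[R]_m.+1] (fun x => f (T x)).
  exact: measurableT_comp.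
rewrite (ge0_integral_rVS mfT)// (ge0_integral_rVS mf)//.
pose c0 := T 0 ord0 ord0.
have T0 x : T x ord0 ord0 = a ord0 * x ord0 ord0 + c0.
  have /= := aT ord0 x 0 (fun j => ltac:(by [])).
  by rewrite mxE mulr0 subr0 -/c0 => <-; rewrite addrC subrK.
pose T' (x : R) (v : 'rV[R]_m) : 'rV[R]_m :=
  \row_j T (cons_rV (x, v)) ord0 (lift ord0 j).
pose G (z : measurableTypeR R) := (\int[lebesgue_rV m]_v f (cons_rV (z, v)))%E.
have mfc : measurable_fun [set: measurableTypeR R * 'rV[R]_m] (f \o @cons_rV R m).
  by apply: measurableT_comp => //; exact: measurable_cons_rV.
have mG : measurable_fun [set: measurableTypeR R] G.
  exact: (measurable_fun_fubini_tonelli_F (m2 := lebesgue_rV m) _ mfc (fun x => f0 _)).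
have G0 z : (0 <= G z)%E by exact: integral_ge0.
have step x : (\int[lebesgue_rV m]_v f (T (cons_rV (x, v))) =
   (\prod_(i < m) `|a (lift ord0 i)|^-1)%:E * G (a ord0 * x + c0)%R)%E.
  rewrite -(IH (fun i => a (lift ord0 i)) (T' x) (fun v => f (cons_rV (a ord0 * x + c0, v))))//.
  - apply: eq_integral => v _; congr f.
    rewrite [LHS]cons_rV_eta; congr (cons_rV (_, _)).
    by rewrite T0 cons_rV0.
  - move=> i v w vw; rewrite !mxE.
    have := aT (lift ord0 i) (cons_rV (x, v)) (cons_rV (x, w)).
    rewrite !cons_rVS; apply => j; case: (unliftP ord0 j) => [k|] -> //=.
      by rewrite !cons_rVS => ki; apply: vw; exact: ki.
    by rewrite !cons_rV0.
  - apply/measurable_fun_rVP => i; under eq_fun do rewrite mxE.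
    apply: (measurableT_comp (measurable_coord _)).
    apply: (measurableT_comp mT).
    by apply: (measurableT_comp (@measurable_cons_rV R m)); exact: measurable_pair1.
  - by apply: (measurableT_comp mfc); exact: measurable_pair1.
under eq_integral do rewrite step.
rewrite (ge0_integralZl_affine _ _ (a0 ord0) mG G0); last first.
  by apply: prodr_ge0 => i _; rewrite invr_ge0.
by rewrite big_ord_recl mulrC.
Qed.
End triangular.

(** * The Heisenberg group and its norm *)

Section group.
Context {R : realType} {n : nat}.
Implicit Types (a b c x y : heis R n) (v w : 'rV[R]_n).

Lemma dotvC v w : dotv v w = dotv w v.
Proof. by apply: eq_bigr => i _; rewrite mulrC. Qed.

Lemma dotvDl v v' w : dotv (v + v') w = dotv v w + dotv v' w.
Proof. by rewrite /dotv -big_split/=; apply: eq_bigr => i _; rewrite mxE mulrDl. Qed.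

Lemma dotvDr v w w' : dotv v (w + w') = dotv v w + dotv v w'.
Proof. by rewrite !(dotvC v) dotvDl. Qed.

Lemma dotvZl (l : R) v w : dotv (l *: v) w = l * dotv v w.
Proof. by rewrite /dotv mulr_sumr; apply: eq_bigr => i _; rewrite mxE mulrA. Qed.

Lemma dotvZr (l : R) v w : dotv v (l *: w) = l * dotv v w.
Proof. by rewrite dotvC dotvZl dotvC. Qed.

Lemma dotvNl v w : dotv (- v) w = - dotv v w.
Proof. by rewrite -scaleN1r dotvZl mulN1r. Qed.

Lemma dotvNr v w : dotv v (- w) = - dotv v w.
Proof. by rewrite dotvC dotvNl dotvC. Qed.

Lemma dotv0l w : dotv 0 w = 0.
Proof. by rewrite -(scale0r 0) dotvZl mul0r. Qed.

Lemma dotv0r v : dotv v 0 = 0.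
Proof. by rewrite dotvC dotv0l. Qed.

Lemma dotv_ge0 v : 0 <= dotv v v.
Proof. by apply: sumr_ge0 => i _; rewrite -expr2 sqr_ge0. Qed.

Lemma heisP a b : hx a = hx b -> hy a = hy b -> ht a = ht b -> a = b.
Proof.
rewrite /hx /hy /ht => hx1 hy1 ht1.
rewrite -[a]hsubmxK -[b]hsubmxK -[lsubmx a]hsubmxK -[lsubmx b]hsubmxK hx1 hy1.
by congr row_mx; apply/rowP => i; rewrite !ord1.
Qed.

Definition hpt v w (t : R) : heis R n := row_mx (row_mx v w) t%:M.

Lemma hx_pt v w t : hx (hpt v w t) = v.
Proof. by rewrite /hx !row_mxKl. Qed.
Lemma hy_pt v w t : hy (hpt v w t) = w.
Proof. by rewrite /hy row_mxKl row_mxKr. Qed.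
Lemma ht_pt v w t : ht (hpt v w t) = t.
Proof. by rewrite /ht row_mxKr mxE eqxx mulr1n. Qed.

Lemma hxM a b : hx (hmul a b) = hx a + hx b.
Proof. exact: hx_pt. Qed.
Lemma hyM a b : hy (hmul a b) = hy a + hy b.
Proof. exact: hy_pt. Qed.
Lemma htM a b : ht (hmul a b) =
  ht a + ht b + 2 * dotv (hy a) (hx b) - 2 * dotv (hx a) (hy b).
Proof. exact: ht_pt. Qed.

Lemma hxV a : hx (hinv a) = - hx a.
Proof. by apply/rowP => i; rewrite !mxE. Qed.
Lemma hyV a : hy (hinv a) = - hy a.
Proof. by apply/rowP => i; rewrite !mxE. Qed.
Lemma htV a : ht (hinv a) = - ht a.
Proof. by rewrite /ht !mxE. Qed.

Lemma hx0 : hx (0 : heis R n) = 0.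
Proof. by apply/rowP => i; rewrite !mxE. Qed.
Lemma hy0 : hy (0 : heis R n) = 0.
Proof. by apply/rowP => i; rewrite !mxE. Qed.
Lemma ht0 : ht (0 : heis R n) = 0.
Proof. by rewrite /ht !mxE. Qed.

Definition hE := (hxM, hyM, htM, hxV, hyV, htV, hx0, hy0, ht0, hx_pt, hy_pt, ht_pt).
Definition dotvE := (dotvDl, dotvDr, dotvNl, dotvNr, dotvZl, dotvZr, dotv0l, dotv0r).

Lemma hmulA : associative (@hmul R n).
Proof.
move=> a b c; apply: heisP; rewrite !hE ?addrA//.
by rewrite !dotvE; ring.
Qed.

Lemma hmul0l a : hmul 0 a = a.
Proof. by apply: heisP; rewrite !hE ?dotvE ?add0r//; ring. Qed.

Lemma hmul0r a : hmul a 0 = a.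
Proof. by apply: heisP; rewrite !hE ?dotvE ?addr0//; ring. Qed.

Lemma hinvK : involutive (@hinv R n).
Proof. by move=> a; rewrite /hinv opprK. Qed.

Lemma hmulgV a : hmul a (hinv a) = 0.
Proof. by rewrite -{1}(hinvK a) hmulVg. Qed.

Lemma hmulKg a b : hmul (hinv a) (hmul a b) = b.
Proof. by rewrite hmulA hmulVg hmul0l. Qed.
Lemma hmulVKg a b : hmul a (hmul (hinv a) b) = b.
Proof. by rewrite hmulA hmulgV hmul0l. Qed.
Lemma hmulgK a b : hmul (hmul b a) (hinv a) = b.
Proof. by rewrite -hmulA hmulgV hmul0r. Qed.
Lemma hinvM a b : hinv (hmul a b) = hmul (hinv b) (hinv a).
Proof.
apply: heisP; rewrite !hE ?dotvE ?opprD 1?addrC//.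
by rewrite (dotvC (hy b)) (dotvC (hx b)); ring.
Qed.

Definition hz2 a : R := dotv (hx a) (hx a) + dotv (hy a) (hy a).
Definition hnorm4 a : R := hz2 a ^+ 2 + ht a ^+ 2.

Lemma hz2_ge0 a : 0 <= hz2 a.
Proof. by rewrite addr_ge0// dotv_ge0. Qed.

Lemma hnorm4_ge0 a : 0 <= hnorm4 a.
Proof. by rewrite addr_ge0// sqr_ge0. Qed.

Lemma hnorm_ge0 a : 0 <= hnorm a.
Proof. exact: powR_ge0. Qed.

Lemma hnormX4 a : hnorm a ^+ 4 = hnorm4 a.
Proof.
by rewrite -powR_mulrn ?hnorm_ge0// /hnorm -powRrM mulVf ?pnatr_eq0// powRr1 ?hnorm4_ge0.
Qed.

Lemma hnormV a : hnorm (hinv a) = hnorm a.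
Proof. by rewrite /hnorm !hE !dotvE !opprK sqrrN. Qed.

Lemma hnorm0 : hnorm (0 : heis R n) = 0.
Proof. by rewrite /hnorm !hE !dotvE addr0 expr0n/= addr0 powR0// invr_eq0 pnatr_eq0. Qed.

Lemma hz2_le a : hz2 a <= hnorm a ^+ 2.
Proof.
rewrite -(@ler_sqr R) ?nnegrE ?hz2_ge0 ?sqr_ge0// -exprM hnormX4.
by rewrite lerDl sqr_ge0.
Qed.

Lemma ht_le a : `|ht a| <= hnorm a ^+ 2.
Proof.
rewrite -(@ler_sqr R) ?nnegrE ?normr_ge0 ?sqr_ge0// -exprM hnormX4 real_normK ?num_real//.
by rewrite lerDr sqr_ge0.
Qed.

Definition hre a b : R := dotv (hx a) (hx b) + dotv (hy a) (hy b).
Definition him a b : R := dotv (hy a) (hx b) - dotv (hx a) (hy b).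

(* Cauchy-Schwarz for the complex vectors [hx + i hy]. *)
Lemma hre_him_le a b : hre a b ^+ 2 + him a b ^+ 2 <= hz2 a * hz2 b.
Proof.
set c := hre a b; set w := him a b.
(* In complex notation [X + i Y = |b|^2 a - <a, b> b], where [<a, b> = c + i w]. This is [|b|^2]
   times the component of [a] orthogonal to [b], and its square norm is [|b|^2] times the defect in
   the inequality. *)
pose X := hz2 b *: hx a - c *: hx b + w *: hy b.
pose Y := hz2 b *: hy a - c *: hy b - w *: hx b.
have : 0 <= dotv X X + dotv Y Y by rewrite addr_ge0// dotv_ge0.
have -> : dotv X X + dotv Y Y = hz2 b * (hz2 a * hz2 b - (c ^+ 2 + w ^+ 2)).
  rewrite /X /Y !dotvE /c /w /hre /him /hz2.
  rewrite (dotvC (hx b) (hx a)) (dotvC (hy b) (hx a)) (dotvC (hx b) (hy a)).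
  by rewrite (dotvC (hy b) (hy a)) (dotvC (hy b) (hx b)); ring.
have [b0|b0] := ltrP 0 (hz2 b); first by rewrite pmulr_rge0// subr_ge0.
move=> _.
have /eqP : hz2 b = 0 by apply/eqP; rewrite eq_le b0 hz2_ge0.
rewrite paddr_eq0 ?dotv_ge0// => /andP[xb yb].
have d0 v : dotv v v == 0 -> v = 0.
  rewrite psumr_eq0; last by move=> i _; rewrite -expr2 sqr_ge0.
  move=> /allP v0; apply/rowP => i; rewrite mxE; apply/eqP.
  by have := v0 i (mem_index_enum _); rewrite mulf_eq0 orbb.
rewrite /c /w /hre /him (d0 _ xb) (d0 _ yb) !dotv0r !(addr0, subr0) expr0n/= addr0.
by rewrite mulr_ge0 ?hz2_ge0.
Qed.

Lemma plane_triangle (u1 u2 v1 v2 p q : R) : 0 <= p -> 0 <= q ->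
  u1 ^+ 2 + u2 ^+ 2 <= p ^+ 2 -> v1 ^+ 2 + v2 ^+ 2 <= q ^+ 2 ->
  (u1 + v1) ^+ 2 + (u2 + v2) ^+ 2 <= (p + q) ^+ 2.
Proof.
move=> p0 q0 up vq.
have : (u1 * v1 + u2 * v2) <= p * q.
  apply: le_trans (ler_norm _) _.
  rewrite -(@ler_sqr R) ?nnegrE ?normr_ge0 ?mulr_ge0// real_normK ?num_real//.
  apply: (@le_trans _ _ ((u1 ^+ 2 + u2 ^+ 2) * (v1 ^+ 2 + v2 ^+ 2))).
    rewrite -subr_ge0 [leRHS](_ : _ = (u1 * v2 - u2 * v1) ^+ 2) ?sqr_ge0//; ring.
  by rewrite exprMn ler_pM// addr_ge0// sqr_ge0.
by move=> h; nra.
Qed.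

(** The complex number [hz2 a + i ht a] has modulus [hnorm a ^+ 2]. For a product it is the sum of
    those of the two factors and of twice the Hermitian product [hre a b + i him a b], whose modulus
    is at most [hnorm a * hnorm b]. The triangle inequality in the plane then gives the square of
    [hnorm a + hnorm b]. *)
Lemma hnorm_triangle a b : hnorm (hmul a b) <= hnorm a + hnorm b.
Proof.
have [a0 b0] := (hnorm_ge0 a, hnorm_ge0 b).
rewrite -(@ler_pXn2r _ 4)// ?nnegrE ?hnorm_ge0 ?addr_ge0// hnormX4.
have -> : hnorm4 (hmul a b) = (hz2 a + (hz2 b + 2 * hre a b)) ^+ 2 +
    (ht a + (ht b + 2 * him a b)) ^+ 2.
  rewrite /hnorm4 /hz2 !hE !dotvE /hre /him.
  by rewrite (dotvC (hx b) (hx a)) (dotvC (hy b) (hy a)); ring.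
rewrite (_ : (hnorm a + hnorm b) ^+ 4 =
  (hnorm a ^+ 2 + (hnorm b ^+ 2 + 2 * (hnorm a * hnorm b))) ^+ 2); last by ring.
have sq c : hz2 c ^+ 2 + ht c ^+ 2 <= (hnorm c ^+ 2) ^+ 2.
  by rewrite -exprM hnormX4.
apply: plane_triangle => //; rewrite ?sqr_ge0 ?addr_ge0 ?mulr_ge0 ?sqr_ge0//.
apply: plane_triangle => //; rewrite ?sqr_ge0 ?addr_ge0 ?mulr_ge0 ?sqr_ge0//.
rewrite !exprMn -mulrDr ler_pM2l ?exprn_gt0//.
apply: le_trans (hre_him_le a b) _.
by rewrite ler_pM ?hz2_ge0 ?hz2_le.
Qed.

Lemma hdistC a b : hdist a b = hdist b a.
Proof. by rewrite /hdist -hnormV hinvM hinvK. Qed.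

Lemma hdist_triangle b a c : hdist a c <= hdist a b + hdist b c.
Proof.
rewrite /hdist addrC; apply: le_trans (hnorm_triangle _ _).
by rewrite hmulA hmulgK.
Qed.

Lemma hdistM c a b : hdist (hmul c a) (hmul c b) = hdist a b.
Proof. by rewrite /hdist hinvM -hmulA hmulKg. Qed.

Lemma hdist_ge0 a b : 0 <= hdist a b.
Proof. exact: hnorm_ge0. Qed.

Lemma hdistMr a b : hdist (hmul a b) a = hnorm b.
Proof. by rewrite /hdist hmulKg. Qed.

(* [h |-> hnorm4 (x h)] is the square of an affine function of [h] plus small
   terms, and [h^-1 = - h]: in the symmetric second difference the odd part
   cancels. *)
Lemma hnorm4_second_diff x h :
  hnorm4 (hmul x h) + hnorm4 (hmul x (hinv h)) - 2 * hnorm4 x <=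
  28 * hnorm x ^+ 2 * hnorm h ^+ 2 + 4 * hnorm h ^+ 4.
Proof.
have -> : hnorm4 (hmul x h) + hnorm4 (hmul x (hinv h)) - 2 * hnorm4 x =
  4 * hz2 x * hz2 h + 2 * hz2 h ^+ 2 + 8 * hre x h ^+ 2 +
  2 * (ht h + 2 * him x h) ^+ 2.
  rewrite /hnorm4 /hz2 !hE !dotvE /hre /him.
  by rewrite (dotvC (hx h) (hx x)) (dotvC (hy h) (hy x)); ring.
have cs := hre_him_le x h.
have [r0 i0] := (sqr_ge0 (hre x h), sqr_ge0 (him x h)).
have zz : hz2 x * hz2 h <= hnorm x ^+ 2 * hnorm h ^+ 2.
  by rewrite ler_pM ?hz2_ge0 ?hz2_le.
have sq : hnorm h ^+ 4 = hz2 h ^+ 2 + ht h ^+ 2 by rewrite hnormX4.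
have : (ht h + 2 * him x h) ^+ 2 <= 2 * ht h ^+ 2 + 8 * him x h ^+ 2.
  have := sqr_ge0 (ht h - 2 * him x h); nra.
rewrite sq; have := sqr_ge0 (hz2 h); have := sqr_ge0 (ht h); nra.
Qed.

End group.

(** * Invariance of the Lebesgue measure *)

Section heis_measure.
Context {R : realType} {n : nat}.
Local Notation H := (heis R n).
Local Notation mu := (@hleb R n).

Lemma hx_coord (x : H) j : hx x ord0 j = x ord0 (lshift 1 (lshift n j)).
Proof. by rewrite !mxE. Qed.
Lemma hy_coord (x : H) j : hy x ord0 j = x ord0 (lshift 1 (rshift n j)).
Proof. by rewrite !mxE. Qed.
Lemma ht_coord (x : H) : ht x = x ord0 (rshift (n + n) ord0).
Proof. by rewrite /ht !mxE. Qed.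

Lemma heis_ordP (P : 'I_(n + n + 1) -> Prop) :
  (forall j, P (lshift 1 (lshift n j))) -> (forall j, P (lshift 1 (rshift n j))) ->
  P (rshift (n + n) ord0) -> forall i, P i.
Proof.
move=> Px Py Pt i; case: (split_ordP i) => j ->; last by rewrite ord1.
by case: (split_ordP j) => k ->.
Qed.

Section measurability.
Context d (T : measurableType d).
Implicit Types (f g : T -> H).

Lemma measurable_heisP f :
  (forall j, measurable_fun setT (fun x => hx (f x) ord0 j)) ->
  (forall j, measurable_fun setT (fun x => hy (f x) ord0 j)) ->
  measurable_fun setT (fun x => ht (f x)) ->
  measurable_fun [set: T] f.
Proof.
move=> mx my mt; apply/measurable_fun_rVP; apply: heis_ordP => [j|j|].
- by under eq_fun do rewrite -hx_coord; exact: mx.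
- by under eq_fun do rewrite -hy_coord; exact: my.
- by under eq_fun do rewrite -ht_coord; exact: mt.
Qed.

Lemma measurable_hx f j : measurable_fun setT f ->
  measurable_fun setT (fun x => hx (f x) ord0 j).
Proof.
move=> mf; under eq_fun do rewrite hx_coord.
by move/measurable_fun_rVP : mf; exact.
Qed.

Lemma measurable_hy f j : measurable_fun setT f ->
  measurable_fun setT (fun x => hy (f x) ord0 j).
Proof.
move=> mf; under eq_fun do rewrite hy_coord.
by move/measurable_fun_rVP : mf; exact.
Qed.

Lemma measurable_ht f : measurable_fun setT f ->
  measurable_fun setT (fun x => ht (f x)).
Proof.
move=> mf; under eq_fun do rewrite ht_coord.
by move/measurable_fun_rVP : mf; exact.
Qed.

Lemma measurable_dotv (v w : T -> 'rV[R]_n) :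
  (forall j, measurable_fun setT (fun x => v x ord0 j)) ->
  (forall j, measurable_fun setT (fun x => w x ord0 j)) ->
  measurable_fun setT (fun x => dotv (v x) (w x)).
Proof.
move=> mv mw; rewrite /dotv.
by apply: measurable_sum => i; exact: measurable_funM.
Qed.

Lemma measurable_hmul f g : measurable_fun setT f -> measurable_fun setT g ->
  measurable_fun setT (fun x => hmul (f x) (g x)).
Proof.
move=> mf mg; apply: measurable_heisP => [j|j|].
- under eq_fun do rewrite !hE mxE.
  by apply: measurable_funD; exact: measurable_hx.
- under eq_fun do rewrite !hE mxE.
  by apply: measurable_funD; exact: measurable_hy.
- under eq_fun do rewrite !hE.
  apply: measurable_funB.
    apply: measurable_funD.
      by apply: measurable_funD; exact: measurable_ht.
    apply: measurable_funM => //; apply: measurable_dotv => j.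
      exact: measurable_hy.
    exact: measurable_hx.
  apply: measurable_funM => //; apply: measurable_dotv => j.
    exact: measurable_hx.
  exact: measurable_hy.
Qed.

Lemma measurable_hinv f : measurable_fun setT f ->
  measurable_fun setT (fun x => hinv (f x)).
Proof.
move=> mf; apply: measurable_heisP => [j|j|].
- under eq_fun do rewrite !hE mxE.
  by apply: measurableT_comp => //; exact: measurable_hx.
- under eq_fun do rewrite !hE mxE.
  by apply: measurableT_comp => //; exact: measurable_hy.
- under eq_fun do rewrite !hE.
  by apply: measurableT_comp => //; exact: measurable_ht.
Qed.

Lemma measurable_hnorm f : measurable_fun setT f ->
  measurable_fun setT (fun x => hnorm (f x)).
Proof.
move=> mf; rewrite /hnorm.
apply: (measurableT_comp (measurable_powR _)).
apply: measurable_funD; last by apply: measurable_funX; exact: measurable_ht.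
apply: measurable_funX; apply: measurable_funD; apply: measurable_dotv => j;
  first [exact: measurable_hx|exact: measurable_hy].
Qed.

Lemma measurable_hdist f g : measurable_fun setT f -> measurable_fun setT g ->
  measurable_fun setT (fun x => hdist (f x) (g x)).
Proof.
move=> mf mg; apply: measurable_hnorm; apply: measurable_hmul => //.
exact: measurable_hinv.
Qed.
End measurability.

Lemma measurable_hball (x : H) r : measurable (hball x r).
Proof.
rewrite /hball -[X in measurable X]setTI.
apply: (@measurable_fun_ltr _ _ _ _ (fun y => hdist y x) (cst r)) => //.
by apply: measurable_hdist.
Qed.

(** A common form for left translations, for [x^-1 a] and for dilations: the vertical coordinate is
    sheared by an arbitrary function [phi] of the horizontal ones, which does not affect the
    Jacobian. *)
Lemma ge0_integral_hmap (al be : R) (v w : 'rV[R]_n) (phi : 'rV[R]_n -> 'rV[R]_n -> R)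
    (T : H -> H) (f : H -> \bar R) :
  al != 0 -> be != 0 ->
  (forall x, T x = hpt (al *: hx x + v) (al *: hy x + w)
                       (be * ht x + phi (hx x) (hy x))) ->
  measurable_fun setT T -> measurable_fun setT f -> (forall x, 0 <= f x)%E ->
  (\int[mu]_x f (T x) = (`|al| ^- (n + n) * `|be|^-1)%:E * \int[mu]_x f x)%E.
Proof.
move=> al0 be0 TE mT mf f0.
pose a (i : 'I_(n + n + 1)) := if (i < n + n)%N then al else be.
rewrite /hleb (@ge0_integral_triangular _ _ a)//.
- congr (_%:E * _)%E; rewrite big_split_ord/= big_ord1; congr (_ * _).
    rewrite (eq_bigr (fun=> `|al|^-1)); last by move=> i _; rewrite /a/= ltn_ord.
    by rewrite prodr_const card_ord exprVn.
  by rewrite /a/= addn0 ltnn.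
- by move=> i; rewrite /a; case: ifP.
- apply: heis_ordP => [j|j|] x y xy.
  + by rewrite !TE -!hx_coord !hx_pt !mxE /a/= ltn_addr//; lra.
  + by rewrite !TE -!hy_coord !hy_pt !mxE /a/= ltn_add2l ltn_ord//; lra.
  + rewrite !TE -!ht_coord !ht_pt /a/= addn0 ltnn.
    have -> : hx x = hx y.
      by apply/rowP => j; rewrite !hx_coord; apply: xy => /=; rewrite addn0 ltn_addr.
    have -> : hy x = hy y.
      by apply/rowP => j; rewrite !hy_coord; apply: xy => /=; rewrite addn0 ltn_add2l.
    by lra.
Qed.

Lemma ge0_integral_hmul (a : H) (f : H -> \bar R) :
  measurable_fun setT f -> (forall x, 0 <= f x)%E ->
  (\int[mu]_x f (hmul a x) = \int[mu]_x f x)%E.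
Proof.
move=> mf f0.
rewrite (@ge0_integral_hmap 1 1 (hx a) (hy a)
  (fun v w => ht a + 2 * dotv (hy a) v - 2 * dotv (hx a) w))//.
- by rewrite normr1 expr1n invr1 mul1r mul1e.
- move=> x; rewrite !scale1r mul1r /hmul /hpt; congr (row_mx (row_mx _ _) _%:M).
  + by rewrite addrC.
  + by rewrite addrC.
  + by ring.
- exact: measurable_hmul.
Qed.

Lemma ge0_integral_hmulV (a : H) (f : H -> \bar R) :
  measurable_fun setT f -> (forall x, 0 <= f x)%E ->
  (\int[mu]_x f (hmul (hinv x) a) = \int[mu]_x f x)%E.
Proof.
move=> mf f0.
rewrite (@ge0_integral_hmap (-1) (-1) (hx a) (hy a)
  (fun v w => ht a - 2 * dotv w (hx a) + 2 * dotv v (hy a)))//.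
- by rewrite normrN normr1 expr1n invr1 mul1r mul1e.
- by move=> x; apply: heisP; rewrite !hE ?dotvE ?scaleN1r//; ring.
- by apply: measurable_hmul => //; exact: measurable_hinv.
Qed.

Lemma ge0_integral_hinv (f : H -> \bar R) :
  measurable_fun setT f -> (forall x, 0 <= f x)%E ->
  (\int[mu]_x f (hinv x) = \int[mu]_x f x)%E.
Proof.
move=> mf f0; rewrite -(ge0_integral_hmulV 0 mf f0).
by apply: eq_integral => x _; rewrite hmul0r.
Qed.

Definition hdil (l : R) (x : H) : H := hpt (l *: hx x) (l *: hy x) (l ^+ 2 * ht x).

Lemma hnorm_dil l x : 0 <= l -> hnorm (hdil l x) = l * hnorm x.
Proof.
move=> l0; apply/eqP; rewrite -(@eqrXn2 _ 4)// ?mulr_ge0 ?hnorm_ge0//.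
rewrite exprMn !hnormX4 /hnorm4 /hz2 !hE !dotvE; apply/eqP; ring.
Qed.

Lemma measurable_hdil l : measurable_fun setT (hdil l).
Proof.
apply: measurable_heisP => [j|j|].
- under eq_fun do rewrite !hE mxE.
  by apply: measurable_funM => //; exact: measurable_hx.
- under eq_fun do rewrite !hE mxE.
  by apply: measurable_funM => //; exact: measurable_hy.
- under eq_fun do rewrite !hE.
  by apply: measurable_funM => //; exact: measurable_ht.
Qed.

Lemma ge0_integral_hdil (l : R) (f : H -> \bar R) : 0 < l ->
  measurable_fun setT f -> (forall x, 0 <= f x)%E ->
  (\int[mu]_x f (hdil l x) = (l ^- (2 * n + 2))%:E * \int[mu]_x f x)%E.
Proof.
move=> l0 mf f0.
rewrite (@ge0_integral_hmap l (l ^+ 2) 0 0 (fun=> cst 0))//.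
- congr (_%:E * _)%E; rewrite !gtr0_norm ?exprn_gt0// -invfM -exprD.
  by rewrite mul2n addnn.
- by rewrite gt_eqF.
- by rewrite gt_eqF ?exprn_gt0.
- by move=> x; rewrite !addr0.
- exact: measurable_hdil.
Qed.

End heis_measure.

(** * Dyadic sums, balls and the kernel *)

Section dyadic.
Context d {T : measurableType d} {R : realType}.
Variable mu : {measure set T -> \bar R}.
Local Open Scope ereal_scope.

(** [g] is dominated by the sum of the functions equal to [c j] on [A j] and 0 elsewhere, whatever
    the overlaps of the [A j]; a geometric series bounds the integral of the sum. Applied to balls
    containing dyadic annuli for the kernel, and to superlevel sets for the final summation. *)
Lemma dyadic_integral (D : set T) (g : T -> R) (A : nat -> set T) (c : nat -> R)
    (B q : R) : measurable D -> measurable_fun D g ->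
  (forall x, D x -> 0 <= g x)%R -> (forall j, measurable (A j)) ->
  (forall j, 0 <= c j)%R ->
  (forall x, D x -> exists j, A j x /\ (g x <= c j)%R) ->
  (forall j, (c j)%:E * mu (A j) <= (B * q ^+ j)%:E) -> (0 <= q < 1)%R ->
  \int[mu]_(x in D) (g x)%:E <= (B / (1 - q))%:E.
Proof.
move=> mD mg g0 mA c0 gA cA /andP[q0 q1].
pose f (j : nat) x := ((c j) * \1_(A j) x)%:E.
have mf j : measurable_fun D (f j).
  apply/measurable_EFinP; apply: measurable_funM => //.
have f0 j x : D x -> 0 <= f j x by rewrite lee_fin mulr_ge0.
apply: (@le_trans _ _ (\int[mu]_(x in D) \big[+%E/0]_(0 <= j <oo) f j x)).
  apply: ge0_le_integral => //.
  - exact/measurable_EFinP.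
  - by apply: ge0_emeasurable_sum => // j x Dx _; exact: f0.
  - move=> x Dx; have [j [Ajx gx]] := gA x Dx.
    apply: (@le_trans _ _ (\sum_(0 <= i < j.+1) f i x)).
      rewrite big_nat_recr//=; apply: (@le_trans _ _ (f j x)).
        by rewrite /f indicE mem_set// mulr1 lee_fin.
      by rewrite leeDr//; apply: sume_ge0 => i _; exact: f0.
    by apply: nneseries_lim_ge => i _ _; exact: f0.
rewrite integral_nneseries//.
apply: (@le_trans _ _ (\big[+%E/0]_(0 <= j <oo) (B * q ^+ j)%:E)).
  apply: lee_nneseries => [j _ _|j _].
    by apply: integral_ge0 => x Dx; exact: f0.
  apply: le_trans (cA j); rewrite /f.
  under eq_integral do rewrite EFinM.
  rewrite ge0_integralZl//.
  - rewrite integral_indic//; apply: lee_pmul => //; rewrite ?lee_fin//.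
    by apply: le_measure; rewrite ?inE//; exact: measurableI.
  - by apply/measurable_EFinP; exact: measurable_indic.
  - by rewrite lee_fin.
have B0 : (0 <= B)%R.
  have := cA 0%N; rewrite expr0 mulr1 -lee_fin; apply: le_trans.
  by apply: mule_ge0 => //; rewrite lee_fin.
apply: lime_le.
  by apply: is_cvg_nneseries => j _ _; rewrite lee_fin mulr_ge0// exprn_ge0.
apply: nearW => N; rewrite sumEFin lee_fin.
have := @geometric_seriesE _ B q; rewrite lt_eqF// => /(_ isT)/(congr1 (fun s => s N)).
rewrite /series/= => ->; rewrite ler_pM2r ?invr_gt0 ?subr_gt0// -[leRHS]mulr1.
by rewrite ler_wpM2l// gerBl exprn_ge0.
Qed.

End dyadic.

Lemma dyadic_ex {R : realType} (x : R) : 1 <= x ->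
  exists j : nat, 2 ^+ j <= x < 2 ^+ j.+1.
Proof.
move=> x1.
have [N xN] : exists N : nat, x < 2 ^+ N.
  exists (Num.bound x); apply: lt_le_trans (archi_boundP (le_trans ler01 x1)) _.
  by rewrite -natrX ler_nat ltnW// ltn_expl.
case: (ex_minnP (ex_intro (fun N : nat => x < 2 ^+ N) N xN)) => -[|m].
  by rewrite expr0 ltNge x1.
move=> xm mmin; exists m; rewrite xm andbT leNgt; apply/negP => /mmin.
by rewrite ltnn.
Qed.

Section ball_measure.
Context {R : realType} {n : nat}.
Local Notation H := (heis R n).
Local Notation mu := (@hleb R n).

Definition hvol : R := fine (mu (hball 0 1)).

Lemma hball0E r : hball (0 : H) r = [set x | hnorm x < r].
Proof.
apply/seteqP; split => x; rewrite /hball /hdist/= => xr.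
  by move: xr; rewrite (_ : hinv 0 = 0) ?hmul0l// /hinv oppr0.
by rewrite (_ : hinv 0 = 0) ?hmul0l// /hinv oppr0.
Qed.

Lemma hnorm_lt r x : 0 <= r -> (hnorm (x : H) < r) = (hnorm4 x < r ^+ 4).
Proof. by move=> r0; rewrite -hnormX4 ltr_pXn2r// ?nnegrE ?hnorm_ge0. Qed.

Lemma mu_hball1_fin : (mu (hball 0 1) < +oo)%E.
Proof.
pose B := [set v : H | forall i, v ord0 i \in `[(-1 : R), 1]].
apply: (@le_lt_trans _ _ (mu B)).
  have mB : measurable B.
    rewrite (_ : B = \bigcap_(i in [set: 'I_(n + n + 1)])
      (fun v : H => v ord0 i) @^-1` `[(-1 : R), 1]); last first.
      by apply/seteqP; split => v /= Bv i; [move=> _; exact: Bv|exact: Bv].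
    apply: fin_bigcap_measurable => // i _.
    by rewrite -[X in measurable X]setTI; exact: measurable_coord.
  apply: le_measure; rewrite ?inE//; first exact: measurable_hball.
  rewrite hball0E => x /= x1; have z1 : hz2 x <= 1.
    by rewrite (le_trans (hz2_le x))// exprn_ile1 ?hnorm_ge0// ltW.
  have t1 : `|ht x| <= 1.
    by rewrite (le_trans (ht_le x))// exprn_ile1 ?hnorm_ge0// ltW.
  have le1 (v : 'rV[R]_n) j : dotv v v <= 1 -> v ord0 j \in `[(-1 : R), 1].
    move=> v1; rewrite in_itv/= -ler_norml.
    rewrite -(@ler_sqr R) ?nnegrE// real_normK ?num_real// expr1n.
    apply: le_trans v1; rewrite /dotv (bigD1 j)//= -expr2 lerDl.
    by apply: sumr_ge0 => i _; rewrite -expr2 sqr_ge0.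
  have [zx zy] := (dotv_ge0 (hx x), dotv_ge0 (hy x)).
  apply: heis_ordP => [j|j|].
  - by rewrite -hx_coord; apply: le1; move: z1; rewrite /hz2; lra.
  - by rewrite -hy_coord; apply: le1; move: z1; rewrite /hz2; lra.
  - by rewrite -ht_coord in_itv/= -ler_norml.
rewrite /hleb /B (@lebesgue_rV_box _ _ (fun=> [set` `[(-1 : R), 1]]))//.
under eq_bigr do rewrite lebesgue_measure_itv/= lte_fin gtrN ?ltr01// -EFinB.
by rewrite prodEFin ltry.
Qed.

Lemma mu_hball1_gt0 : (0 < mu (hball 0 1))%E.
Proof.
(* The cube of half-side [e] lies in the unit ball: on it [hz2 <= 2 n e^2 <= e] and [ht^2 <= e^2],
   so [hnorm4 <= 2 e^2 < 1] because [e <= 1/2]. *)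
pose e : R := (2 * n + 2)%:R^-1.
have e0 : 0 < e by rewrite invr_gt0 ltr0n addn2.
pose B := [set v : H | forall i, v ord0 i \in `[- e, e]].
have mB : measurable B.
  rewrite (_ : B = \bigcap_(i in [set: 'I_(n + n + 1)])
    (fun v : H => v ord0 i) @^-1` `[- e, e]); last first.
    by apply/seteqP; split => v /= Bv i; [move=> _; exact: Bv|exact: Bv].
  apply: fin_bigcap_measurable => // i _.
  by rewrite -[X in measurable X]setTI; exact: measurable_coord.
apply: (@lt_le_trans _ _ (mu B)).
  rewrite /hleb /B (@lebesgue_rV_box _ _ (fun=> [set` `[- e, e]]))//.
  under eq_bigr do rewrite lebesgue_measure_itv/= lte_fin gtrN// -EFinB.
  rewrite prodEFin lte_fin; apply: prodr_gt0 => i _; lra.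
apply: le_measure; rewrite ?inE//; first exact: measurable_hball.
rewrite hball0E => x /= Bx; rewrite hnorm_lt// expr1n /hnorm4.
have e2 : e <= 2^-1 by rewrite lef_pV2 ?posrE ?ltr0n ?addn2// ler_nat.
have ne : (2 * n)%:R * e <= 1.
  by rewrite /e ler_pdivrMr ?ltr0n ?addn2// mul1r ler_nat leqW.
have le_sq (a : R) : a \in `[- e, e] -> a ^+ 2 <= e ^+ 2.
  rewrite in_itv/= -ler_norml => ae; rewrite -real_normK ?num_real//.
  by rewrite ler_sqr ?nnegrE// ltW.
have dle (v : 'rV[R]_n) : (forall j, v ord0 j \in `[- e, e]) -> dotv v v <= n%:R * e ^+ 2.
  move=> ve; rewrite /dotv mulr_natl -[X in _ *+ X]card_ord -sumr_const.
  by apply: ler_sum => i _; rewrite -expr2; exact: le_sq.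
have hxe : dotv (hx x) (hx x) <= n%:R * e ^+ 2.
  by apply: dle => j; rewrite hx_coord; exact: Bx.
have hye : dotv (hy x) (hy x) <= n%:R * e ^+ 2.
  by apply: dle => j; rewrite hy_coord; exact: Bx.
have hte : ht x ^+ 2 <= e ^+ 2 by apply: le_sq; rewrite ht_coord; exact: Bx.
have z0 := hz2_ge0 x.
have ze : hz2 x <= e.
  move: ne; rewrite natrM => ne; rewrite /hz2; nra.
nra.
Qed.

Lemma hvol_gt0 : 0 < hvol.
Proof. by rewrite fine_gt0// mu_hball1_gt0 mu_hball1_fin. Qed.

Lemma mu_hball (x : H) r : 0 < r -> mu (hball x r) = (hvol * r ^+ (2 * n + 2))%:E.
Proof.
move=> r0.
have mi (y : H) t : measurable_fun setT (fun z : H => (\1_(hball y t) z : R)%:E).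
  by apply/measurable_EFinP; apply: measurable_indic; exact: measurable_hball.
rewrite -[X in mu X]setIT -integral_indic//; last exact: measurable_hball.
rewrite -(ge0_integral_hmul x)//.
have -> : (\int[mu]_z (\1_(hball x r) (hmul x z))%:E = \int[mu]_z (\1_(hball 0 1) (hdil r^-1 z))%:E)%E.
  apply: eq_integral => z _; congr (_%:E); rewrite !indicE; congr (nat_of_bool _)%:R.
  rewrite hball0E; apply/idP/idP; rewrite !inE /hball/= hdistMr hnorm_dil ?invr_ge0 ?(ltW r0)//.
    by rewrite mulrC ltr_pdivrMr// mul1r.
  by rewrite mulrC ltr_pdivrMr// mul1r.
rewrite (ge0_integral_hdil (f := fun z => (\1_(hball 0 1) z)%:E)) ?invr_gt0//.
rewrite integral_indic//; last exact: measurable_hball.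
by rewrite setIT -exprVn invrK mulrC EFinM fineK// ge0_fin_numE// mu_hball1_fin.
Qed.

End ball_measure.

Lemma invr_powR_anti {R : realType} (a b p : R) : 0 <= p -> 0 < a -> a <= b ->
  (b `^ p)^-1 <= (a `^ p)^-1.
Proof.
move=> p0 a0 ab; have b0 := lt_le_trans a0 ab.
rewrite lef_pV2 ?posrE ?powR_gt0//.
by apply: ge0_ler_powR; rewrite ?nnegrE ?(ltW a0) ?(ltW b0).
Qed.

Section kernel.
Context {R : realType} {n : nat}.
Local Notation H := (heis R n).
Local Notation mu := (@hleb R n).
Local Notation Q := (hQ R n).
Variable s : R.
Hypothesis s01 : 0 < s < 1.

Definition hker (h : H) : R := (hnorm h `^ (Q + 2 * s))^-1.

Lemma hkernelE (x y : H) : hkernel s x y = hker (hmul (hinv y) x).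
Proof. by []. Qed.

Lemma hkernelC (x y : H) : hkernel s x y = hkernel s y x.
Proof. by rewrite /hkernel hdistC. Qed.

Lemma hker_ge0 h : 0 <= hker h.
Proof. by rewrite invr_ge0 powR_ge0. Qed.

Lemma hkernel_ge0 (x y : H) : 0 <= hkernel s x y.
Proof. exact: hker_ge0. Qed.

Lemma hkerV h : hker (hinv h) = hker h.
Proof. by rewrite /hker hnormV. Qed.

Lemma hQ2s_gt0 : 0 < Q + 2 * s.
Proof. by case/andP: s01 => s0 s1; rewrite /hQ addr_gt0 ?mulr_gt0// ltr0n addn2. Qed.

Lemma hker_hnorm0 h : hnorm h = 0 -> hker h = 0.
Proof. by move=> h0; rewrite /hker h0 powR0 ?invr0// gt_eqF// hQ2s_gt0. Qed.

Lemma hker_le (r : R) h : 0 < r -> r <= hnorm h -> hker h <= (r `^ (Q + 2 * s))^-1.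
Proof. by move=> r0 rh; apply: invr_powR_anti => //; exact: ltW hQ2s_gt0. Qed.

Lemma hker_ge (r : R) h : 0 < hnorm h -> hnorm h <= r -> (r `^ (Q + 2 * s))^-1 <= hker h.
Proof. by move=> r0 rh; apply: invr_powR_anti => //; exact: ltW hQ2s_gt0. Qed.

Lemma measurable_hker : measurable_fun setT hker.
Proof.
rewrite /hker; under eq_fun do rewrite -powRN.
by apply: (measurableT_comp (measurable_powR _)); exact: measurable_hnorm.
Qed.

Lemma measurable_hkernel d (T : measurableType d) (f g : T -> H) :
  measurable_fun setT f -> measurable_fun setT g ->
  measurable_fun setT (fun x => hkernel s (f x) (g x)).
Proof.
move=> mf mg; apply: (measurableT_comp measurable_hker).
by apply: measurable_hmul => //; exact: measurable_hinv.
Qed.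

Lemma powRX2 (a : R) (m : nat) : 0 <= a -> a ^+ m = a `^ m%:R.
Proof. by move=> a0; rewrite powR_mulrn. Qed.

Lemma powRDp (x a b : R) : 0 < x -> x `^ (a + b) = x `^ a * x `^ b.
Proof. by move=> x0; rewrite powRD// (gt_eqF x0) implybT. Qed.

Lemma pow2N_lt1 (c : R) : 0 < c -> 2 `^ (- c) < 1 :> R.
Proof.
by move=> c0; rewrite /powR pnatr_eq0 -[ltRHS]expR0 ltr_expR mulNr oppr_lt0 mulr_gt0// ln_gt0 ?ltr1n.
Qed.

Lemma pow2D (a b : R) : 2 `^ (a + b) = (2 : R) `^ a * 2 `^ b.
Proof. by rewrite powRDp. Qed.

(** The weight to which second differences at scale [rho] lead. Its integral converges at infinity
    because [2 s > 0], and at the origin because the square gains two powers and [2 - 2 s > 0]. *)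
Definition trunc_ker (rho : R) (h : H) : R := Num.min 1 ((hnorm h / rho) ^+ 2) * hker h.

Lemma trunc_ker_ge0 rho h : 0 <= trunc_ker rho h.
Proof. by rewrite mulr_ge0 ?hker_ge0// le_min ler01 sqr_ge0. Qed.

Lemma measurable_trunc_ker rho : measurable_fun setT (trunc_ker rho).
Proof.
apply: measurable_funM; last exact: measurable_hker.
apply: measurable_minr => //.
apply: measurable_funX; apply: measurable_funM => //.
exact: measurable_hnorm.
Qed.

Lemma trunc_ker1_fin : (\int[mu]_h (trunc_ker 1 h)%:E < +oo)%E.
Proof.
have /andP[s0 s1] := s01.
have p0 := hQ2s_gt0.
have q2 : 2 <= Q by rewrite /hQ ler_nat leq_addl.
have mB : measurable (hball (0 : H) 1) by exact: measurable_hball.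
rewrite -(setvU (hball (0 : H) 1)) ge0_integral_setU//; last 4 first.
  - exact: measurableC.
  - by rewrite setvU; apply/measurable_EFinP; exact: measurable_trunc_ker.
  - by move=> x _; rewrite lee_fin trunc_ker_ge0.
  - by apply/disj_set2P; rewrite setICl.
have mt D : measurable_fun D (trunc_ker 1).
  by apply: measurable_funTS; exact: measurable_trunc_ker.
have powj (a : R) j : (2 `^ a) ^+ j = 2 `^ (a * j%:R).
  by rewrite powRX2 ?powR_ge0// -powRrM.
apply: lte_add_pinfty.
(* Outside the unit ball: if [2^j <= |h| < 2^(j+1)], the kernel is at most [2^(-j(Q+2s))] on a set
   of measure at most [hvol 2^((j+1)Q)], whence the ratio [2^(-2s)]. *)
- apply: le_lt_trans (ltry ((hvol (R:=R) (n:=n) * 2 `^ Q) / (1 - 2 `^ (- (2 * s))))).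
  apply: (@dyadic_integral _ _ _ _ _ _ (fun j => hball 0 (2 ^+ j.+1))
    (fun j => ((2 ^+ j) `^ (Q + 2 * s))^-1)) => //.
  + exact: measurableC.
  + by move=> x _; exact: trunc_ker_ge0.
  + by move=> j; exact: measurable_hball.
  + move=> x; rewrite hball0E /= => /negP; rewrite -leNgt => /dyadic_ex[j /andP[jx xj]].
    exists j; split; first by rewrite hball0E.
    apply: (@le_trans _ _ (hker x)).
      by rewrite ler_piMl ?hker_ge0// ge_min lexx.
    by apply: hker_le; rewrite ?exprn_gt0.
  + move=> j; rewrite [X in (_ * X)%E](mu_hball _ (exprn_gt0 _ _))// -EFinM lee_fin.
    rewrite powj (powRX2 j)// (powRX2 j.+1)// powRX2 ?powR_ge0// -!powRrM -powRN.
    rewrite -/(hQ R n) mulrCA -!mulrA ler_pM2l ?hvol_gt0// -!pow2D.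
    by apply: ler_powR; [lra|rewrite -natr1; nra].
  + by rewrite powR_ge0/=; apply: pow2N_lt1; lra.
(* Inside: if [2^j <= 1/|h| < 2^(j+1)], then [|h|^2] times the kernel is at most
   [2^((j+1)(Q+2s-2))], the exponent being nonnegative as [Q >= 2]. The radius [2^(1-j)] makes the
   strict ball contain [|h| = 2^(-j)]; the ratio is [2^(-(2-2s))]. *)
- apply: le_lt_trans (ltry ((hvol (R:=R) (n:=n) * 2 `^ (Q + Q + 2 * s - 2)) / (1 - 2 `^ (- (2 - 2 * s))))).
  apply: (@dyadic_integral _ _ _ _ _ _ (fun j => hball 0 (2 `^ (1 - j%:R)))
    (fun j => (2 ^+ j.+1) `^ (Q + 2 * s - 2))) => //.
  + by move=> x _; exact: trunc_ker_ge0.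
  + by move=> j; exact: measurable_hball.
  + move=> x; rewrite hball0E /= => x1.
    have [x0|x0] := eqVneq (hnorm x) 0.
      (* At the origin any index will do, since the kernel is 0 there by the convention on
         inverses. *)
      exists 0%N; split; first by rewrite hball0E/= x0 powR_gt0.
      by rewrite /trunc_ker hker_hnorm0// mulr0 powR_ge0.
    have {}x0 : 0 < hnorm x by rewrite lt_neqAle eq_sym x0 hnorm_ge0.
    have : 1 <= (hnorm x)^-1 by rewrite invf_ge1// ltW.
    move=> /dyadic_ex[j /andP[jx xj]].
    exists j; split.
      rewrite hball0E/= powRB ?pnatr_eq0 ?implybT// powRr1// -powRX2//.
      rewrite ltr_pdivlMr ?exprn_gt0//.
      have : hnorm x * 2 ^+ j <= 1 by rewrite mulrC -ler_pdivlMr// mul1r.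
      by move=> /le_lt_trans; apply; rewrite ltr1n.
    apply: (@le_trans _ _ (hnorm x ^+ 2 * hker x)).
      by rewrite ler_wpM2r ?hker_ge0// ge_min divr1 lexx orbT.
    rewrite powRX2 ?hnorm_ge0// /hker -powRN -powRDp//.
    rewrite (_ : 2 + - _ = - (Q + 2 * s - 2)); last by lra.
    rewrite powRN -powR_inv1 ?powR_ge0// -powRrM mulrC powRrM powR_inv1 ?hnorm_ge0//.
    apply: ge0_ler_powR; rewrite ?nnegrE ?invr_ge0 ?exprn_ge0 ?hnorm_ge0//; last exact: ltW.
    by lra.
  + move=> j; rewrite [X in (_ * X)%E](mu_hball _ (powR_gt0 _ _))// -EFinM lee_fin.
    rewrite powj (powRX2 j.+1)// powRX2 ?powR_ge0// -!powRrM.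
    rewrite -/(hQ R n) mulrCA -!mulrA ler_pM2l ?hvol_gt0// -!pow2D.
    by apply: ler_powR; [lra|rewrite -natr1; nra].
  + by rewrite powR_ge0/=; apply: pow2N_lt1; lra.
Qed.

Definition hTheta : R := fine (\int[mu]_h (trunc_ker 1 h)%:E).

Lemma hTheta_ge0 : 0 <= hTheta.
Proof. by apply: fine_ge0; apply: integral_ge0 => h _; rewrite lee_fin trunc_ker_ge0. Qed.

Lemma integral_trunc_ker rho : 0 < rho ->
  (\int[mu]_h (trunc_ker rho h)%:E = (rho `^ (- (2 * s)) * hTheta)%:E)%E.
Proof.
move=> r0.
have mt : measurable_fun setT (fun h => (trunc_ker rho h)%:E).
  by apply/measurable_EFinP; exact: measurable_trunc_ker.
have t0 h : (0 <= (trunc_ker rho h)%:E)%E by rewrite lee_fin trunc_ker_ge0.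
have dilE := ge0_integral_hdil r0 mt t0.
have scaleE : (\int[mu]_h (trunc_ker rho (hdil rho h))%:E =
  (rho `^ (- (Q + 2 * s)) * hTheta)%:E)%E.
  rewrite EFinM fineK; last first.
    by rewrite ge0_fin_numE ?trunc_ker1_fin//; apply: integral_ge0 => h _; rewrite lee_fin trunc_ker_ge0.
  rewrite -ge0_integralZl//; last 3 first.
    - by apply/measurable_EFinP; exact: measurable_trunc_ker.
    - by move=> h _; rewrite lee_fin trunc_ker_ge0.
    - by rewrite lee_fin powR_ge0.
  apply: eq_integral => h _; rewrite -EFinM; congr EFin.
  rewrite /trunc_ker /hker hnorm_dil ?(ltW r0)// mulrAC divff ?gt_eqF// mul1r divr1.
  by rewrite powRM ?hnorm_ge0 ?(ltW r0)// invfM powRN; ring.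
(* The dilated integral has been computed twice, by homogeneity of the integrand (degree [-(Q+2s)])
   and by the Jacobian ([-Q]); multiplying by [rho^Q] isolates the wanted one. *)
have := etrans (esym scaleE) dilE => /(congr1 (fun z => (rho ^+ (2 * n + 2))%:E * z)%E).
rewrite muleA -!EFinM divff ?expf_neq0 ?gt_eqF// mul1e => <-.
congr EFin; rewrite mulrA; congr (_ * _).
rewrite (powRX2 _ (ltW r0)) -powRDp//.
by congr (_ `^ _); rewrite -/(hQ R n); ring.
Qed.

End kernel.

(** * Measurability and integrals over pairs of points *)

Lemma measurable_oppr_comp d (T : measurableType d) (R : realType) (f : T -> R) D :
  measurable_fun D f -> measurable_fun D (fun x => - f x).
Proof. by move=> mf; exact: measurableT_comp. Qed.

Lemma measurable_normr_comp d (T : measurableType d) (R : realType) (f : T -> R) D :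
  measurable_fun D f -> measurable_fun D (fun x => `|f x|).
Proof. by move=> mf; exact: measurableT_comp. Qed.

Lemma measurable_max_comp d (T : measurableType d) (R : realType) (f g : T -> R) D :
  measurable_fun D f -> measurable_fun D g -> measurable_fun D (fun x => Num.max (f x) (g x)).
Proof. by move=> mf mg; exact: measurable_maxr. Qed.

Lemma measurable_min_comp d (T : measurableType d) (R : realType) (f g : T -> R) D :
  measurable_fun D f -> measurable_fun D g -> measurable_fun D (fun x => Num.min (f x) (g x)).
Proof. by move=> mf mg; exact: measurable_minr. Qed.

Ltac mfun_step :=
  lazymatch goal with
    | |- measurable_fun _ (fun _ => ?c) => exact: measurable_cst
    | |- measurable_fun _ (fun x => x) => exact: measurable_id
    | |- measurable_fun _ (fun x => EFin (@?f x)) => apply/measurable_EFinP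
    | |- measurable_fun _ (fun x => fst x) => exact: measurable_fst
    | |- measurable_fun _ (fun x => snd x) => exact: measurable_snd
    | |- measurable_fun _ (fun x => (@?f x) - (@?g x)) => apply: (measurable_funB (f := f) (g := g))
    | |- measurable_fun _ (fun x => (@?f x) + (@?g x)) => apply: (measurable_funD (f := f) (g := g))
    | |- measurable_fun _ (fun x => (@?f x) * (@?g x)) => apply: (measurable_funM (f := f) (g := g))
    | |- measurable_fun _ (fun x => (@?f x) ^+ _) => apply: (measurable_funX (f := f))
    | |- measurable_fun _ (fun x => - (@?f x)) => apply: (measurable_oppr_comp (f := f))
    | |- measurable_fun _ (fun x => `| (@?f x) |) => apply: (measurable_normr_comp (f := f))
    | |- measurable_fun _ (fun x => @Order.max _ _ (@?f x) (@?g x)) => apply: (measurable_max_comp (f := f) (g := g))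
    | |- measurable_fun _ (fun x => @Order.min _ _ (@?f x) (@?g x)) => apply: (measurable_min_comp (f := f) (g := g))
    | |- measurable_fun _ (fun x => hmul (@?f x) (@?g x)) => apply: (measurable_hmul (f := f) (g := g))
    | |- measurable_fun _ (fun x => hinv (@?f x)) => apply: (measurable_hinv (f := f))
    | |- measurable_fun _ (fun x => hnorm (@?f x)) => apply: (measurable_hnorm (f := f))
    | |- measurable_fun _ (fun x => hdist (@?f x) (@?g x)) => apply: (measurable_hdist (f := f) (g := g))
    | |- measurable_fun _ (fun x => hkernel _ (@?f x) (@?g x)) => apply: (measurable_hkernel _ (f := f) (g := g))
    | |- measurable_fun _ (fun x => hker _ (@?g x)) => apply: (measurableT_comp (measurable_hker _) (g := g))
    | |- measurable_fun _ (fun x => (@?f x) `^ _) => apply: (measurableT_comp (measurable_powR _) (g := f))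
    | |- measurable_fun _ (fun x => ?f (@?g x)) => apply: (@measurableT_comp _ _ _ _ _ _ f _ g)
    | |- measurable_fun _ _ => assumption
    end.
Ltac mfun := repeat mfun_step.

Section indic_limit.
Context d {T : measurableType d} {R : realType}.
Variable mu : {measure set T -> \bar R}.
Variables (F : T -> R) (A : nat -> set T).
Hypothesis mA : forall j, measurable (A j).
Hypothesis FA : forall x, F x != 0 -> exists N, forall j, (N <= j)%N -> A j x.

Let cvgF x : ((F x * \1_(A j) x)%:E @[j --> \oo] --> (F x)%:E)%E.
Proof.
have [F0|/FA[N AN]] := eqVneq (F x) 0.
  by rewrite F0; under eq_fun do rewrite mul0r; exact: cvg_cst.
apply: cvg_near_cst; exists N => // j /= Nj.
by rewrite indicE mem_set ?mulr1//; exact: AN.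
Qed.

Lemma cvg_integral_indic : mu.-integrable setT (EFin \o F) ->
  (\int[mu]_x (F x * \1_(A j) x)%:E @[j --> \oo] --> \int[mu]_x (F x)%:E)%E.
Proof.
move=> iF; have mF : measurable_fun setT F.
  by have /integrableP[/measurable_EFinP] := iF.
have mj j : measurable_fun setT (fun x => (F x * \1_(A j) x)%:E).
  by apply/measurable_EFinP; apply: measurable_funM => //; exact: measurable_indic.
have iG : mu.-integrable setT (fun x => `|(F x)%:E|)%E by exact: integrable_abse.
have FG : {ae mu, forall x, forall j, setT x -> (`|(F x * \1_(A j) x)%:E| <= `|(F x)%:E|)%E}.
  apply: aeW => x j _; rewrite !abse_EFin lee_fin normrM ler_piMr//.
  by rewrite indicE; case: (_ \in _); rewrite ?normr1 ?normr0.
have mF' : measurable_fun setT (EFin \o F) by exact/measurable_EFinP.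
have cF : {ae mu, forall x, setT x -> ((F x * \1_(A j) x)%:E @[j --> \oo] --> (F x)%:E)%E}.
  by apply: aeW => x _; exact: cvgF.
by have [_ _] := dominated_convergence measurableT mj mF' cF iG FG.
Qed.

(** The monotone counterpart of the previous limit: here finiteness is a conclusion, so this is the
    tool for showing that the energy of the bump is finite, before dominated convergence can be
    used. *)
Lemma ge0_integral_indic_le (M : \bar R) : measurable_fun setT F ->
  (forall x, 0 <= F x) -> (forall i j, (i <= j)%N -> A i `<=` A j) ->
  (forall j, \int[mu]_x (F x * \1_(A j) x)%:E <= M)%E -> (\int[mu]_x (F x)%:E <= M)%E.
Proof.
move=> mF F0 ndA AM.
have mj j : measurable_fun setT (fun x => (F x * \1_(A j) x)%:E).
  by apply/measurable_EFinP; apply: measurable_funM => //; exact: measurable_indic.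
have cv := @cvg_monotone_convergence _ _ _ mu _ (@measurableT _ T) _ mj.
have -> : (\int[mu]_x (F x)%:E = limn (fun j => \int[mu]_x (F x * \1_(A j) x)%:E))%E.
  apply/esym/cvg_lim => //.
  rewrite [X in _ --> X](_ : _ = \int[mu]_x limn (fun j => (F x * \1_(A j) x)%:E))%E; last first.
    by apply: eq_integral => x _; apply/esym/cvg_lim => //; exact: cvgF.
  apply: cv => [j x _|x _ i j ij]; first by rewrite lee_fin mulr_ge0.
  rewrite lee_fin ler_wpM2l// !indicE ler_nat.
  case: (boolP (x \in A i)) => // /set_mem Aix.
  by rewrite mem_set//; exact: ndA Aix.
apply: lime_le; last by apply: nearW.
apply: ereal_nondecreasing_is_cvgn => i j ij.
apply: ge0_le_integral => //.
- by move=> x _; rewrite lee_fin mulr_ge0.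
- move=> x _; rewrite lee_fin ler_wpM2l// !indicE ler_nat.
  case: (boolP (x \in A i)) => // /set_mem Aix.
  by rewrite mem_set//; exact: ndA Aix.
Qed.
End indic_limit.

Section pairs.
Context {R : realType} {n : nat}.
Local Notation H := (heis R n).
Local Notation mu := (@hleb R n).

(** Writing [y = x h] turns [hkernel s x y] into a function of [h] alone, so that energies become
    integrals of right differences. *)
Lemma ge0_integral_hpair (G : H * H -> \bar R) : measurable_fun setT G ->
  (forall p, 0 <= G p)%E ->
  (\int[mu \x mu]_p G p = \int[mu]_x \int[mu]_h G (x, hmul x h))%E.
Proof.
move=> mG G0; apply: etrans (fubini_tonelli1 _ mG G0) _; apply: eq_integral => x _.
apply/esym/(ge0_integral_hmul x (f := fun y => G (x, y))) => //.
by apply: (measurableT_comp mG); exact: measurable_pair1.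
Qed.

Lemma ge0_integral_hpair_swap (G : H * H -> \bar R) : measurable_fun setT G ->
  (forall p, 0 <= G p)%E ->
  (\int[mu \x mu]_p G p = \int[mu \x mu]_p G (p.2, p.1))%E.
Proof.
move=> mG G0; apply: etrans (fubini_tonelli2 _ mG G0) _; apply/esym.
have ms : measurable_fun setT (fun p : H * H => (p.2, p.1)).
  by apply/measurable_fun_pair; mfun.
exact: (fubini_tonelli1 _ (measurableT_comp mG ms) (fun p => G0 _)).
Qed.

Lemma ge0_integral_hpair_hmul (z : H) (G : H * H -> \bar R) : measurable_fun setT G ->
  (forall p, 0 <= G p)%E ->
  (\int[mu \x mu]_p G (hmul z p.1, hmul z p.2) = \int[mu \x mu]_p G p)%E.
Proof.
move=> mG G0.
have mz : measurable_fun setT (fun p : H * H => (hmul z p.1, hmul z p.2)).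
  by apply/measurable_fun_pair; mfun.
apply: etrans (fubini_tonelli1 _ (measurableT_comp mG mz) (fun p => G0 _)) _.
apply: etrans (esym (fubini_tonelli1 _ mG G0)); rewrite /fubini_F/=.
have mG1 x : measurable_fun setT (fun y => G (x, y)).
  by apply: (measurableT_comp mG); exact: measurable_pair1.
under eq_integral => x _ do rewrite (ge0_integral_hmul z (mG1 (hmul z x)))//.
apply: (ge0_integral_hmul z (f := fun x => \int[mu]_y G (x, y))%E).
  exact: (measurable_fun_fubini_tonelli_F (m2 := mu) _ mG).
by move=> x; apply: integral_ge0.
Qed.

Lemma ge0_integral_hpairM (G : H * H -> \bar R) : measurable_fun setT G ->
  (forall p, 0 <= G p)%E ->
  (\int[mu \x mu]_p G p = \int[mu \x mu]_p G (p.1, hmul p.1 p.2))%E.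
Proof.
move=> mG G0; apply: etrans (ge0_integral_hpair mG G0) _; apply/esym.
have ms : measurable_fun setT (fun p : H * H => (p.1, hmul p.1 p.2)).
  by apply/measurable_fun_pair; mfun.
exact: (fubini_tonelli1 _ (measurableT_comp mG ms) (fun p => G0 _)).
Qed.

Lemma ge0_integral_hpairV (G : H * H -> \bar R) : measurable_fun setT G ->
  (forall p, 0 <= G p)%E ->
  (\int[mu \x mu]_p G p = \int[mu \x mu]_p G (p.1, hinv p.2))%E.
Proof.
move=> mG G0; apply/esym.
have ms : measurable_fun setT (fun p : H * H => (p.1, hinv p.2)).
  by apply/measurable_fun_pair; mfun.
apply: etrans (fubini_tonelli1 _ (measurableT_comp mG ms) (fun p => G0 _)) _.
apply: etrans (esym (fubini_tonelli1 _ mG G0)); apply: eq_integral => x _.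
have mGx : measurable_fun setT (fun y => G (x, y)).
  by apply: (measurableT_comp mG); exact: measurable_pair1.
exact: (ge0_integral_hinv mGx (fun y => G0 _)).
Qed.

Lemma ge0_integral_sep (f g : H -> R) : measurable_fun setT f ->
  measurable_fun setT g -> (forall x, 0 <= f x) -> (forall x, 0 <= g x) ->
  (\int[mu \x mu]_p (f p.1 * g p.2)%:E =
   \int[mu]_x (f x)%:E * \int[mu]_x (g x)%:E)%E.
Proof.
move=> mf mg f0 g0.
have mF : measurable_fun setT (fun p : H * H => (f p.1 * g p.2)%:E) by mfun.
have F0 p : (0 <= (f p.1 * g p.2)%:E)%E by rewrite lee_fin mulr_ge0.
apply: etrans (fubini_tonelli1 _ mF F0) _.
have mgE : measurable_fun setT (fun x => (g x)%:E) by mfun.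
have mfE : measurable_fun setT (fun x => (f x)%:E) by mfun.
have gE0 x : setT x -> (0 <= (g x)%:E)%E by move=> _; rewrite lee_fin.
have fE0 x : setT x -> (0 <= (f x)%:E)%E by move=> _; rewrite lee_fin.
have ig0 : (0 <= \int[mu]_x (g x)%:E)%E by apply: integral_ge0.
transitivity (\int[mu]_x ((\int[mu]_y (g y)%:E) * (f x)%:E))%E.
  apply: eq_integral => x _; rewrite muleC.
  rewrite -(ge0_integralZl _ measurableT mgE gE0)//; last by rewrite lee_fin.
rewrite (ge0_integralZl _ measurableT mfE fE0 ig0).
by rewrite muleC.
Qed.

End pairs.

Opaque hmul hinv hnorm hnorm4 lebesgue_rV hleb.

(** * Energy of a quartic bump *)

Lemma mulr3_ge0 (R : numDomainType) (a b c : R) :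
  0 <= a -> 0 <= b -> 0 <= c -> 0 <= a * b * c.
Proof. by move=> a0 b0 c0; rewrite mulr_ge0// mulr_ge0. Qed.

Lemma ge0_integral_le_sum d (T : measurableType d) (R : realType)
    (mu : {measure set T -> \bar R}) (f g h k : T -> R) :
  measurable_fun setT f -> measurable_fun setT g -> measurable_fun setT h ->
  measurable_fun setT k ->
  (forall x, 0 <= (f x)%:E)%E -> (forall x, 0 <= (g x)%:E)%E ->
  (forall x, 0 <= (h x)%:E)%E -> (forall x, 0 <= (k x)%:E)%E ->
  (forall x, f x + f x <= g x + h x + k x) ->
  (\int[mu]_x (f x)%:E + \int[mu]_x (f x)%:E <=
   \int[mu]_x (g x)%:E + \int[mu]_x (h x)%:E + \int[mu]_x (k x)%:E)%E.
Proof.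
move=> mf mg mh mk f0 g0 h0 k0 fghk.
move: mf mg mh mk => /measurable_EFinP mf /measurable_EFinP mg /measurable_EFinP mh /measurable_EFinP mk.
rewrite -!ge0_integralD//; last 2 first.
- by move=> x _; rewrite adde_ge0.
- exact: emeasurable_funD.
apply: ge0_le_integral => //.
- by move=> x _; rewrite adde_ge0.
- exact: emeasurable_funD.
- by apply: emeasurable_funD => //; exact: emeasurable_funD.
- by move=> x _; rewrite -!EFinD lee_fin.
Qed.

Lemma indic01 (T : Type) (R : realDomainType) (A : set T) x : 0 <= (\1_A x : R) <= 1.
Proof. by rewrite indicE; case: (x \in A); rewrite ?lexx ?ler01. Qed.

(** The pointwise form of the second-difference bound, with [g = f x], [a], [b], [c] the values of
    the bump at [x], [x h], [x h^-1], [k] the kernel and [I] the indicator of the cut. It is kept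
    additive, as both sides will be integrated as nonnegative functions. The bound on [2 a - b - c]
    is asked only where [g > 0], which is where it holds. *)
Lemma second_diff_key (R : realDomainType) (a b c k I g m : R) :
  0 <= g -> 0 <= k -> 0 <= m -> 0 <= I <= 1 -> (0 < g -> 2 * a - b - c <= 32 * m) ->
  g * a * (k * I) + g * a * (k * I) <=
  g * b * (k * I) + g * c * (k * I) + g * (32 * (m * k)).
Proof.
rewrite le_eqVlt => /predU1P[<- *|g0 k0 m0 /andP[I0 I1] /(_ g0) abc].
  by rewrite !mul0r !addr0.
rewrite -subr_ge0.
have -> : g * b * (k * I) + g * c * (k * I) + g * (32 * (m * k)) - (g * a * (k * I) + g * a * (k * I)) =
   g * k * (I * (32 * m - (2 * a - b - c)) + (1 - I) * (32 * m)) by ring.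
by rewrite mulr_ge0 ?mulr_ge0 ?(ltW g0)// addr_ge0// mulr_ge0 ?subr_ge0 ?mulr_ge0.
Qed.

(** Recovers the integral of a signed product from those of its four nonnegative terms. Finiteness
    of [A] and [B] is what permits the subtraction, and is the reason for cutting the kernel. *)
Lemma ge0_integral_diff_le d (T : measurableType d) (R : realType)
    (mu : {measure set T -> \bar R}) (a1 a2 b1 b2 F : T -> R) (A B C : \bar R) :
  measurable_fun setT a1 -> measurable_fun setT a2 ->
  measurable_fun setT b1 -> measurable_fun setT b2 ->
  (forall x, 0 <= (a1 x)%:E)%E -> (forall x, 0 <= (a2 x)%:E)%E ->
  (forall x, 0 <= (b1 x)%:E)%E -> (forall x, 0 <= (b2 x)%:E)%E ->
  (A = \int[mu]_x (a1 x)%:E)%E -> (A = \int[mu]_x (a2 x)%:E)%E ->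
  (B = \int[mu]_x (b1 x)%:E)%E -> (B = \int[mu]_x (b2 x)%:E)%E ->
  (A < +oo)%E -> (B < +oo)%E ->
  (forall x, F x = (a1 x + a2 x) - (b1 x + b2 x)) ->
  (A + A <= B + B + C)%E -> (\int[mu]_x (F x)%:E <= C)%E.
Proof.
move=> ma1 ma2 mb1 mb2 a10 a20 b10 b20 A1 A2 B1 B2 Afin Bfin FE key.
pose P x := a1 x + a2 x; pose N x := b1 x + b2 x.
have mP : measurable_fun setT P by apply: measurable_funD.
have mN : measurable_fun setT N by apply: measurable_funD.
have P0 x : 0 <= P x by rewrite addr_ge0// -lee_fin.
have N0 x : 0 <= N x by rewrite addr_ge0// -lee_fin.
have PA : (\int[mu]_p (P p)%:E = A + A)%E.
  by rewrite {1}A1 A2 -ge0_integralD//; exact/measurable_EFinP.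
have NB : (\int[mu]_p (N p)%:E = B + B)%E.
  by rewrite {1}B1 B2 -ge0_integralD//; exact/measurable_EFinP.
have iP : mu.-integrable setT (EFin \o P).
  apply/integrableP; split; first exact/measurable_EFinP.
  under eq_integral do rewrite gee0_abs ?lee_fin//.
  by rewrite PA lte_add_pinfty.
have iN : mu.-integrable setT (EFin \o N).
  apply/integrableP; split; first exact/measurable_EFinP.
  under eq_integral do rewrite gee0_abs ?lee_fin//.
  by rewrite NB lte_add_pinfty.
have -> : (\int[mu]_p (F p)%:E = \int[mu]_p ((P p)%:E - (N p)%:E))%E.
  by apply: eq_integral => p _; rewrite -EFinB FE.
rewrite integralB_EFin// PA NB.
have Nfin : (B + B)%E \is a fin_num.
  by rewrite ge0_fin_numE ?lte_add_pinfty// B1 adde_ge0// integral_ge0.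
by rewrite leeBlDl.
Qed.

Section bump.
Context {R : realType} {n : nat}.
Local Notation H := (heis R n).
Local Notation mu := (@hleb R n).
Implicit Types (x y h : H) (rho : R).

Lemma integral_indic_hball x0 rho : 0 < rho ->
  (\int[mu]_x (\1_(hball x0 rho) x)%:E = (hvol (n := n) * rho ^+ (2 * n + 2))%:E)%E.
Proof.
move=> r0; rewrite integral_indic//; last exact: measurable_hball.
by rewrite setIT -(mu_hball x0 r0).
Qed.

Definition hbump (x0 : H) (rho : R) (x : H) : R :=
  Num.max 0 (1 - hnorm4 (hmul (hinv x0) x) / rho ^+ 4).

Lemma hbump_ge0 x0 rho x : 0 <= hbump x0 rho x.
Proof. by rewrite le_max lexx. Qed.

Lemma hbump_le1 x0 rho x : 0 < rho -> hbump x0 rho x <= 1.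
Proof.
move=> r0; rewrite ge_max ler01/= gerBl divr_ge0 ?hnorm4_ge0//.
by rewrite exprn_ge0// ltW.
Qed.

Lemma hbump_gt0 x0 rho x : 0 < rho -> (0 < hbump x0 rho x) = (hdist x x0 < rho).
Proof.
move=> r0; rewrite lt_max ltxx/= subr_gt0 ltr_pdivrMr ?exprn_gt0// mul1r.
by rewrite -hnorm_lt// ltW.
Qed.

Lemma hbump_eq0 x0 rho x : 0 < rho -> rho <= hdist x x0 -> hbump x0 rho x = 0.
Proof.
move=> r0 rx; apply/eqP; rewrite eq_le hbump_ge0 andbT leNgt hbump_gt0//.
by rewrite -leNgt.
Qed.

Lemma measurable_hbump x0 rho : measurable_fun setT (hbump x0 rho).
Proof.
rewrite (_ : hbump x0 rho =
    fun x => Num.max 0 (1 - hnorm (hmul (hinv x0) x) ^+ 4 / rho ^+ 4)); first by mfun.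
by apply/funext => x; rewrite hnormX4.
Qed.

(** Only an upper bound is needed, so the translates may be replaced by the polynomial below them,
    while at [x] itself the bump equals that polynomial. With [a = |h|/rho <= 1] and
    [b = |x0^-1 x|/rho <= 1] the polynomial estimate is [28 b^2 a^2 + 4 a^4 <= 32 a^2], hence the
    constant 32; for [a >= 1] the left side is at most 2. *)
Lemma hbump_second_diff x0 rho x h : 0 < rho -> 0 < hbump x0 rho x ->
  2 * hbump x0 rho x - hbump x0 rho (hmul x h) - hbump x0 rho (hmul x (hinv h))
  <= 32 * Num.min 1 ((hnorm h / rho) ^+ 2).
Proof.
move=> r0 bx.
have [a1|a1] := leP 1 ((hnorm h / rho) ^+ 2).
  have := hbump_le1 x0 x r0; have := hbump_ge0 x0 rho (hmul x h).
  have := hbump_ge0 x0 rho (hmul x (hinv h)).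
  move: (hbump _ _ _) (hbump _ _ (hmul x h)) (hbump _ _ x) => a b c; lra.
have yr : hnorm (hmul (hinv x0) x) < rho by move: bx; rewrite hbump_gt0.
have E : hbump x0 rho x = 1 - hnorm4 (hmul (hinv x0) x) / rho ^+ 4.
  by move: bx; rewrite {1}/hbump lt_max ltxx/= => /ltW bx; apply/max_idPr.
have L k : 1 - hnorm4 (hmul (hmul (hinv x0) x) k) / rho ^+ 4 <= hbump x0 rho (hmul x k).
  by rewrite /hbump hmulA le_max lexx orbT.
have := L h; have := L (hinv h); rewrite {L}E.
set y := hmul (hinv x0) x in yr *.
have := hnorm4_second_diff y h.
set P := hnorm4 (hmul y h); set M := hnorm4 (hmul y (hinv h)).
have r4 : 0 < rho ^+ 4 by rewrite exprn_gt0.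
rewrite -(@ler_pM2r _ (rho ^- 4)) ?invr_gt0//.
set a := hnorm h / rho.
have a0 : 0 <= a by rewrite divr_ge0 ?hnorm_ge0// ltW.
have -> : (28 * hnorm y ^+ 2 * hnorm h ^+ 2 + 4 * hnorm h ^+ 4) / rho ^+ 4 =
   28 * (hnorm y / rho) ^+ 2 * a ^+ 2 + 4 * a ^+ 4.
  by rewrite /a; field; rewrite gt_eqF.
set b := hnorm y / rho.
have b0 : 0 <= b by rewrite divr_ge0 ?hnorm_ge0// ltW.
have b1 : b <= 1 by rewrite ler_pdivrMr// mul1r ltW.
have b2 : b ^+ 2 <= 1 by rewrite exprn_ile1.
have : 28 * b ^+ 2 * a ^+ 2 + 4 * a ^+ 4 <= 32 * a ^+ 2.
  have -> : a ^+ 4 = a ^+ 2 * a ^+ 2 by ring.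
  have := sqr_ge0 a; move: (ltW a1); rewrite -/a; nra.
rewrite (_ : (P + M - 2 * hnorm4 y) / rho ^+ 4 =
  P / rho ^+ 4 + M / rho ^+ 4 - 2 * (hnorm4 y / rho ^+ 4)); last by ring.
move=> h1 /le_trans/(_ h1) {h1}.
move: (P / _) (M / _) (hnorm4 y / _) (hbump x0 rho (hmul x h)) (hbump x0 rho (hmul x (hinv h))).
by move: (a ^+ 2) => a2 c2 c3 c4 b3 b4; lra.
Qed.

End bump.

Section energy.
Context {R : realType} {n : nat}.
Local Notation H := (heis R n).
Local Notation mu := (@hleb R n).
Variable s : R.
Hypothesis s01 : 0 < s < 1.
Implicit Types (f g u v w : H -> R).

Lemma hkernel_mulr (x h : H) : hkernel s x (hmul x h) = hker s h.
Proof. by rewrite hkernelC hkernelE hmulKg. Qed.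

Lemma gagliardo2E f : gagliardo2 s f = hform s f f.
Proof.
apply: eq_integral => p _; congr (_ * _)%:E.
by rewrite real_normK ?num_real// expr2.
Qed.

Lemma gagliardo2_ge0 f : (0 <= gagliardo2 s f)%E.
Proof.
by apply: integral_ge0 => p _; rewrite lee_fin mulr_ge0 ?hkernel_ge0// exprn_ge0.
Qed.

Lemma integrable_energy f g : measurable_fun setT f -> measurable_fun setT g ->
  (gagliardo2 s f < +oo)%E -> (gagliardo2 s g < +oo)%E ->
  (mu \x mu)%E.-integrable setT
    (fun p => ((f p.1 - f p.2) * (g p.1 - g p.2) * hkernel s p.1 p.2)%:E).
Proof.
move=> mf mg Ef Eg; apply/integrableP; split; first by mfun.
pose F f (p : H * H) := (`|f p.1 - f p.2| ^+ 2 * hkernel s p.1 p.2)%:E.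
have F0 f' p : (0 <= F f' p)%E by rewrite lee_fin mulr_ge0 ?hkernel_ge0// exprn_ge0.
have mF f' : measurable_fun setT f' -> measurable_fun setT (F f') by move=> mf'; rewrite /F; mfun.
apply: (@le_lt_trans _ _ (\int[mu \x mu]_p (F f p + F g p))%E); last first.
  rewrite ge0_integralD//; [exact: lte_add_pinfty|exact: mF|exact: mF].
apply: ge0_le_integral => //.
- apply: measurableT_comp => //; mfun.
- by apply: emeasurable_funD; exact: mF.
- move=> p _; rewrite abse_EFin -EFinD lee_fin normrM (ger0_norm (hkernel_ge0 _ _ _)).
  rewrite -mulrDl ler_wpM2r ?hkernel_ge0// normrM.
  have := sqr_ge0 (`|f p.1 - f p.2| - `|g p.1 - g p.2|).
  have := normr_ge0 (f p.1 - f p.2); have := normr_ge0 (g p.1 - g p.2); nra.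
Qed.

Definition hshell (e : R) : set H := ~` hball 0 e.

Lemma hshellE e h : (h \in hshell e) = (e <= hnorm h).
Proof.
rewrite /hshell hball0E; apply/idP/idP; rewrite inE/= => h1.
  by rewrite leNgt; apply/negP.
by apply/negP; rewrite -leNgt.
Qed.

Lemma measurable_hshell e : measurable (hshell e).
Proof. by apply: measurableC; exact: measurable_hball. Qed.

Definition hkerT (e : R) (h : H) : R := hker s h * \1_(hshell e) h.

Lemma hkerT_ge0 e h : 0 <= hkerT e h.
Proof. by rewrite mulr_ge0 ?hker_ge0. Qed.

Lemma hkerTV e h : hkerT e (hinv h) = hkerT e h.
Proof. by rewrite /hkerT hkerV !indicE !hshellE hnormV. Qed.

Lemma measurable_hkerT e : measurable_fun setT (hkerT e).
Proof.
apply: measurable_funM; first exact: measurable_hker.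
by apply: measurable_indic; exact: measurable_hshell.
Qed.

(** A crude bound for the mass of the kernel on [|h| >= e]: there [min 1 (e^2) <= min 1 (|h|^2)], so
    the cut kernel is a multiple of [trunc_ker s 1] at most. *)
Definition hTail (e : R) : R := (Num.min 1 (e ^+ 2))^-1 * hTheta (n := n) s.

Lemma integral_hkerT e : 0 < e -> (\int[mu]_h (hkerT e h)%:E <= (hTail e)%:E)%E.
Proof.
move=> e0; have m0 : 0 < Num.min 1 (e ^+ 2) by rewrite lt_min ltr01 exprn_gt0.
rewrite /hTail EFinM fineK; last first.
  rewrite ge0_fin_numE ?trunc_ker1_fin//.
  by apply: integral_ge0 => h _; rewrite lee_fin trunc_ker_ge0.
have mt : measurable_fun setT (fun h : H => (trunc_ker s 1 h)%:E).
  by apply/measurable_EFinP; exact: measurable_trunc_ker.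
rewrite -ge0_integralZl//; last 2 first.
  by move=> h _; rewrite lee_fin trunc_ker_ge0.
  by rewrite lee_fin invr_ge0 ltW.
apply: ge0_le_integral => //.
- by move=> h _; rewrite lee_fin hkerT_ge0.
- by apply/measurable_EFinP; exact: measurable_hkerT.
- by apply: measurable_funeM.
- move=> h _; rewrite -EFinM lee_fin /hkerT indicE hshellE.
  case: (leP e (hnorm h)) => eh; last first.
    by rewrite mulr0 mulr_ge0 ?trunc_ker_ge0// invr_ge0 ltW.
  rewrite mulr1 ler_pdivlMl// /trunc_ker ler_wpM2r ?hker_ge0// divr1.
  by rewrite le_min ge_min lexx/= ge_min ler_sqr ?nnegrE ?hnorm_ge0 ?(ltW e0)// eh orbT.
Qed.

Variables (x0 : H) (rho : R).
Hypothesis rho0 : 0 < rho.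
Local Notation eta := (hbump x0 rho).

Definition Ceta : R := 32 * (rho `^ (- (2 * s)) * hTheta (n := n) s).

Lemma Ceta_ge0 : 0 <= Ceta.
Proof. by rewrite !mulr_ge0 ?powR_ge0 ?hTheta_ge0. Qed.

Section trunc.
Variables (f : H -> R) (l : R).
Hypothesis mf : measurable_fun setT f.
Hypothesis f0 : forall x, 0 <= f x.
Hypothesis fl : forall x, f x <= l * eta x.

Let f_eta x : 0 < f x -> 0 < eta x.
Proof.
move=> fx; rewrite lt_neqAle hbump_ge0 andbT; apply/eqP => e0.
by have := fl x; rewrite -e0 mulr0 leNgt fx.
Qed.

Lemma integral_bump_fin : (\int[mu]_x (f x)%:E < +oo)%E.
Proof.
have mB : measurable (hball x0 rho) by exact: measurable_hball.
apply: (@le_lt_trans _ _ (\int[mu]_x (`|l| * \1_(hball x0 rho) x)%:E)%E).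
  apply: ge0_le_integral => //.
  - by move=> x _; rewrite lee_fin.
  - by mfun.
  - by apply/measurable_EFinP; apply: measurable_funM => //; exact: measurable_indic.
  - move=> x _; rewrite lee_fin indicE.
    have [xB|xB] := ltP (hdist x x0) rho.
      rewrite mem_set// mulr1 (le_trans (fl x))//.
      rewrite (le_trans (ler_norm _))// normrM (ger0_norm (hbump_ge0 _ _ _)).
      by rewrite ler_piMr// hbump_le1.
    by have := fl x; rewrite hbump_eq0// mulr0 => /le_trans; apply; rewrite mulr_ge0.
under eq_integral do rewrite EFinM.
rewrite ge0_integralZl//; last by apply/measurable_EFinP; exact: measurable_indic.
by rewrite integral_indic_hball// -EFinM ltry.
Qed.

Let meta := measurable_hbump x0 rho.

(** With the kernel cut, the form is [2 A - 2 B], where [A] integrates [f(x) eta(x)] and [B]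
    integrates [f(x) eta(y)]. Writing one copy of [B] with [y = x h] and the other with [y = x h^-1]
    makes the second difference of [eta] at [x] appear under the integral of [f]. The bound is
    independent of [e]. *)
Lemma trunc_energy_bump e : 0 < e ->
  (\int[mu \x mu]_p ((f p.1 - f p.2) * (eta p.1 - eta p.2) * hkernel s p.1 p.2 *
      \1_[set p : H * H | hshell e (hmul (hinv p.2) p.1)] p)%:E <=
   Ceta%:E * \int[mu]_x (f x)%:E)%E.
Proof.
move=> e0.
pose K (p : H * H) := hkerT e (hmul (hinv p.2) p.1).
under eq_integral => p _ do rewrite -mulrA -[X in _ * X]/(K p).
have mK : measurable_fun setT K.
  by apply: (measurableT_comp (measurable_hkerT e)); mfun.
have K0 p : 0 <= K p by exact: hkerT_ge0.
have KC x y : K (x, y) = K (y, x).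
  by rewrite /K/= -hkerTV hinvM hinvK.
have KM x h : K (x, hmul x h) = hkerT e h by rewrite KC /K/= hmulKg.
have mkT := measurable_hkerT e.
clearbody K.
pose A := (\int[mu \x mu]_p (f p.1 * eta p.1 * K p)%:E)%E.
pose B := (\int[mu \x mu]_p (f p.1 * eta p.2 * K p)%:E)%E.
have mA : measurable_fun setT (fun p : H * H => (f p.1 * eta p.1 * K p)%:E) by mfun.
have mB : measurable_fun setT (fun p : H * H => (f p.1 * eta p.2 * K p)%:E) by mfun.
have A0 p : (0 <= (f p.1 * eta p.1 * K p)%:E)%E by rewrite lee_fin !mulr_ge0 ?hbump_ge0.
have B0 p : (0 <= (f p.1 * eta p.2 * K p)%:E)%E by rewrite lee_fin !mulr_ge0 ?hbump_ge0.
have K'0 h : 0 <= hkerT e h by exact: hkerT_ge0.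
have mA' : measurable_fun setT (fun p : H * H => (f p.1 * eta p.1 * hkerT e p.2)%:E) by mfun.
have mB' : measurable_fun setT (fun p : H * H => (f p.1 * eta (hmul p.1 p.2) * hkerT e p.2)%:E) by mfun.
have mB'' : measurable_fun setT (fun p : H * H => (f p.1 * eta (hmul p.1 (hinv p.2)) * hkerT e p.2)%:E) by mfun.
have mt : measurable_fun setT (@trunc_ker R n s rho) by exact: measurable_trunc_ker.
have mC : measurable_fun setT (fun p : H * H => (f p.1 * (32 * trunc_ker s rho p.2))%:E) by mfun.
have e0' x : 0 <= eta x by exact: hbump_ge0.
have t0 (h : H) : 0 <= trunc_ker s rho h by exact: trunc_ker_ge0.
have A'0 p : (0 <= (f p.1 * eta p.1 * hkerT e p.2)%:E)%E by rewrite lee_fin mulr3_ge0.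
have B'0 p : (0 <= (f p.1 * eta (hmul p.1 p.2) * hkerT e p.2)%:E)%E by rewrite lee_fin mulr3_ge0.
have B''0 p : (0 <= (f p.1 * eta (hmul p.1 (hinv p.2)) * hkerT e p.2)%:E)%E by rewrite lee_fin mulr3_ge0.
have C0 (p : H * H) : (0 <= (f p.1 * (32 * trunc_ker s rho p.2))%:E)%E.
  by rewrite lee_fin; apply: mulr_ge0 => //; apply: mulr_ge0.
have AE : A = (\int[mu \x mu]_p (f p.1 * eta p.1 * hkerT e p.2)%:E)%E.
  by apply: etrans (ge0_integral_hpairM mA A0) _; apply: eq_integral => p _; rewrite KM.
have BE : B = (\int[mu \x mu]_p (f p.1 * eta (hmul p.1 p.2) * hkerT e p.2)%:E)%E.
  by apply: etrans (ge0_integral_hpairM mB B0) _; apply: eq_integral => p _; rewrite KM.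
have BE' : B = (\int[mu \x mu]_p (f p.1 * eta (hmul p.1 (hinv p.2)) * hkerT e p.2)%:E)%E.
  apply: etrans BE _; apply: etrans (ge0_integral_hpairV mB' B'0) _.
  by apply: eq_integral => p _; rewrite hkerTV.
have mfE : measurable_fun setT (fun x => (f x)%:E) by mfun.
have if_fin : (\int[mu]_x (f x)%:E)%E \is a fin_num.
  by rewrite ge0_fin_numE ?integral_bump_fin//; apply: integral_ge0 => x _; rewrite lee_fin.
have CE : (Ceta%:E * \int[mu]_x (f x)%:E = \int[mu \x mu]_p (f p.1 * (32 * trunc_ker s rho p.2))%:E)%E.
  rewrite (ge0_integral_sep (g := fun h => 32 * trunc_ker s rho h))//; first last.
  - by move=> h; apply: mulr_ge0.
  - by mfun.
  have -> : (\int[mu]_x (32 * trunc_ker s rho x)%:E = 32%:E * \int[mu]_x (trunc_ker s rho x)%:E)%E.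
    rewrite -ge0_integralZl//.
    - by mfun.
    - by move=> h _; rewrite lee_fin.
  by rewrite integral_trunc_ker// -EFinM muleC.
have key : (A + A <= B + B + Ceta%:E * \int[mu]_x (f x)%:E)%E.
  rewrite {1}BE BE' AE CE.
  apply: (ge0_integral_le_sum _ _ _ _ _ A'0 B'0 B''0 C0); [by mfun|by mfun|by mfun|by mfun|].
  move=> p; apply: second_diff_key.
  - exact: f0.
  - exact: hker_ge0.
  - by rewrite le_min ler01 sqr_ge0.
  - exact: indic01.
  - by move=> fp; exact: hbump_second_diff rho0 (f_eta fp).
(* [f] is integrable, the factor [c] is at most 1 and the cut kernel has finite mass: each piece is
   finite. *)
have fin (c : H * H -> R) : measurable_fun setT c -> (forall p : H * H, 0 <= c p <= 1) ->
    (\int[mu \x mu]_p (f p.1 * c p * hkerT e p.2)%:E < +oo)%E.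
  move=> mc c01.
  apply: (@le_lt_trans _ _ (\int[mu \x mu]_p (f p.1 * hkerT e p.2)%:E)%E).
    apply: ge0_le_integral => //.
    - by move=> p _; have /andP[a0 _] := c01 p; rewrite lee_fin mulr3_ge0.
    - by mfun.
    - by mfun.
    - move=> p _; have /andP[a0 a1] := c01 p; rewrite lee_fin ler_wpM2r//.
      by rewrite ler_piMr.
  rewrite ge0_integral_sep//; apply: lte_mul_pinfty => //.
  - by apply: integral_ge0 => x _; rewrite lee_fin.
  - by apply: le_lt_trans (integral_hkerT e0) (ltry _).
have Afin : (A < +oo)%E.
  rewrite AE; apply: (fin (fun p => eta p.1)); first by mfun.
  by move=> p; rewrite e0' hbump_le1.
have Bfin : (B < +oo)%E.
  rewrite BE; apply: (fin (fun p => eta (hmul p.1 p.2))); first by mfun.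
  by move=> p; rewrite e0' hbump_le1.
have mA2 : measurable_fun setT (fun p : H * H => (f p.2 * eta p.2 * K p)%:E) by mfun.
have mB2 : measurable_fun setT (fun p : H * H => (f p.2 * eta p.1 * K p)%:E) by mfun.
have A20 p : (0 <= (f p.2 * eta p.2 * K p)%:E)%E by rewrite lee_fin mulr3_ge0.
have B20 p : (0 <= (f p.2 * eta p.1 * K p)%:E)%E by rewrite lee_fin mulr3_ge0.
have AE2 : A = (\int[mu \x mu]_p (f p.2 * eta p.2 * K p)%:E)%E.
  apply: etrans (ge0_integral_hpair_swap mA A0) _.
  by apply: eq_integral => -[x y] _; rewrite KC.
have BE2 : B = (\int[mu \x mu]_p (f p.2 * eta p.1 * K p)%:E)%E.
  apply: etrans (ge0_integral_hpair_swap mB B0) _.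
  by apply: eq_integral => -[x y] _; rewrite KC.
apply: (ge0_integral_diff_le _ _ _ _ A0 A20 B0 B20 erefl AE2 erefl BE2 Afin Bfin _ key).
- by mfun.
- by mfun.
- by mfun.
- by mfun.
- by move=> p; ring.
Qed.
End trunc.
End energy.

(** * Removing the cut near the diagonal *)

Section near_diagonal.
Context {R : realType} {n : nat}.
Local Notation H := (heis R n).

Definition hfar (j : nat) := [set p : H * H | hshell j.+1%:R^-1 (hmul (hinv p.2) p.1)].

Lemma measurable_hfar j : measurable (hfar j).
Proof.
rewrite -[X in measurable X]setTI.
have m1 : measurable_fun setT (fun p : H * H => hmul (hinv p.2) p.1) by mfun.
exact: (m1 measurableT _ (measurable_hshell _)).
Qed.

Lemma hfarE j p : (p \in hfar j) = (j.+1%:R^-1 <= hdist p.1 p.2).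
Proof.
rewrite -[hdist _ _]/(hnorm _) -hshellE.
by apply/idP/idP => /set_mem h; apply/mem_set.
Qed.

Lemma subset_hfar i j : (i <= j)%N -> hfar i `<=` hfar j.
Proof.
move=> ij p /mem_set; rewrite hfarE => ip; apply: set_mem; rewrite hfarE.
by apply: le_trans ip; rewrite lef_pV2 ?posrE ?ltr0n// ler_nat.
Qed.

Lemma hfar_near (p : H * H) : 0 < hdist p.1 p.2 ->
  exists N, forall j, (N <= j)%N -> hfar j p.
Proof.
move=> d0; exists (Num.bound (hdist p.1 p.2)^-1) => j Nj.
apply: set_mem; rewrite hfarE -[leRHS]invrK lef_pV2 ?posrE ?invr_gt0 ?ltr0n//.
apply/ltW; apply: lt_le_trans (archi_boundP _) _; first by rewrite invr_ge0 ltW.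
by rewrite ler_nat leqW.
Qed.
End near_diagonal.

Section bump_energy.
Context {R : realType} {n : nat}.
Local Notation H := (heis R n).
Local Notation mu := (@hleb R n).
Variables (s : R) (x0 : H) (rho : R).
Hypothesis s01 : 0 < s < 1.
Hypothesis rho0 : 0 < rho.
Local Notation eta := (hbump x0 rho).

(** The kernel is 0 on the diagonal, so integrands containing it vanish off the union of the sets
    [hfar j], and nothing is lost in the limit. *)
Lemma hkernel_hfar (F : H * H -> R) p : F p * hkernel s p.1 p.2 != 0 ->
  exists N, forall j, (N <= j)%N -> hfar j p.
Proof.
move=> Fp; apply: hfar_near; rewrite lt_neqAle hdist_ge0 andbT.
apply: contra_neq Fp => d0.
by rewrite /hkernel -d0 powR0 ?invr0 ?mulr0// gt_eqF// hQ2s_gt0.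
Qed.

(** The cut estimate with [f = eta] and [l = 1]: its integrand is a square, so monotone convergence
    applies without knowing the energy to be finite. *)
Lemma gagliardo2_bump_fin : (gagliardo2 s eta < +oo)%E.
Proof.
have me := measurable_hbump x0 rho.
have e0 x : 0 <= eta x by exact: hbump_ge0.
have e1 x : eta x <= 1 * eta x by rewrite mul1r.
apply: (@le_lt_trans _ _ ((Ceta (n := n) s rho)%:E * \int[mu]_x (eta x)%:E)%E); last first.
  apply: lte_mul_pinfty => //; first by rewrite lee_fin Ceta_ge0.
  exact: (integral_bump_fin rho0 me e0 e1).
rewrite gagliardo2E /hform.
apply: (@ge0_integral_indic_le _ _ _ _ _ hfar) => //.
- exact: measurable_hfar.
- exact: hkernel_hfar.
- by mfun.
- by move=> p; rewrite -expr2 mulr_ge0 ?sqr_ge0 ?hkernel_ge0.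
- exact: subset_hfar.
- move=> j; apply: (trunc_energy_bump s01 rho0 me e0 e1); by rewrite invr_gt0 ltr0n.
Qed.

(** Here the integrand has no sign; the energies of [f] and [eta] are finite and dominate it. *)
Lemma hform_bump_le (f : H -> R) (l : R) : measurable_fun setT f ->
  (forall x, 0 <= f x) -> (forall x, f x <= l * eta x) ->
  (gagliardo2 s f < +oo)%E ->
  (hform s f eta <= (Ceta (n := n) s rho)%:E * \int[mu]_x (f x)%:E)%E.
Proof.
move=> mf f0 fl fE.
have me := measurable_hbump x0 rho.
have int := integrable_energy mf me fE gagliardo2_bump_fin.
have cv := cvg_integral_indic measurable_hfar (hkernel_hfar (F := fun p => (f p.1 - f p.2) * (eta p.1 - eta p.2))) int.
rewrite /hform -(cvg_lim _ cv)//; apply: lime_le; first by apply/cvg_ex; eexists; exact: cv.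
apply: nearW => j; apply: (trunc_energy_bump s01 rho0 mf f0 fl).
by rewrite invr_gt0 ltr0n.
Qed.

End bump_energy.

(** * Smoothness of integrals of flat kernels *)

Section flat_exponential.
Context {R : realType}.
Implicit Types (t : R) (j : nat).

(** The functions [t^-j exp(-1/t)], extended by 0 to [t <= 0]. A whole family is taken because
    differentiation raises the index: the derivative of [efam j] is [- j efam (j+1) + efam (j+2)],
    at every real [t]. *)
Definition efam j t : R := if 0 < t then (t^-1) ^+ j * expR (- t^-1) else 0.

Lemma efam_ge0 j t : 0 <= efam j t.
Proof.
by rewrite /efam; case: ifPn => // t0; rewrite mulr_ge0 ?expR_ge0// exprn_ge0// invr_ge0 ltW.
Qed.

Lemma efam_le j t : efam j t <= (j`!)%:R.
Proof.
rewrite /efam; case: ifPn => // t0; rewrite expRN.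
have a0 : 0 <= t^-1 by rewrite invr_ge0 ltW.
rewrite ler_pdivrMr ?expR_gt0//; case: j => [|j].
  by rewrite expr0 fact0 mul1r (le_trans _ (expR_ge1Dx _))// lerDl.
have := expR_ge1Dxn j a0.
rewrite -ler_pdivrMl ?ltr0n ?fact_gt0// mulrC => h.
by apply: le_trans h; rewrite lerDr.
Qed.

(** Flatness at 0: with [k = 2] the difference quotient of [efam j] at 0 is [t * efam (j+2) t], and
    the last factor is bounded, so the derivative there is 0. *)
Lemma efam_shift j k t : efam j t = t ^+ k * efam (j + k) t.
Proof.
rewrite /efam; case: ifPn => t0; last by rewrite mulr0.
by rewrite exprD !exprVn; field; rewrite !expf_neq0 ?gt_eqF.
Qed.

Lemma is_derive_efam j t :
  is_derive t (1 : R) (efam j) (- j%:R * efam j.+1 t + efam j.+2 t).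
Proof.
have [t0|t0|t0] := ltgtP t 0.
- apply: (near_eq_is_derive (f := cst 0)).
    near=> u; rewrite /efam ltNge ltW//=.
    by near: u; exact: lt_nbhsl.
  rewrite /efam !ltNge (ltW t0)/= mulr0 addr0; exact: is_derive_cst.
- pose g (u : R) : R := (u^-1) ^+ j * expR (- u^-1).
  apply: (near_eq_is_derive (f := g)).
    near=> u; rewrite /efam /g ifT//.
    by near: u; exact: lt_nbhsr.
  have dV : is_derive t (1 : R) (fun u : R => u^-1) (- t ^- 2 *: (1 : R)).
    by apply: is_deriveV; rewrite ?gt_eqF.
  have dX := is_deriveX j dV.
  have dE : is_derive t (1 : R) (fun u : R => expR (- u^-1)) (expR (- t^-1) * (- (- t ^- 2 *: (1 : R)))).
    by apply: (is_derive1_comp (f := expR)); exact: is_deriveN.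
  have := is_deriveM dX dE.
  rewrite [X in is_derive _ _ X _](_ : _ = g); last first.
    by apply/funext => u; rewrite /g /= -fctE exprfctE.
  move=> h; apply: (is_derive_eq h); rewrite /efam t0.
  rewrite /GRing.scale/= !mulr1 /= exprfctE.
  case: j {g dX h} => [|j].
    by rewrite !expr0 !mul0r mulr0 mul1r addr0 oppr0 mul0r add0r exprVn; ring.
  rewrite -pred_Sn !exprS !exprVn; field.
  by rewrite expf_neq0 ?gt_eqF.
- rewrite t0 {t0 t}.
  have -> : - j%:R * efam j.+1 0 + efam j.+2 0 = 0 :> R by rewrite /efam ltxx mulr0 addr0.
  have cv : (h^-1 *: ((efam j \o shift 0) (h *: (1 : R)) - efam j 0)) @[h --> 0^'] --> (0 : R).
    apply/norm_cvg0P.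
    apply: (@squeeze_cvgr _ _ _ _ (cst 0) (fun h : R => (j.+2)`!%:R * `|h|)).
    + near=> h; rewrite normr_ge0/= /shift/= addr0.
      have h0 : h != 0 by near: h; exact: nbhs_dnbhs_neq.
      rewrite {2}/efam ltxx subr0 /GRing.scale/= mulr1 (efam_shift j 2) addn2.
      rewrite expr2 -mulrA mulKf// normrM (ger0_norm (efam_ge0 _ _)) mulrC.
      by rewrite ler_wpM2r// efam_le.
    + exact: cvg_cst.
    + rewrite -[X in _ --> X](mulr0 (j.+2)`!%:R).
      apply: cvgM; first exact: cvg_cst.
      have c0 : `|h| @[h --> (0:R)] --> `|0 : R| by apply: norm_continuous.
      by rewrite normr0 in c0; apply: cvg_within_filter c0.
  apply: DeriveDef; first by apply/cvg_ex; exists 0.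
  exact: cvg_lim cv.
Unshelve. all: by end_near.
Qed.

Lemma efam_Lipschitz j t u : `|efam j t - efam j u| <=
  (j%:R * (j.+1)`!%:R + (j.+2)`!%:R) * `|t - u|.
Proof.
wlog tu : t u / t < u.
  move=> hw; have [tu|ut|->] := ltgtP t u; first exact: hw.
    by rewrite distrC (distrC t); exact: hw.
  by rewrite !subrr normr0 mulr0.
have cf : {within `[t, u], continuous (efam j)}.
  apply: continuous_subspaceT => z; apply: differentiable_continuous.
  by apply/derivable1_diffP; apply: (@ex_derive _ _ _ _ _ _ _ (is_derive_efam j z)).
have [c _ E] := MVT tu (fun z _ => is_derive_efam j z) cf.
rewrite distrC E normrM (distrC t) ler_wpM2r//.
apply: le_trans (ler_normD _ _) _; rewrite lerD//.
  rewrite normrM normrN (ger0_norm (efam_ge0 _ _)) ger0_norm//.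
  by rewrite ler_wpM2l// efam_le.
by rewrite ger0_norm ?efam_ge0// efam_le.
Qed.

Lemma measurable_efam j : measurable_fun [set: R] (efam j).
Proof.
apply: continuous_measurable_fun => z; apply: differentiable_continuous.
by apply/derivable1_diffP; apply: (@ex_derive _ _ _ _ _ _ _ (is_derive_efam j z)).
Qed.

End flat_exponential.

Section kernel_expressions.
Context {R : realType} {m : nat}.
Local Notation V := 'rV[R]_m.
Implicit Types (x y v : V) (i : 'I_m).

(* Functions [k(x, y)] obtained from the coordinates of [x] and [y] by sums,
   products and the flat functions [efam j]; this class is stable under
   differentiation in [x]. *)
Inductive kexpr : Type :=
| KX of 'I_m | KY of 'I_m | KC of R
| KAdd of kexpr & kexpr | KMul of kexpr & kexpr | KE of nat & kexpr.

Fixpoint keval (e : kexpr) x y : R :=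
  match e with
  | KX i => x ord0 i
  | KY i => y ord0 i
  | KC c => c
  | KAdd e1 e2 => keval e1 x y + keval e2 x y
  | KMul e1 e2 => keval e1 x y * keval e2 x y
  | KE j e1 => efam j (keval e1 x y)
  end.

Fixpoint kderive i (e : kexpr) : kexpr :=
  match e with
  | KX k => KC (k == i)%:R
  | KY _ | KC _ => KC 0
  | KAdd e1 e2 => KAdd (kderive i e1) (kderive i e2)
  | KMul e1 e2 => KAdd (KMul e1 (kderive i e2)) (KMul e2 (kderive i e1))
  | KE j e1 =>
      KMul (KAdd (KMul (KC (- j%:R)) (KE j.+1 e1)) (KE j.+2 e1)) (kderive i e1)
  end.

Local Notation dir i := (delta_mx ord0 i : V).

Lemma is_derive_keval e i x y (t : R) :
  is_derive t (1 : R) (fun t => keval e (t *: dir i + x) y)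
    (keval (kderive i e) (t *: dir i + x) y).
Proof.
elim: e => [k|k|c|e1 IH1 e2 IH2|e1 IH1 e2 IH2|j e1 IH1] /=.
- have -> : (fun t : R => (t *: dir i + x) ord0 k) =
      (fun t : R => (k == i)%:R * t + x ord0 k).
    by apply/funext => u; rewrite !mxE eqxx/= mulrC.
  have := is_deriveD (is_deriveZ (k == i)%:R (is_derive_id t (1 : R))) (is_derive_cst (x ord0 k) t (1 : R)).
  move=> h; apply: (is_derive_eq h).
  by rewrite addr0 /GRing.scale/= mulr1.
- exact: is_derive_cst.
- exact: is_derive_cst.
- exact: is_deriveD.
- exact: (is_deriveM IH1 IH2).
- exact: (is_derive1_comp (is_derive_efam j _) IH1).
Qed.

Lemma keval_bound e (M : R) : 0 <= M -> exists2 B : R, 0 <= B &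
  forall x y, (forall i, `|x ord0 i| <= M) -> (forall i, `|y ord0 i| <= M) ->
  `|keval e x y| <= B.
Proof.
move=> M0; elim: e => [k|k|c|e1 [B1 B10 IH1] e2 [B2 B20 IH2]|e1 [B1 B10 IH1] e2 [B2 B20 IH2]|j e1 _] /=.
- by exists M.
- by exists M.
- by exists `|c|.
- exists (B1 + B2) => [|x y xM yM]; first exact: addr_ge0.
  by rewrite (le_trans (ler_normD _ _))// lerD ?IH1 ?IH2.
- exists (B1 * B2) => [|x y xM yM]; first exact: mulr_ge0.
  by rewrite normrM ler_pM ?IH1 ?IH2.
- exists (j`!)%:R => // x y _ _.
  by rewrite ger0_norm ?efam_ge0// efam_le.
Qed.

Lemma keval_Lipschitz e (M : R) : 0 <= M -> exists2 L : R, 0 <= L &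
  forall x x' y, (forall i, `|x ord0 i| <= M) -> (forall i, `|x' ord0 i| <= M) ->
  (forall i, `|y ord0 i| <= M) -> `|keval e x y - keval e x' y| <= L * `|x - x'|.
Proof.
move=> M0; elim: e => [k|k|c|e1 [B1 B10 IH1] e2 [B2 B20 IH2]|e1 [L1 L10 IH1] e2 [L2 L20 IH2]|j e1 [B1 B10 IH1]] /=.
- exists 1 => // x x' y _ _ _; rewrite mul1r.
  have -> : x ord0 k - x' ord0 k = (x - x') ord0 k by rewrite !mxE.
  rewrite [leRHS]mx_normrE; apply: (le_bigmax _ (fun ij => `|(x - x') ij.1 ij.2|) (ord0, k)).
- by exists 0 => // x x' y _ _ _; rewrite subrr normr0 mul0r.
- by exists 0 => // x x' y _ _ _; rewrite subrr normr0 mul0r.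
- exists (B1 + B2) => [|x x' y xM x'M yM]; first exact: addr_ge0.
  rewrite opprD addrACA (le_trans (ler_normD _ _))// mulrDl.
  by rewrite lerD ?IH1 ?IH2.
- have [B1 B10 HB1] := keval_bound e1 M0.
  have [B2 B20 HB2] := keval_bound e2 M0.
  exists (B1 * L2 + B2 * L1) => [|x x' y xM x'M yM]; first by rewrite addr_ge0 ?mulr_ge0.
  have -> : keval e1 x y * keval e2 x y - keval e1 x' y * keval e2 x' y =
    keval e1 x y * (keval e2 x y - keval e2 x' y) + keval e2 x' y * (keval e1 x y - keval e1 x' y) by ring.
  rewrite (le_trans (ler_normD _ _))// mulrDl lerD// normrM -mulrA ler_pM//.
  + exact: HB1. + exact: IH2. + exact: HB2. + exact: IH1.
- exists ((j%:R * (j.+1)`!%:R + (j.+2)`!%:R) * B1) => [|x x' y xM x'M yM].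
    by rewrite mulr_ge0// addr_ge0// mulr_ge0.
  rewrite (le_trans (efam_Lipschitz _ _ _))// -mulrA ler_wpM2l ?IH1//.
Qed.

Lemma measurable_keval e : measurable_fun [set: V * V] (fun p : V * V => keval e p.1 p.2).
Proof.
elim: e => [k|k|c|e1 IH1 e2 IH2|e1 IH1 e2 IH2|j e1 IH1] /=.
- exact: (measurableT_comp (measurable_coord k) measurable_fst).
- exact: (measurableT_comp (measurable_coord k) measurable_snd).
- exact: measurable_cst.
- exact: measurable_funD.
- exact: measurable_funM.
- exact: (measurableT_comp (measurable_efam j) IH1).
Qed.

Definition expressible (k : V -> V -> R) := exists e, forall x y, keval e x y = k x y.

Lemma expressibleD k1 k2 : expressible k1 -> expressible k2 ->
  expressible (fun x y => k1 x y + k2 x y).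
Proof. by move=> [e1 E1] [e2 E2]; exists (KAdd e1 e2) => x y /=; rewrite E1 E2. Qed.
Lemma expressibleM k1 k2 : expressible k1 -> expressible k2 ->
  expressible (fun x y => k1 x y * k2 x y).
Proof. by move=> [e1 E1] [e2 E2]; exists (KMul e1 e2) => x y /=; rewrite E1 E2. Qed.
Lemma expressibleC c : expressible (fun _ _ => c).
Proof. by exists (KC c). Qed.
Lemma expressibleX i : expressible (fun x _ => x ord0 i).
Proof. by exists (KX i). Qed.
Lemma expressibleY i : expressible (fun _ y => y ord0 i).
Proof. by exists (KY i). Qed.
Lemma expressible_efam j k : expressible k -> expressible (fun x y => efam j (k x y)).
Proof. by move=> [e E]; exists (KE j e) => x y /=; rewrite E. Qed.
Lemma expressibleN k : expressible k -> expressible (fun x y => - k x y).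
Proof. by move=> [e E]; exists (KMul (KC (-1)) e) => x y /=; rewrite E mulN1r. Qed.
Lemma expressible_sum (I : finType) (k : I -> V -> V -> R) :
  (forall a, expressible (k a)) -> expressible (fun x y => \sum_a k a x y).
Proof.
move=> ke; elim: (index_enum I) => [|a r [e E]].
  by exists (KC 0) => x y; rewrite big_nil.
have [ea Ea] := ke a; exists (KAdd ea e) => x y /=.
by rewrite big_cons Ea E.
Qed.

End kernel_expressions.

Section kernel_integral.
Context {R : realType} {m : nat}.
Local Notation V := 'rV[R]_m.
Variables (mu : {measure set V -> \bar R}) (w : V -> R) (M : R).
Hypothesis mw : measurable_fun setT w.
Hypothesis iw : mu.-integrable setT (EFin \o w).
Hypothesis wM : forall y, w y != 0 -> forall i, `|y ord0 i| <= M.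
Implicit Types (x y v : V) (i : 'I_m) (e : @kexpr R m).

Local Notation dir i := (delta_mx ord0 i : V).

Definition kint e x : R := \int[mu]_y (keval e x y * w y).

Let coord_le x i : `|x ord0 i| <= `|x|.
Proof. by rewrite [leRHS]mx_normrE; apply: (le_bigmax _ (fun ij => `|x ij.1 ij.2|) (ord0, i)). Qed.

Let M' (r : R) := `|M| + r.

Lemma keval_mulw_le e r : 0 <= r -> exists2 B : R, 0 <= B &
  forall x y, (forall i, `|x ord0 i| <= r) -> `|keval e x y * w y| <= B * `|w y|.
Proof.
move=> r0; have [B B0 HB] := @keval_bound R m e (M' r) (addr_ge0 (normr_ge0 _) r0).
exists B => // x y xr; have [->|wy] := eqVneq (w y) 0.
  by rewrite mulr0 normr0 mulr0.
rewrite normrM ler_wpM2r// HB// => i.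
  by rewrite (le_trans (xr i))// lerDr.
by rewrite (le_trans (wM wy i))// (le_trans (ler_norm _))// lerDl.
Qed.

Let mkw e x : measurable_fun setT (fun y => keval e x y * w y).
Proof.
apply: measurable_funM => //.
apply: (measurableT_comp (measurable_keval e) (g := fun y => (x, y))).
exact: measurable_pair1.
Qed.

Let iabsw (B : R) : mu.-integrable setT (EFin \o (fun y => B * `|w y|)).
Proof.
rewrite (_ : _ \o _ = (fun y => B%:E * `|(EFin \o w) y|)%E); last first.
  by apply/funext => y /=; rewrite EFinM.
by apply: integrableZl => //; exact: integrable_abse.
Qed.

Lemma integrable_keval e x : mu.-integrable setT (EFin \o (fun y => keval e x y * w y)).
Proof.
have [B B0 HB] := keval_mulw_le e (normr_ge0 x).
apply: (le_integrable measurableT _ _ (iabsw B)).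
  by apply/measurable_EFinP; exact: mkw.
move=> y _ /=; rewrite lee_fin [leRHS]ger0_norm ?mulr_ge0//.
by apply: HB => i; exact: coord_le.
Qed.

(** Differentiation under the integral, along the segment [x + t dir i] with [|t| < 1]. The
    domination comes from the boundedness of [w]'s support: all coordinates entering [kderive i e]
    stay in a fixed box. As the derivative is again a [kint], the argument iterates to all
    orders. *)
Lemma is_derive_kint e i x : is_derive x (dir i) (kint e) (kint (kderive i e) x).
Proof.
pose f (t : R) y := keval e (t *: dir i + x) y * w y.
have df t y : is_derive t (1 : R) (f ^~ y) (keval (kderive i e) (t *: dir i + x) y * w y).
  have := is_deriveM (is_derive_keval e i x y t) (is_derive_cst (w y) t (1 : R)).
  move=> h; apply: (is_derive_eq h).
  by rewrite scaler0 add0r /GRing.scale/= mulrC.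
have d1 t y : partial1of2 f t y = keval (kderive i e) (t *: dir i + x) y * w y.
  by rewrite partial1of2E (@derive_val _ _ _ _ _ _ _ (df t y)).
have [B B0 HB] := @keval_mulw_le (kderive i e) (`|x| + 1) (addr_ge0 (normr_ge0 x) ler01).
have I0 : `](-1 : R), 1[%classic 0 by rewrite /= in_itv/= ltrN10 ltr01.
have := @cvg_differentiation_under_integral R _ _ mu f setT measurableT 0 (-1) 1 I0
  (fun t _ => integrable_keval e (t *: dir i + x))
  (fun t y _ _ => @ex_derive _ _ _ _ _ _ _ (df t y))
  (fun y => B * `|w y|) (fun y => mulr_ge0 B0 (normr_ge0 _)) (iabsw B).
have Hb : forall (t : R) (y : V), `](-1 : R), 1[%classic t -> setT y -> `|partial1of2 f t y| <= B * `|w y|.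
  move=> t y; rewrite /= in_itv/= => /andP[t1 t2] _; rewrite d1; apply: HB => k.
  rewrite mxE (le_trans (ler_normD _ _))// addrC lerD//.
  rewrite !mxE eqxx/= normrM; case: eqP => _; rewrite ?normr1 ?normr0 ?mulr0 ?mulr1//.
  by rewrite ler_norml !ltW.
move=> /(_ Hb) cv.
have {}cv : (h^-1 *: ((kint e \o shift x) (h *: dir i) - kint e x)) @[h --> 0^'] --> kint (kderive i e) x.
  move: cv; rewrite (_ : \int[mu]_(y in setT) partial1of2 f 0 y = kint (kderive i e) x); last first.
    by apply: eq_Rintegral => y _; rewrite d1 scale0r add0r.
  apply: cvg_trans; apply: near_eq_cvg; near=> h.
  by rewrite /kint /f /= addr0 scale0r add0r.
apply: DeriveDef; first by apply/cvg_ex; eexists; exact: cv.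
exact: cvg_lim cv.
Unshelve. all: by end_near.
Qed.

Lemma continuous_kint e : continuous (kint e).
Proof.
move=> x.
have [L L0 HL] := @keval_Lipschitz R m e (M' (`|x| + 1))
  (addr_ge0 (normr_ge0 _) (addr_ge0 (normr_ge0 x) ler01)).
pose W := \int[mu]_y `|w y|.
have W0 : 0 <= W by apply: Rintegral_ge0.
have lip x' : `|x - x'| <= 1 -> `|kint e x - kint e x'| <= L * W * `|x - x'|.
  have iD : mu.-integrable setT (EFin \o (fun y => keval e x y * w y - keval e x' y * w y)).
    exact: (integrableB measurableT (integrable_keval e x) (integrable_keval e x')).
  move=> xx'; rewrite /kint -RintegralB//; [|exact: integrable_keval|exact: integrable_keval].
  apply: (@le_trans _ _ (\int[mu]_y `|keval e x y * w y - keval e x' y * w y|)).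
    exact: le_normr_Rintegral.
  have -> : L * W * `|x - x'| = \int[mu]_y ((L * `|x - x'|) * `|w y|).
    rewrite mulrAC; apply/esym; apply: RintegralZl => //.
    exact: (integrable_abse iw).
  apply: le_Rintegral => //.
  - exact: (integrable_abse iD).
  - move=> y _; have [->|wy] := eqVneq (w y) 0.
      by rewrite !mulr0 subrr normr0 mulr0.
    rewrite -mulrBl normrM ler_wpM2r//; apply: HL => i.
    + by rewrite (le_trans (coord_le x i))// /M' addrCA lerDl addr_ge0.
    + have -> : x' = x - (x - x') by rewrite subKr.
      rewrite (le_trans (coord_le _ i))// (le_trans (ler_normB _ _))//.
      by rewrite /M' addrCA lerD2l (le_trans xx')// lerDr.
    + by rewrite (le_trans (wM wy i))// (le_trans (ler_norm _))// lerDl addr_ge0.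
have FF : ProperFilter (nbhs x) by exact: mx_nbhs_filter.
apply/cvgrPdist_le => eps eps0.
near=> x'.
have x1 : `|x - x'| <= 1 by near: x'; exact: cvgr_dist_le.
apply: le_trans (lip _ x1) _.
have : `|x - x'| <= eps / (L * W + 1).
  near: x'; apply: cvgr_dist_le => //.
  by rewrite divr_gt0// ltr_wpDl// mulr_ge0.
rewrite ler_pdivlMr ?ltr_wpDl ?mulr_ge0// mulrDr mulr1 mulrC.
by apply: le_trans; rewrite lerDl.
Unshelve. all: by end_near.
Qed.

End kernel_integral.

Lemma Ck_kint {R : realType} {n : nat} (mu : {measure set (heis R n) -> \bar R})
    (w : heis R n -> R) (M : R) k e :
  measurable_fun setT w -> mu.-integrable setT (EFin \o w) ->
  (forall y, w y != 0 -> forall i, `|y ord0 i| <= M) -> Ck k (kint mu w e).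
Proof.
move=> mw iw wM; elim: k e => [|k IH] e; first exact: (continuous_kint mw iw wM).
move=> i; split=> [x|].
  exact: (@ex_derive _ _ _ _ _ _ _ (is_derive_kint mw iw wM e i x)).
rewrite (_ : partial i (kint mu w e) = kint mu w (kderive i e)); first exact: IH.
by apply/funext => x; exact: (@derive_val _ _ _ _ _ _ _ (is_derive_kint mw iw wM e i x)).
Qed.

(** * Averages *)

Section average.
Context d {U : measurableType d} {R : realType}.
Variables (nu : {measure set U -> \bar R}) (phi : U -> R) (c : R).
Hypothesis mphi : measurable_fun setT phi.
Hypothesis phi0 : forall z, 0 <= phi z.
Hypothesis phic : (\int[nu]_z (phi z)%:E = c%:E)%E.
Hypothesis c0 : 0 < c.
Implicit Types (g : U -> R) (K : R).

Definition avg g : R := c^-1 * \int[nu]_z (phi z * g z).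

Let iphi : nu.-integrable setT (EFin \o phi).
Proof.
apply/integrableP; split; first exact/measurable_EFinP.
under eq_integral do rewrite gee0_abs ?lee_fin//.
by rewrite phic ltry.
Qed.

Lemma integrable_phiM g K : measurable_fun setT g -> (forall z, `|g z| <= K) ->
  nu.-integrable setT (EFin \o (fun z => phi z * g z)).
Proof.
move=> mg gK; apply: (le_integrable measurableT _ _ (integrableZl measurableT K iphi)).
  by apply/measurable_EFinP; exact: measurable_funM.
move=> z _ /=; rewrite lee_fin mulrC !normrM (ger0_norm (phi0 z)) ler_wpM2r//.
by rewrite (le_trans (gK z))// ler_norm.
Qed.

Lemma avg_cst a : avg (fun=> a) = a.
Proof.
rewrite /avg; under eq_Rintegral do rewrite mulrC.
rewrite RintegralZl// /Rintegral phic/= mulrCA mulVf ?mulr1//.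
by rewrite gt_eqF.
Qed.

Lemma avgB g1 g2 K1 K2 : measurable_fun setT g1 -> (forall z, `|g1 z| <= K1) ->
  measurable_fun setT g2 -> (forall z, `|g2 z| <= K2) ->
  avg (fun z => g1 z - g2 z) = avg g1 - avg g2.
Proof.
move=> mg1 g1K mg2 g2K; rewrite /avg -mulrBr; congr (_ * _).
under eq_Rintegral do rewrite mulrBr.
rewrite RintegralB//; [exact: integrable_phiM g1K|exact: integrable_phiM g2K].
Qed.

Lemma avg_eq0 g : (forall z, phi z * g z = 0) -> avg g = 0.
Proof.
move=> g0; rewrite /avg /Rintegral.
by under eq_integral do rewrite g0; rewrite integral0 mulr0.
Qed.

Lemma avg_ge0 g : (forall z, 0 <= g z) -> 0 <= avg g.
Proof.
move=> g0; rewrite mulr_ge0 ?invr_ge0 ?(ltW c0)//.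
by apply: Rintegral_ge0 => z _; rewrite mulr_ge0.
Qed.

Lemma avg_le g K : measurable_fun setT g -> (forall z, `|g z| <= K) -> avg g <= K.
Proof.
move=> mg gK; rewrite -[leRHS]avg_cst /avg.
rewrite ler_pM2l ?invr_gt0//; apply: le_Rintegral => //.
- exact: integrable_phiM gK.
- by apply: (@integrable_phiM _ `|K|).
- by move=> z _; rewrite ler_wpM2l// (le_trans (ler_norm _)).
Qed.

(* Jensen's inequality: integrate [2 a phi g <= phi g^2 + a^2 phi] for [a = avg g]. *)
Lemma avg_jensen g K : measurable_fun setT g -> (forall z, `|g z| <= K) ->
  ((avg g ^+ 2)%:E <= (c^-1)%:E * \int[nu]_z (phi z * g z ^+ 2)%:E)%E.
Proof.
move=> mg gK; set a := avg g.
have K0 : 0 <= K ^+ 2 by exact: sqr_ge0.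
have i1 := integrable_phiM mg gK.
have i2 : nu.-integrable setT (EFin \o (fun z => phi z * g z ^+ 2)).
  apply: (@integrable_phiM (fun z => g z ^+ 2) (K ^+ 2)); first exact: measurable_funX.
  by move=> z; rewrite normrX ler_sqr ?nnegrE// (le_trans _ (gK z)).
have I2 : (\int[nu]_z (phi z * g z ^+ 2)%:E = (\int[nu]_z (phi z * g z ^+ 2))%:E)%E.
  by rewrite /Rintegral fineK//; exact: integrable_fin_num.
rewrite I2 -EFinM lee_fin ler_pdivlMl// mulrC.
have aE : \int[nu]_z (phi z * g z) = c * a by rewrite /a /avg mulVKf// gt_eqF.
have : 2 * a * \int[nu]_z (phi z * g z) <= \int[nu]_z (phi z * g z ^+ 2) + a ^+ 2 * c.
  have -> : c = \int[nu]_z phi z by rewrite /Rintegral phic.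
  rewrite -!RintegralZl//.
  have i3 : nu.-integrable setT (EFin \o (fun z => a ^+ 2 * phi z)).
    exact: (integrableZl measurableT (a ^+ 2) iphi).
  rewrite -RintegralD//; apply: le_Rintegral => //.
  - exact: (integrableZl measurableT (2 * a) i1).
  - exact: (integrableD measurableT i2 i3).
  - move=> z _; rewrite -subr_ge0.
    have -> : phi z * g z ^+ 2 + a ^+ 2 * phi z - 2 * a * (phi z * g z) = phi z * (g z - a) ^+ 2 by ring.
    by rewrite mulr_ge0 ?sqr_ge0.
rewrite aE; nra.
Qed.

End average.

Lemma measurable_avg d d' (T : measurableType d) (U : measurableType d') (R : realType)
    (nu : {sigma_finite_measure set U -> \bar R}) (phi : U -> R) (c : R) (g : T * U -> R) :
  measurable_fun setT phi -> (forall z, 0 <= phi z) ->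
  measurable_fun setT g -> (forall p, 0 <= g p) ->
  measurable_fun setT (fun x => avg nu phi c (fun z => g (x, z))).
Proof.
move=> mphi phi0 mg g0; apply: measurable_funM => //.
apply: (measurableT_comp (@fine_measurable R setT measurableT)).
apply: (measurable_fun_fubini_tonelli_F (m2 := nu) (fun p => (phi p.2 * g p)%:E)).
  apply/measurable_EFinP; apply: measurable_funM => //.
  exact: (measurableT_comp mphi measurable_snd).
by move=> p; rewrite lee_fin mulr_ge0.
Qed.

(** The pair is opened into its coordinates, so that [z] is exchanged first with the second
    coordinate, then with the first, by the two-variable theorem. *)
Lemma fubini_tonelli_prod d1 d2 d3 (T1 : measurableType d1) (T2 : measurableType d2)
    (T3 : measurableType d3) (R : realType)
    (m1 : {sigma_finite_measure set T1 -> \bar R})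
    (m2 : {sigma_finite_measure set T2 -> \bar R})
    (m3 : {sigma_finite_measure set T3 -> \bar R}) (G : (T1 * T2) * T3 -> \bar R) :
  measurable_fun setT G -> (forall q, 0 <= G q)%E ->
  (\int[m1 \x m2]_p \int[m3]_z G (p, z) = \int[m3]_z \int[m1 \x m2]_p G (p, z))%E.
Proof.
move=> mG G0.
have mI : measurable_fun setT (fun p => \int[m3]_z G (p, z))%E.
  exact: (measurable_fun_fubini_tonelli_F (m2 := m3) _ mG).
have I0 p : (0 <= \int[m3]_z G (p, z))%E by exact: integral_ge0.
apply: etrans (fubini_tonelli1 _ mI I0) _; rewrite /fubini_F/=.
have mGx x : measurable_fun setT (fun q : T2 * T3 => G ((x, q.1), q.2)).
  apply: (measurableT_comp mG); apply/measurable_fun_pair => //.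
  by apply/measurable_fun_pair.
under eq_integral => x _ do rewrite (fubini_tonelli (m1 := m2) (m2 := m3) _ (mGx x) (fun q => G0 _)) /=.
have mG' : measurable_fun setT (fun q : (T1 * T3) * T2 => G ((q.1.1, q.2), q.1.2)).
  apply: (measurableT_comp mG); apply/measurable_fun_pair.
    apply/measurable_fun_pair => //.
    exact: (measurableT_comp measurable_fst measurable_fst).
  exact: (measurableT_comp measurable_snd measurable_fst).
have mJ : measurable_fun setT (fun q : T1 * T3 => \int[m2]_y G ((q.1, y), q.2))%E.
  exact: (measurable_fun_fubini_tonelli_F (m2 := m2) _ mG' (fun q => G0 _)).
have J0 q : (0 <= \int[m2]_y G ((q.1, y), q.2))%E by exact: integral_ge0.
apply: etrans (fubini_tonelli (m1 := m1) (m2 := m3) _ mJ J0) _ => /=.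
apply: eq_integral => z _; apply/esym.
have mGz : measurable_fun setT (fun p : T1 * T2 => G (p, z)).
  by apply: (measurableT_comp mG); exact: measurable_pair2.
exact: (fubini_tonelli1 _ mGz (fun p => G0 _)).
Qed.

(** * Right invariance, conjugation and the size of bumps *)

Section heis_extra.
Context {R : realType} {n : nat}.
Local Notation H := (heis R n).
Local Notation mu := (@hleb R n).

Lemma dotv_eq0 (v : 'rV[R]_n) : dotv v v = 0 -> v = 0.
Proof.
move/eqP; rewrite psumr_eq0; last by move=> i _; rewrite -expr2 sqr_ge0.
move=> /allP v0; apply/rowP => i; rewrite mxE; apply/eqP.
by have := v0 i (mem_index_enum _); rewrite mulf_eq0 orbb.
Qed.

Lemma hnorm_eq0 (h : H) : hnorm h = 0 -> h = 0.
Proof.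
move=> h0; have : hnorm4 h = 0 by rewrite -hnormX4 h0 expr0n.
Transparent hnorm4.
rewrite /hnorm4 => /eqP; rewrite paddr_eq0 ?sqr_ge0// !sqrf_eq0 => /andP[].
rewrite /hz2 paddr_eq0 ?dotv_ge0// => /andP[/eqP/dotv_eq0 xh /eqP/dotv_eq0 yh] /eqP th.
by apply: heisP; rewrite ?xh ?yh ?th ?hx0 ?hy0 ?ht0.
Opaque hnorm4.
Qed.

(** Unimodularity: inverting [x] changes [x a] into [x^-1 a], whose change of variable is known. *)
Lemma ge0_integral_hmulr (a : H) (f : H -> \bar R) :
  measurable_fun setT f -> (forall x, 0 <= f x)%E ->
  (\int[mu]_x f (hmul x a) = \int[mu]_x f x)%E.
Proof.
move=> mf f0.
have mf' : measurable_fun setT (fun x => f (hmul x a)).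
  by apply: (measurableT_comp mf); mfun.
apply: etrans (esym (ge0_integral_hinv mf' (fun x => f0 _))) _.
exact: ge0_integral_hmulV.
Qed.

(** The norm is not invariant under conjugation: [y^-1 z y] has the horizontal part of [z] and its
    height moved by [4 him z y], of size [d r]. So a conjugate of an element of size [d] has size of
    order [d^(1/2)], uniformly for [y] in a ball, which still tends to 0. *)
Lemma hnorm_conj (z y : H) (d r : R) : d <= 1 -> hnorm z <= d -> hnorm y <= r ->
  hnorm (hmul (hmul (hinv y) z) y) ^+ 4 <= d ^+ 2 * (1 + (1 + 4 * r) ^+ 2).
Proof.
move=> d1 zd yr.
have [z0 y0] := (hnorm_ge0 z, hnorm_ge0 y).
have d0 := le_trans z0 zd; have r0 := le_trans y0 yr.
rewrite hnormX4.
have -> : hnorm4 (hmul (hmul (hinv y) z) y) = hz2 z ^+ 2 + (ht z + 4 * him z y) ^+ 2.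
  Transparent hnorm4.
  rewrite /hnorm4 /hz2 !hE !dotvE /him.
  Opaque hnorm4.
  rewrite (dotvC (hx y) (hx z)) (dotvC (hy y) (hy z)) (dotvC (hy y) (hx z)) (dotvC (hx y) (hy z)).
  by rewrite (dotvC (hy y) (hx y)); ring.
have zz : hz2 z <= d ^+ 2.
  by rewrite (le_trans (hz2_le z))// ler_sqr ?nnegrE.
have tz : `|ht z| <= d ^+ 2.
  by rewrite (le_trans (ht_le z))// ler_sqr ?nnegrE.
have iz : `|him z y| <= d * r.
  rewrite -(@ler_sqr R) ?nnegrE ?mulr_ge0// real_normK ?num_real// exprMn.
  have yy : hz2 y <= r ^+ 2 by rewrite (le_trans (hz2_le y))// ler_sqr ?nnegrE.
  apply: (@le_trans _ _ (hz2 z * hz2 y)).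
    by apply: le_trans (hre_him_le z y); rewrite lerDr sqr_ge0.
  by rewrite ler_pM ?hz2_ge0.
have dd : d ^+ 2 <= d by rewrite expr2 ler_piMl.
have tt : `|ht z + 4 * him z y| <= d * (1 + 4 * r).
  rewrite (le_trans (ler_normD _ _))// normrM ger0_norm// mulrDr mulr1.
  by rewrite lerD ?(le_trans tz)// mulrCA ler_wpM2l.
rewrite (_ : _ * (1 + _) = d ^+ 2 + (d * (1 + 4 * r)) ^+ 2); last by ring.
rewrite lerD//.
  rewrite (@le_trans _ _ ((d ^+ 2) ^+ 2))// ?ler_sqr ?nnegrE ?hz2_ge0 ?sqr_ge0//.
by rewrite -real_normK ?num_real// ler_sqr ?nnegrE ?mulr_ge0 ?addr_ge0 ?mulr_ge0.
Qed.

Lemma hbump_Lipschitz d (a b : H) : 0 < d ->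
  `|hbump 0 d (hmul a b) - hbump 0 d a| <= 4 / d * hnorm b.
Proof.
move=> d0.
pose g (t : R) := Num.max 0 (1 - (t / d) ^+ 4).
have gE h : hbump 0 d h = g (hnorm h).
  by rewrite /hbump /g (_ : hmul (hinv 0) h = h) -?hnormX4 ?expr_div_n// -{1}[h]hmul0l hmulKg.
have gle t u : 0 <= t -> t <= u -> `|g u - g t| <= 4 / d * (u - t).
  move=> t0 tu; rewrite /g.
  have [a0 ab] : 0 <= t / d /\ t / d <= u / d by rewrite divr_ge0 ?(ltW d0)// ler_pM2r ?invr_gt0.
  rewrite [4 / d * _](_ : _ = 4 * (u / d - t / d)); last by rewrite -mulrBl mulrA mulrAC -mulrA.
  move: (t / d) (u / d) a0 ab => a' b' a0 ab.
  have b0 := le_trans a0 ab.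
  have ab4 : a' ^+ 4 <= b' ^+ 4 by rewrite ler_pXn2r.
  rewrite distrC ger0_norm; last by rewrite subr_ge0 le_max2// lerD2l lerN2.
  have [b1|b1] := leP b' 1.
    have a1 := le_trans ab b1.
    rewrite (max_idPr _) ?subr_ge0 ?exprn_ile1// (max_idPr _) ?subr_ge0 ?exprn_ile1//.
    have -> : 1 - a' ^+ 4 - (1 - b' ^+ 4) = (b' - a') * (b' ^+ 3 + b' ^+ 2 * a' + b' * a' ^+ 2 + a' ^+ 3) by ring.
    rewrite mulrC ler_wpM2r ?subr_ge0//.
    have h3 : b' ^+ 3 <= 1 by rewrite exprn_ile1.
    have h4 : a' ^+ 3 <= 1 by rewrite exprn_ile1.
    have h5 : b' ^+ 2 * a' <= 1 by rewrite mulr_ile1 ?exprn_ile1 ?sqr_ge0.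
    have h6 : b' * a' ^+ 2 <= 1 by rewrite mulr_ile1 ?exprn_ile1 ?sqr_ge0.
    lra.
  have -> : Num.max 0 (1 - b' ^+ 4) = 0.
    by apply/max_idPl; rewrite subr_le0 exprn_ege1// ltW.
  rewrite subr0; have [a1|a1] := leP a' 1; last first.
    have -> : Num.max 0 (1 - a' ^+ 4) = 0.
      by apply/max_idPl; rewrite subr_le0 exprn_ege1// ltW.
    by rewrite mulr_ge0// subr_ge0.
  rewrite (max_idPr _) ?subr_ge0 ?exprn_ile1//.
  have -> : 1 - a' ^+ 4 = (1 - a') * (1 + a' + a' ^+ 2 + a' ^+ 3) by ring.
  apply: (@le_trans _ _ ((1 - a') * 4)); last by rewrite mulrC ler_wpM2l// lerD2r ltW.
  rewrite ler_wpM2l ?subr_ge0//.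
  have h4 : a' ^+ 3 <= 1 by rewrite exprn_ile1.
  have h5 : a' ^+ 2 <= 1 by rewrite exprn_ile1.
  lra.
have t1 := hnorm_triangle a b.
have t2 : hnorm a <= hnorm (hmul a b) + hnorm b.
  by rewrite -{1}(hmulgK b a) -[hnorm b]hnormV hnorm_triangle.
have c0 : 0 <= 4 / d by rewrite divr_ge0// ltW.
rewrite !gE; have [ab|ab] := leP (hnorm a) (hnorm (hmul a b)).
  apply: le_trans (gle _ _ (hnorm_ge0 _) ab) _; rewrite ler_wpM2l// lerBlDr addrC.
  exact: t1.
rewrite distrC; apply: le_trans (gle _ _ (hnorm_ge0 _) (ltW ab)) _.
by rewrite ler_wpM2l// lerBlDl.
Qed.

Lemma hbump_mass d : 0 < d -> exists2 b : R,
  hvol (n := n) * (d / 2) ^+ (2 * n + 2) / 2 <= b &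
  (\int[mu]_h (hbump 0 d h)%:E = b%:E)%E.
Proof.
move=> d0; have mb := measurable_hbump (0 : H) d.
have b0 (h : H) : 0 <= hbump 0 d h by exact: hbump_ge0.
have fin : (\int[mu]_h (hbump 0 d h)%:E < +oo)%E.
  by apply: (integral_bump_fin d0 mb b0 (l := 1)) => h; rewrite mul1r.
have d20 : 0 < d / 2 by rewrite divr_gt0.
exists (fine (\int[mu]_h (hbump 0 d h)%:E)); last first.
  by rewrite fineK// ge0_fin_numE// integral_ge0// => h _; rewrite lee_fin.
rewrite -lee_fin fineK; last first.
  by rewrite ge0_fin_numE// integral_ge0// => h _; rewrite lee_fin.
have -> : (hvol (n := n) * (d / 2) ^+ (2 * n + 2) / 2)%:E =
    (\int[mu]_h (2^-1 * \1_(hball (0 : H) (d / 2)) h)%:E)%E.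
  have mI : measurable_fun setT (fun h : H => (\1_(hball (0 : H) (d / 2)) h : R)%:E).
    by apply/measurable_EFinP; apply: measurable_indic; exact: measurable_hball.
  under eq_integral do rewrite EFinM.
  rewrite (ge0_integralZl _ measurableT mI)//.
  by rewrite integral_indic_hball// -EFinM mulrC.
apply: ge0_le_integral => //.
- apply/measurable_EFinP; apply: measurable_funM => //.
  by apply: measurable_indic; exact: measurable_hball.
- by apply/measurable_EFinP.
- move=> h _; rewrite lee_fin indicE; case: (boolP (h \in _)) => hB; last by rewrite mulr0.
  move: hB; rewrite inE hball0E/= => hB.
  rewrite mulr1 /hbump (_ : hmul (hinv 0) h = h); last by rewrite -{1}[h]hmul0l hmulKg.
  rewrite le_max; apply/orP; right.
  rewrite -hnormX4 -expr_div_n.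
  have q0 : 0 <= hnorm h / d by rewrite divr_ge0 ?hnorm_ge0// ltW.
  have q1 : hnorm h / d <= 2^-1 by rewrite ler_pdivrMr// mulrC ltW.
  have : (hnorm h / d) ^+ 4 <= 2^-1 ^+ 4 by rewrite ler_pXn2r// nnegrE.
  by move: (_ ^+ 4) => q4; lra.
Qed.

End heis_extra.

(** * Continuity of translations from the energy *)

Lemma measurable_integral_hmul (R : realType) (n : nat) (G : heis R n * heis R n -> \bar R) :
  measurable_fun setT G -> (forall p, 0 <= G p)%E ->
  measurable_fun setT (fun x => \int[@hleb R n]_h G (x, hmul x h))%E.
Proof.
move=> mG G0.
have ms : measurable_fun setT (fun p : heis R n * heis R n => (p.1, hmul p.1 p.2)).
  by apply/measurable_fun_pair; mfun.
have mG' := measurableT_comp mG ms.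
exact: (measurable_fun_fubini_tonelli_F (m2 := @hleb R n) _ mG' (fun p => G0 _)).
Qed.

Lemma ge0_integral_sq3 d (T : measurableType d) (R : realType)
    (mu : {measure set T -> \bar R}) (a b c f : T -> R) :
  measurable_fun setT a -> measurable_fun setT b -> measurable_fun setT c ->
  measurable_fun setT f ->
  (forall x, f x = - a x + b x + c x) ->
  (\int[mu]_x (f x ^+ 2)%:E <= 3%:E * (\int[mu]_x (a x ^+ 2)%:E +
    \int[mu]_x (b x ^+ 2)%:E + \int[mu]_x (c x ^+ 2)%:E))%E.
Proof.
move=> ma mb mc mf fE.
have sq0 (g : T -> R) x : (0 <= (g x ^+ 2)%:E)%E by rewrite lee_fin sqr_ge0.
have msq (g : T -> R) : measurable_fun setT g -> measurable_fun setT (fun x => (g x ^+ 2)%:E).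
  by move=> mg; apply/measurable_EFinP; exact: measurable_funX.
have [ma2 mb2 mc2] := And3 (msq _ ma) (msq _ mb) (msq _ mc).
have mab := emeasurable_funD ma2 mb2.
have mabc := emeasurable_funD mab mc2.
rewrite -(ge0_integralD _ measurableT (fun x _ => sq0 a x) ma2 (fun x _ => sq0 b x) mb2).
have ab0 x : setT x -> (0 <= (a x ^+ 2)%:E + (b x ^+ 2)%:E)%E by rewrite adde_ge0.
rewrite -(ge0_integralD _ measurableT ab0 mab (fun x _ => sq0 c x) mc2).
have abc0 x : setT x -> (0 <= (a x ^+ 2)%:E + (b x ^+ 2)%:E + (c x ^+ 2)%:E)%E.
  by move=> _; rewrite adde_ge0// ab0.
rewrite -(ge0_integralZl _ measurableT mabc abc0)//.
apply: ge0_le_integral => //.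
- exact: msq.
- exact: measurable_funeM.
- move=> x _; rewrite -!EFinD -EFinM lee_fin fE.
  have := sqr_ge0 (a x + b x); have := sqr_ge0 (a x + c x); have := sqr_ge0 (b x - c x).
  move: (a x) (b x) (c x) => p q r; nra.
Qed.

Section right_mollifier.
Context {R : realType} {n : nat}.
Local Notation H := (heis R n).
Local Notation mu := (@hleb R n).
Variables (s : R) (x0 : H) (rho : R) (w : H -> R) (K : R).
Hypothesis s01 : 0 < s < 1.
Hypothesis rho0 : 0 < rho.
Hypothesis mw : measurable_fun setT w.
Hypothesis w0 : forall x, 0 <= w x.
Hypothesis wK : forall x, w x <= K.
Hypothesis wsupp : forall x, rho <= hdist x x0 -> w x = 0.
Hypothesis wE : (gagliardo2 s w < +oo)%E.

Let w_le x : `|w x| <= K. Proof. by rewrite ger0_norm. Qed.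

Let K0 : 0 <= K. Proof. exact: le_trans (w0 0) (wK 0). Qed.

Lemma integral_supp_le (v : H -> R) (k r : R) : 0 < r -> measurable_fun setT v ->
  (forall x, 0 <= v x) -> (forall x, v x <= k) ->
  (forall x, r <= hdist x x0 -> v x = 0) ->
  (\int[mu]_x (v x)%:E <= (k * (hvol (n := n) * r ^+ (2 * n + 2)))%:E)%E.
Proof.
move=> r0 mv v0 vk vs; have k0 := le_trans (v0 0) (vk 0).
have mI : measurable_fun setT (fun h : H => (\1_(hball x0 r) h : R)%:E).
  by apply/measurable_EFinP; apply: measurable_indic; exact: measurable_hball.
rewrite EFinM -(integral_indic_hball x0 r0) -(ge0_integralZl _ measurableT mI)//.
apply: ge0_le_integral => //.
- by move=> x _; rewrite lee_fin.
- by apply/measurable_EFinP.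
- exact: measurable_funeM.
- move=> x _; rewrite -EFinM lee_fin indicE.
  have [xB|xB] := ltP (hdist x x0) r; first by rewrite mem_set// mulr1.
  by rewrite vs// mulr_ge0.
Qed.

Let intw : (\int[mu]_x (w x)%:E < +oo)%E.
Proof. exact: le_lt_trans (integral_supp_le rho0 mw w0 wK wsupp) (ltry _). Qed.

Section scale.
Variables (d b : R).
Hypothesis d0 : 0 < d.
Hypothesis b0 : 0 < b.
Hypothesis bE : (\int[mu]_h (hbump 0 d h)%:E = b%:E)%E.
Local Notation theta := (hbump (0 : H) d).

Definition rmoll x : R := avg mu theta b (fun h => w (hmul x h)).

Let mtheta := measurable_hbump (0 : H) d.
Let theta0 h : 0 <= theta h. Proof. exact: hbump_ge0. Qed.

Lemma measurable_rmoll : measurable_fun setT rmoll.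
Proof.
apply: (@measurable_avg _ _ _ _ _ _ _ _ (fun p : H * H => w (hmul p.1 p.2))) => //.
by mfun.
Qed.

Let theta_eq0 h : d <= hnorm h -> theta h = 0.
Proof.
move=> dh; apply: hbump_eq0 => //; rewrite /hdist.
by rewrite (_ : hmul (hinv 0) h = h)// -{1}[h]hmul0l hmulKg.
Qed.

Let mwx x : measurable_fun setT (fun h => w (hmul x h)). Proof. by mfun. Qed.

Lemma rmoll_supp x : rho + d <= hdist x x0 -> rmoll x = 0.
Proof.
move=> xr; apply: avg_eq0 => h.
have [hd|hd] := ltP (hnorm h) d; last by rewrite theta_eq0// mul0r.
have E : w (hmul x h) = 0; last by rewrite E mulr0.
apply: wsupp; rewrite -(lerD2r d); apply: le_trans xr _.
apply: le_trans (hdist_triangle (hmul x h) x x0) _.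
by rewrite hdistC hdistMr addrC lerD2l ltW.
Qed.

(** [rmoll x - w x] averages [w (x h) - w x] over [|h| < d]. By Jensen its square is bounded by the
    average of the squares, and there the weight is at most 1, hence at most [d^(Q+2s)] times the
    kernel. As [b] is of order [d^Q], the bound is of order [d^(2s)]. *)
Lemma rmoll_dist : (\int[mu]_x ((rmoll x - w x) ^+ 2)%:E <=
  (b^-1 * d `^ (hQ R n + 2 * s))%:E * gagliardo2 s w)%E.
Proof.
have mr := measurable_rmoll.
pose F (p : H * H) := (theta p.2 * (w (hmul p.1 p.2) - w p.1) ^+ 2)%:E.
have mF : measurable_fun setT F by rewrite /F; mfun.
have F0 p : (0 <= F p)%E by rewrite lee_fin mulr_ge0 ?sqr_ge0.
have bV0 : (0 <= (b^-1)%:E)%E by rewrite lee_fin invr_ge0 ltW.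
have J x : (((rmoll x - w x) ^+ 2)%:E <= (b^-1)%:E * \int[mu]_h F (x, h))%E.
  have -> : rmoll x - w x = avg mu theta b (fun h => w (hmul x h) - w x).
    rewrite (avgB mtheta theta0 bE (K1 := K) (K2 := K))//.
    by rewrite (avg_cst mtheta theta0 bE b0).
  apply: (avg_jensen mtheta theta0 bE b0 (K := K)); first by mfun.
  move=> h; rewrite ler_norml; apply/andP; split.
    by rewrite lerBrDl (le_trans _ (w0 _))// subr_le0.
  by rewrite lerBlDr (le_trans (wK _))// lerDl.
have mI : measurable_fun setT (fun x => \int[mu]_h F (x, h))%E.
  exact: (measurable_fun_fubini_tonelli_F (m2 := mu) _ mF).
have I0 x : (0 <= \int[mu]_h F (x, h))%E by exact: integral_ge0.
apply: (@le_trans _ _ (\int[mu]_x ((b^-1)%:E * \int[mu]_h F (x, h)))%E).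
  apply: ge0_le_integral => //.
  - by move=> x _; rewrite lee_fin sqr_ge0.
  - by mfun.
  - exact: measurable_funeM.
rewrite (ge0_integralZl _ measurableT mI (fun x _ => I0 x) bV0) EFinM -muleA.
apply: lee_wpmul2l => //.
pose G (p : H * H) := (`|w p.1 - w p.2| ^+ 2 * hkernel s p.1 p.2)%:E.
have mG : measurable_fun setT G by rewrite /G; mfun.
have G0 p : (0 <= G p)%E by rewrite lee_fin mulr_ge0 ?hkernel_ge0// exprn_ge0.
have -> : gagliardo2 s w = (\int[mu]_x \int[mu]_h G (x, hmul x h))%E.
  exact: (ge0_integral_hpair mG G0).
have dp0 : (0 <= (d `^ (hQ R n + 2 * s))%:E)%E by rewrite lee_fin powR_ge0.
have mJ := measurable_integral_hmul mG G0.
have J0 x : (0 <= \int[mu]_h G (x, hmul x h))%E by exact: integral_ge0.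
rewrite -(ge0_integralZl _ measurableT mJ (fun x _ => J0 x) dp0).
apply: ge0_le_integral => //; first exact: measurable_funeM.
move=> x _.
have mGx : measurable_fun setT (fun h => G (x, hmul x h)) by rewrite /G/=; mfun.
rewrite -(ge0_integralZl _ measurableT mGx (fun h _ => G0 _) dp0).
apply: ge0_le_integral => //.
- by rewrite /F/=; mfun.
- exact: measurable_funeM.
move=> h _; rewrite /F /G/= -EFinM lee_fin hkernel_mulr.
rewrite distrC real_normK ?num_real//.
have [hd|hd] := ltP (hnorm h) d; last first.
  by rewrite theta_eq0// mul0r mulr_ge0 ?powR_ge0// mulr_ge0 ?sqr_ge0 ?hker_ge0.
have [h0|h0] := eqVneq (hnorm h) 0.
  by rewrite (hnorm_eq0 h0) hmul0r subrr expr0n/= mul0r !mulr0.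
have {}h0 : 0 < hnorm h by rewrite lt_neqAle eq_sym h0 hnorm_ge0.
rewrite [leRHS]mulrCA [leLHS]mulrC ler_wpM2l ?sqr_ge0//.
apply: le_trans (hbump_le1 _ _ d0) _.
rewrite mulrC -ler_pdivrMr ?powR_gt0// mul1r.
exact: (hker_ge s01 h0 (ltW hd)).
Qed.

Lemma rmollE x : rmoll x = b^-1 * \int[mu]_y (w y * theta (hmul (hinv x) y)).
Proof.
rewrite /rmoll /avg /Rintegral; congr (_ * fine _).
have mG : measurable_fun setT (fun h => (theta h * w (hmul x h))%:E) by mfun.
have G0 h : (0 <= (theta h * w (hmul x h))%:E)%E by rewrite lee_fin mulr_ge0.
apply: etrans (esym (ge0_integral_hmul (hinv x) mG G0)) _.
by apply: eq_integral => y _; rewrite hmulVKg mulrC.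
Qed.

Definition wmass : R := fine (\int[mu]_x (w x)%:E).

Let wmassE : (\int[mu]_x (w x)%:E = wmass%:E)%E.
Proof.
by rewrite fineK// ge0_fin_numE// integral_ge0// => x _; rewrite lee_fin.
Qed.

(** By [rmollE] the variable [x] occurs only in [theta (x^-1 y)]. Replacing [x] by [z^-1 x]
    multiplies [x^-1 y] on the right by the conjugate [y^-1 z y]; if this is small on the support of
    [w], the Lipschitz bound for [theta] concludes. *)
Lemma rmoll_translate (z : H) (k0 : R) :
  (forall y, hdist y x0 < rho -> hnorm (hmul (hmul (hinv y) z) y) <= k0) -> 0 <= k0 ->
  forall x, `|rmoll (hmul (hinv z) x) - rmoll x| <= b^-1 * (4 / d * k0 * wmass).
Proof.
move=> zk k00 x; rewrite !rmollE -mulrBr normrM (ger0_norm (ltW _)) ?invr_gt0//.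
rewrite ler_pM2l ?invr_gt0//.
have m1 (a : H) : measurable_fun setT (fun y : H => theta (hmul (hinv a) y)) by mfun.
have t1 (a : H) y : `|theta (hmul (hinv a) y)| <= 1.
  by rewrite ger0_norm ?hbump_le1.
have i1 a := integrable_phiM mw w0 wmassE (m1 a) (t1 a).
rewrite -RintegralB//.
have iD := integrableB measurableT (i1 (hmul (hinv z) x)) (i1 x).
apply: le_trans (le_normr_Rintegral measurableT iD) _.
have iw : mu.-integrable setT (EFin \o w).
  apply/integrableP; split; first exact/measurable_EFinP.
  by under eq_integral do rewrite gee0_abs ?lee_fin//.
have -> : 4 / d * k0 * wmass = \int[mu]_y (4 / d * k0 * w y).
  by rewrite (RintegralZl _ measurableT iw).
apply: le_Rintegral => //.
- exact: (integrable_abse iD).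
- exact: (integrableZl measurableT (4 / d * k0) iw).
- move=> y _; rewrite -mulrBr normrM (ger0_norm (w0 y)) mulrC.
  have [->|wy] := eqVneq (w y) 0; first by rewrite !mulr0.
  have yr : hdist y x0 < rho.
    by rewrite ltNge; apply: contra_neqN wy; exact: wsupp.
  rewrite ler_wpM2r// hinvM hinvK.
  have -> : hmul (hmul (hinv x) z) y = hmul (hmul (hinv x) y) (hmul (hmul (hinv y) z) y).
    by rewrite -!hmulA hmulVKg.
  apply: le_trans (hbump_Lipschitz _ _ d0) _.
  by rewrite ler_wpM2l ?zk// divr_ge0// ltW.
Qed.

Lemma l2_rmoll_translate (z : H) (k0 : R) :
  (forall y, hdist y x0 < rho -> hnorm (hmul (hmul (hinv y) z) y) <= k0) -> 0 <= k0 ->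
  hnorm (hmul (hmul (hinv x0) z) x0) <= 1 ->
  (\int[mu]_x ((rmoll (hmul (hinv z) x) - rmoll x) ^+ 2)%:E <=
   ((b^-1 * (4 / d * k0 * wmass)) ^+ 2 * (hvol (n := n) * (rho + d + 1) ^+ (2 * n + 2)))%:E)%E.
Proof.
move=> zk k00 z1; have mr := measurable_rmoll.
apply: integral_supp_le.
- by rewrite addr_gt0// addr_gt0.
- by mfun.
- by move=> x; exact: sqr_ge0.
- move=> x; have S0 : 0 <= b^-1 * (4 / d * k0 * wmass).
    exact: le_trans (normr_ge0 _) (rmoll_translate zk k00 x).
  by rewrite -real_normK ?num_real// ler_sqr ?nnegrE// rmoll_translate.
- move=> x xr.
  have E1 : rmoll x = 0.
    by apply: rmoll_supp; apply: le_trans xr; rewrite lerDl.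
  have E2 : rmoll (hmul (hinv z) x) = 0; last by rewrite E1 E2 subrr expr0n.
  apply: rmoll_supp; rewrite -(lerD2r 1); apply: le_trans xr _.
  rewrite /hdist -{1}(hmulVKg z x) hmulA.
  have -> : hmul (hmul (hinv x0) z) (hmul (hinv z) x) =
    hmul (hmul (hmul (hinv x0) z) x0) (hmul (hinv x0) (hmul (hinv z) x)).
    by rewrite -!hmulA !hmulVKg.
  by rewrite [leRHS]addrC; exact: le_trans (hnorm_triangle _ _) (lerD z1 (lexx _)).
Qed.
End scale.

(** Both [w] and its translate are compared with [rmoll] and its translate, at a scale [d] fixed
    first; then [z] is made small for that [d]. Three errors of square norm [e / 9] add up to [e],
    since the square of a sum of three terms costs a factor 3. The size of [z] is measured after
    conjugation by [x0], as [w] lives near [x0]. *)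
Lemma l2_translate (e : R) : 0 < e -> exists2 r : R, 0 < r & forall z : H,
  hnorm (hmul (hmul (hinv x0) z) x0) < r ->
  (\int[mu]_x ((w (hmul (hinv z) x) - w x) ^+ 2)%:E <= e%:E)%E.
Proof.
move=> e0; pose G := fine (gagliardo2 s w).
have GE : gagliardo2 s w = G%:E.
  by rewrite fineK// ge0_fin_numE// gagliardo2_ge0.
have G0 : 0 <= G by rewrite fine_ge0// gagliardo2_ge0.
have /andP[s0 s1] := s01.
pose N := (2 * n + 2)%N.
pose C := 2 ^+ N.+1 / hvol (R := R) (n := n).
have C0 : 0 < C by rewrite divr_gt0 ?exprn_gt0// hvol_gt0.
(* Chosen so that [C d^(2s) G <= e / 9]; [C] is the constant with [d^N <= C b] for the mass [b] of
   the bump. *)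
pose d := (e / (9 * (C * G + 1))) `^ (2 * s)^-1.
have CG0 : 0 < C * G + 1 by rewrite ltr_wpDl// mulr_ge0// ltW.
have d0 : 0 < d by rewrite powR_gt0// divr_gt0// mulr_gt0.
have [b bd bE] := hbump_mass (n := n) d0.
have b0 : 0 < b.
  by apply: lt_le_trans bd; rewrite divr_gt0// mulr_gt0 ?hvol_gt0// exprn_gt0// divr_gt0.
have near0 : (\int[mu]_x ((rmoll d b x - w x) ^+ 2)%:E <= (e / 9)%:E)%E.
  apply: le_trans (rmoll_dist d0 b0 bE) _; rewrite GE -EFinM lee_fin.
  apply: (@le_trans _ _ (C * d `^ (2 * s) * G)).
    rewrite ler_wpM2r// /hQ -/N powRDp// -powRX2 ?(ltW d0)// mulrA ler_wpM2r ?powR_ge0//.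
    rewrite mulrC ler_pdivrMr// mulrC.
    have -> : d ^+ N = hvol (n := n) * (d / 2) ^+ N / 2 * C.
      rewrite /C expr_div_n exprS; field.
      by rewrite expf_neq0//= gt_eqF// hvol_gt0.
    by rewrite ler_pM2r.
  rewrite /d -powRrM mulVf ?gt_eqF ?mulr_gt0// powRr1; last by rewrite divr_ge0 ?ltW// mulr_gt0.
  rewrite mulrAC mulrA ler_pdivrMr ?mulr_gt0//.
  have -> : e / 9 * (9 * (C * G + 1)) = e * (C * G + 1) by field.
  by rewrite mulrC ler_pM2l// lerDl.
pose W := wmass. have W0 : 0 <= W by rewrite fine_ge0// integral_ge0// => x _; rewrite lee_fin.
pose V := hvol (R := R) (n := n) * (rho + d + 1) ^+ N.
have V0 : 0 < V by rewrite mulr_gt0 ?hvol_gt0// exprn_gt0// addr_gt0// addr_gt0.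
pose A := b^-1 * (4 / d * W).
have A0 : 0 <= A by rewrite mulr_ge0 ?invr_ge0 ?(ltW b0)// mulr_ge0// divr_ge0// ltW.
(* The translated mollification moves by at most [A k0], on a set of measure at most [V]. The
   minimum with 1 gives [k0^2 <= k0], hence [(A k0)^2 V <= e / 9]. *)
pose k0 := Num.min 1 (e / (9 * ((A ^+ 2 + 1) * V))).
have k00 : 0 < k0.
  by rewrite lt_min ltr01 divr_gt0// mulr_gt0// mulr_gt0// ltr_wpDl// sqr_ge0.
pose D := 1 + (1 + 4 * rho) ^+ 2.
have D1 : 1 <= D by rewrite lerDl sqr_ge0.
(* With this bound on [z], the fourth power of the conjugate's norm is at most
   [(k0^2 / D)^2 D = k0^4 / D <= k0^4]. *)
exists (Num.min 1 (k0 ^+ 2 / D)).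
  by rewrite lt_min ltr01 divr_gt0 ?exprn_gt0// (lt_le_trans ltr01).
move=> z; rewrite lt_min => /andP[z1 zk].
have D0 : 0 < D by exact: lt_le_trans ltr01 D1.
have conj y : hdist y x0 < rho -> hnorm (hmul (hmul (hinv y) z) y) <= k0.
  move=> yr; pose y' := hmul (hinv x0) y.
  have -> : hmul (hmul (hinv y) z) y =
      hmul (hmul (hinv y') (hmul (hmul (hinv x0) z) x0)) y'.
    by rewrite /y' hinvM hinvK -!hmulA !hmulVKg.
  rewrite -(@ler_pXn2r _ 4)// ?nnegrE ?hnorm_ge0 ?(ltW k00)//.
  have m1 : Num.min 1 (k0 ^+ 2 / D) <= 1 by rewrite ge_min lexx.
  apply: le_trans (@hnorm_conj _ _ _ y' (Num.min 1 (k0 ^+ 2 / D)) rho m1 _ _) _.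
  - by rewrite le_min !ltW.
  - exact: ltW.
  - apply: (@le_trans _ _ ((k0 ^+ 2 / D) ^+ 2 * D)).
      rewrite ler_wpM2r ?(ltW D0)// ler_sqr ?nnegrE ?ge_min ?lexx ?orbT//.
        by rewrite le_min ler01 divr_ge0 ?sqr_ge0// ltW.
      by rewrite divr_ge0 ?sqr_ge0// ltW.
    have -> : (k0 ^+ 2 / D) ^+ 2 * D = k0 ^+ 4 / D by field; rewrite gt_eqF.
    by rewrite ler_pdivrMr// ler_peMr// exprn_ge0// ltW.
have mid := l2_rmoll_translate d0 b0 conj (ltW k00) (ltW z1).
have {}mid : (\int[mu]_x ((rmoll d b (hmul (hinv z) x) - rmoll d b x) ^+ 2)%:E <= (e / 9)%:E)%E.
  apply: le_trans mid _; rewrite lee_fin -/N -/V.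
  have -> : b^-1 * (4 / d * k0 * wmass) = A * k0 by rewrite /A /W; ring.
  have kk : k0 ^+ 2 <= e / (9 * ((A ^+ 2 + 1) * V)).
    apply: (@le_trans _ _ k0); last by rewrite ge_min lexx orbT.
    by rewrite expr2 ler_piMl ?(ltW k00)// ge_min lexx.
  rewrite exprMn mulrAC; apply: (@le_trans _ _ ((A ^+ 2 + 1) * V * k0 ^+ 2)).
    by rewrite ler_wpM2r ?sqr_ge0// ler_wpM2r ?(ltW V0)// lerDl.
  have P0 : 0 < (A ^+ 2 + 1) * V by rewrite mulr_gt0// ltr_wpDl// sqr_ge0.
  apply: (@le_trans _ _ ((A ^+ 2 + 1) * V * (e / (9 * ((A ^+ 2 + 1) * V))))).
    by rewrite ler_wpM2l// ltW.
  move: ((A ^+ 2 + 1) * V) P0 => P P0.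
  by have -> : P * (e / (9 * P)) = e / 9 by field; rewrite gt_eqF.
have mr := measurable_rmoll d b.
have far : (\int[mu]_x ((rmoll d b (hmul (hinv z) x) - w (hmul (hinv z) x)) ^+ 2)%:E <= (e / 9)%:E)%E.
  have mD : measurable_fun setT (fun x => ((rmoll d b x - w x) ^+ 2)%:E) by mfun.
  have D0' x : (0 <= ((rmoll d b x - w x) ^+ 2)%:E)%E by rewrite lee_fin sqr_ge0.
  by rewrite (ge0_integral_hmul (hinv z) mD D0').
apply: (@le_trans _ _ (3%:E * (\int[mu]_x ((rmoll d b (hmul (hinv z) x) - w (hmul (hinv z) x)) ^+ 2)%:E +
  \int[mu]_x ((rmoll d b (hmul (hinv z) x) - rmoll d b x) ^+ 2)%:E +
  \int[mu]_x ((rmoll d b x - w x) ^+ 2)%:E))%E); last first.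
  apply: (@le_trans _ _ (3%:E * ((e / 9)%:E + (e / 9)%:E + (e / 9)%:E))%E).
    by apply: lee_wpmul2l => //; rewrite leeD// leeD.
  by rewrite -!EFinD -EFinM lee_fin le_eqVlt; apply/orP; left; apply/eqP; field.
apply: ge0_integral_sq3; [by mfun|by mfun|by mfun|by mfun|].
move=> x; ring.
Qed.

End right_mollifier.

(** * Mollification by left translates *)

(** Jensen under the integral, then Tonelli. The exchange of integrals enters as a hypothesis since
    [m] is once the measure on points (for the [L^2] distance) and once the one on pairs (for the
    energy). *)
Lemma avg_sq_integral dP dZ (P : measurableType dP) (Z : measurableType dZ) (R : realType)
    (m : {measure set P -> \bar R}) (nu : {sigma_finite_measure set Z -> \bar R})
    (psi : Z -> R) (c : R) (G : P * Z -> R) (k : P -> R) (K : R) :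
  measurable_fun setT psi -> (forall z, 0 <= psi z) ->
  (\int[nu]_z (psi z)%:E = c%:E)%E -> 0 < c ->
  measurable_fun setT G -> (forall q, `|G q| <= K) ->
  measurable_fun setT k -> (forall p, 0 <= k p) ->
  (forall F : P * Z -> \bar R, measurable_fun setT F -> (forall q, 0 <= F q)%E ->
    (\int[m]_p \int[nu]_z F (p, z) = \int[nu]_z \int[m]_p F (p, z))%E) ->
  measurable_fun setT (fun p => avg nu psi c (fun z => G (p, z))) ->
  (\int[m]_p (avg nu psi c (fun z => G (p, z)) ^+ 2 * k p)%:E <=
   (c^-1)%:E * \int[nu]_z \int[m]_p (psi z * (G (p, z) ^+ 2 * k p))%:E)%E.
Proof.
move=> mpsi psi0 psic c0 mG GK mk k0 swap mavg.
pose F (q : P * Z) := (psi q.2 * (G q ^+ 2 * k q.1))%:E.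
have mF : measurable_fun setT F by rewrite /F; mfun.
have F0 q : (0 <= F q)%E by rewrite lee_fin mulr_ge0// mulr_ge0 ?sqr_ge0.
have cV0 : (0 <= (c^-1)%:E)%E by rewrite lee_fin invr_ge0 ltW.
have mI : measurable_fun setT (fun p => \int[nu]_z F (p, z))%E.
  exact: (measurable_fun_fubini_tonelli_F (m2 := nu) _ mF F0).
have I0 p : (0 <= \int[nu]_z F (p, z))%E by exact: integral_ge0.
rewrite -(swap F mF F0) -(ge0_integralZl _ measurableT mI (fun p _ => I0 p) cV0).
apply: ge0_le_integral => //.
- by move=> p _; rewrite lee_fin mulr_ge0 ?sqr_ge0.
- by mfun.
- exact: measurable_funeM.
move=> p _; rewrite EFinM.
have mGp : measurable_fun setT (fun z => G (p, z)).
  by apply: (measurableT_comp mG); exact: measurable_pair1.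
apply: (@le_trans _ _ ((c^-1)%:E * \int[nu]_z (psi z * G (p, z) ^+ 2)%:E * (k p)%:E)%E).
  apply: lee_wpmul2r; first by rewrite lee_fin.
  exact: (avg_jensen mpsi psi0 psic c0 mGp (fun z => GK _)).
rewrite -muleA lee_wpmul2l// muleC.
have mg : measurable_fun setT (fun z => (psi z * G (p, z) ^+ 2)%:E) by mfun.
rewrite -(ge0_integralZl _ measurableT mg)//; last 2 first.
- by move=> z _; rewrite lee_fin mulr_ge0 ?sqr_ge0.
- by rewrite lee_fin.
rewrite le_eqVlt; apply/orP; left; apply/eqP; apply: eq_integral => z _.
by rewrite /F/= -EFinM mulrC mulrA.
Qed.

(** * Group operations among the kernel expressions, and compactness of balls *)

Section expressible_group.
Context {R : realType} {n : nat}.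
Local Notation H := (heis R n).
Implicit Types (f g : H -> H -> H).

Definition hexpressible f := [/\ forall j, expressible (fun x y => hx (f x y) ord0 j),
  forall j, expressible (fun x y => hy (f x y) ord0 j) &
  expressible (fun x y => ht (f x y))].

Lemma eq_expressible (k1 k2 : H -> H -> R) : (forall x y, k1 x y = k2 x y) ->
  expressible k1 -> expressible k2.
Proof. by move=> E [e ke]; exists e => x y; rewrite ke. Qed.

Lemma expressible_dotv (v w : H -> H -> 'rV[R]_n) :
  (forall j, expressible (fun x y => v x y ord0 j)) ->
  (forall j, expressible (fun x y => w x y ord0 j)) ->
  expressible (fun x y => dotv (v x y) (w x y)).
Proof. by move=> ev ew; apply: expressible_sum => j; exact: expressibleM. Qed.

Lemma hexpressibleM f g : hexpressible f -> hexpressible g ->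
  hexpressible (fun x y => hmul (f x y) (g x y)).
Proof.
move=> [fx fy ft] [gx gy gt]; split.
- move=> j; apply: eq_expressible (expressibleD (fx j) (gx j)) => x y.
  by rewrite hxM [RHS]mxE.
- move=> j; apply: eq_expressible (expressibleD (fy j) (gy j)) => x y.
  by rewrite hyM [RHS]mxE.
- have e1 := expressibleM (expressibleC 2) (expressible_dotv fy gx).
  have e2 := expressibleM (expressibleC 2) (expressible_dotv fx gy).
  apply: eq_expressible (expressibleD (expressibleD (expressibleD ft gt) e1) (expressibleN e2)) => x y.
  by rewrite htM.
Qed.

Lemma hexpressibleV f : hexpressible f -> hexpressible (fun x y => hinv (f x y)).
Proof.
move=> [fx fy ft]; split.
- by move=> j; apply: eq_expressible (expressibleN (fx j)) => x y; rewrite hxV [RHS]mxE.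
- by move=> j; apply: eq_expressible (expressibleN (fy j)) => x y; rewrite hyV [RHS]mxE.
- by apply: eq_expressible (expressibleN ft) => x y; rewrite htV.
Qed.

Lemma hexpressibleC a : hexpressible (fun _ _ => a).
Proof. by split=> [j|j|]; exact: expressibleC. Qed.

Lemma hexpressibleX : hexpressible (fun x _ => x).
Proof.
split=> [j|j|]; [under eq_fun do under eq_fun do rewrite hx_coord
  |under eq_fun do under eq_fun do rewrite hy_coord|under eq_fun do under eq_fun do rewrite ht_coord];
  exact: expressibleX.
Qed.

Lemma hexpressibleY : hexpressible (fun _ y => y).
Proof.
split=> [j|j|]; [under eq_fun do under eq_fun do rewrite hx_coord
  |under eq_fun do under eq_fun do rewrite hy_coord|under eq_fun do under eq_fun do rewrite ht_coord];
  exact: expressibleY.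
Qed.

Lemma expressible_hnorm4 f : hexpressible f -> expressible (fun x y => hnorm4 (f x y)).
Proof.
move=> [fx fy ft].
have e1 := expressibleD (expressible_dotv fx fx) (expressible_dotv fy fy).
have e2 := expressibleD (expressibleM e1 e1) (expressibleM ft ft).
by apply: eq_expressible e2 => x y; rewrite -!expr2.
Qed.

Lemma continuous_keval (e : @kexpr R (n + n + 1)) y : continuous (fun x => keval e x y).
Proof.
elim: e => [k|k|c|e1 IH1 e2 IH2|e1 IH1 e2 IH2|j e1 IH1] /= x.
- exact: coord_continuous.
- exact: cst_continuous.
- exact: cst_continuous.
- have FF : ProperFilter (nbhs x) by exact: mx_nbhs_filter.
  by apply: cvgD; [exact: IH1|exact: IH2].
- have FF : ProperFilter (nbhs x) by exact: mx_nbhs_filter.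
  by apply: cvgM; [exact: IH1|exact: IH2].
- have ce : continuous (efam (R := R) j).
    move=> t; apply: differentiable_continuous.
    by apply/derivable1_diffP; apply: (@ex_derive _ _ _ _ _ _ _ (is_derive_efam j _)).
  by apply: (cvg_comp _ _ (IH1 x)); exact: ce.
Qed.

Lemma continuous_hnorm4 (a : H) : continuous (fun x => hnorm4 (hmul (hinv a) x)).
Proof.
have [e E] := expressible_hnorm4 (hexpressibleM (hexpressibleV (hexpressibleC a)) hexpressibleX).
rewrite (_ : (fun x => _) = fun x => keval e x 0); last by apply/funext => x; rewrite E.
exact: continuous_keval.
Qed.

(** A bound on the norm bounds the coordinates of [a^-1 x]; those of [x = a (a^-1 x)] are
    expressions in them, and expressions are bounded on boxes. *)
Lemma hdist_le_coord (a : H) (r : R) : 0 <= r -> exists M : R,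
  forall x, hdist x a <= r -> forall i, `|x ord0 i| <= M.
Proof.
move=> r0; have [ex ey et] := hexpressibleM (hexpressibleC a) hexpressibleX.
have eall i : expressible (fun x _ : H => hmul a x ord0 i).
  move: i; apply: heis_ordP => [j|j|].
  - by apply: eq_expressible (ex j) => x y; rewrite hx_coord.
  - by apply: eq_expressible (ey j) => x y; rewrite hy_coord.
  - by apply: eq_expressible et => x y; rewrite ht_coord.
pose m := r + r ^+ 2.
have m0 : 0 <= m by rewrite addr_ge0 ?sqr_ge0.
have hm h : hnorm (h : H) <= r -> forall i, `|h ord0 i| <= m.
  move=> hr; have hz : hz2 h <= r ^+ 2.
    by rewrite (le_trans (hz2_le h))// ler_sqr ?nnegrE ?hnorm_ge0.
  have dz (v : 'rV[R]_n) j : dotv v v <= r ^+ 2 -> `|v ord0 j| <= m.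
    move=> vr; apply: (@le_trans _ _ r); last by rewrite lerDl sqr_ge0.
    rewrite -(@ler_sqr R) ?nnegrE// real_normK ?num_real//; apply: le_trans vr.
    rewrite /dotv (bigD1 j)//= -expr2 lerDl sumr_ge0// => k _.
    by rewrite -expr2 sqr_ge0.
  apply: heis_ordP => [j|j|].
  - by rewrite -hx_coord; apply: dz; apply: le_trans hz; rewrite lerDl dotv_ge0.
  - by rewrite -hy_coord; apply: dz; apply: le_trans hz; rewrite lerDr dotv_ge0.
  - rewrite -ht_coord (le_trans (ht_le h))//.
    rewrite (@le_trans _ _ (r ^+ 2))// ?ler_sqr ?nnegrE ?hnorm_ge0//.
    by rewrite lerDr.
have bnd i : exists B : R, forall h, hnorm (h : H) <= r -> `|hmul a h ord0 i| <= B.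
  have [e E] := eall i; have [B _ HB] := keval_bound e m0.
  by exists B => h hr; rewrite -(E h h); apply: HB; exact: hm.
have [B HB] := choice bnd.
exists (\sum_i `|B i|) => x xr i.
have E : x = hmul a (hmul (hinv a) x) by rewrite hmulVKg.
rewrite E; apply: le_trans (HB i _ xr) _.
by rewrite (le_trans (ler_norm _))// (bigD1 i)//= lerDl sumr_ge0.
Qed.

(** The closed balls of [hdist] are closed for the topology of ['rV[R]_m] because [hnorm4] is a
    polynomial, and they are bounded by [hdist_le_coord]. *)
Lemma compact_closure_hball (a : H) (r : R) (A : set H) : 0 <= r ->
  (forall x, A x -> hdist x a <= r) ->
  compact (closure A) /\ (forall x, closure A x -> hdist x a <= r).
Proof.
move=> r0 Ar.
have rE x : (hdist x a <= r) = (hnorm4 (hmul (hinv a) x) <= r ^+ 4).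
  by rewrite -hnormX4 ler_pXn2r// nnegrE ?hnorm_ge0.
have cl : closed [set x | hdist x a <= r].
  rewrite (_ : [set x | _] = (fun x => hnorm4 (hmul (hinv a) x)) @^-1` [set t | t <= r ^+ 4]); last first.
    by apply/seteqP; split => x /=; rewrite rE.
  apply: closed_comp; last exact: closed_le.
  by move=> x _; exact: continuous_hnorm4.
have sub : closure A `<=` [set x | hdist x a <= r].
  by move=> x Ax; apply: cl; apply: closure_subset Ax => y Ay; exact: Ar.
split; last exact: sub.
have [M HM] := hdist_le_coord a r0.
apply: bounded_closed_compact; last exact: closed_closure.
exists M; split; first exact: num_real.
move=> B MB x /sub xr /=.
rewrite [leLHS]mx_normrE; apply/bigmax_leP; split=> [|[i j] _ /=].
  apply: le_trans (ltW MB).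
  exact: le_trans (normr_ge0 _) (HM x xr (rshift (n + n) ord0)).
by rewrite ord1 (le_trans (HM x xr j)) ?ltW.
Qed.
End expressible_group.

Section mollifier.
Context {R : realType} {n : nat}.
Local Notation H := (heis R n).
Local Notation mu := (@hleb R n).
Variables (s : R) (x0 : H) (rho : R) (w : H -> R) (K : R).
Hypothesis s01 : 0 < s < 1.
Hypothesis rho0 : 0 < rho.
Hypothesis mw : measurable_fun setT w.
Hypothesis w0 : forall x, 0 <= w x.
Hypothesis wK : forall x, w x <= K.
Hypothesis wsupp : forall x, rho <= hdist x x0 -> w x = 0.
Hypothesis wE : (gagliardo2 s w < +oo)%E.

Let K0 : 0 <= K. Proof. exact: le_trans (w0 0) (wK 0). Qed.
Let w_le x : `|w x| <= K. Proof. by rewrite ger0_norm. Qed.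

Section scale.
Variable d : R.
Hypothesis d0 : 0 < d.

Definition hmollb (y : H) : R := efam 0 (d ^+ 4 - hnorm4 (hmul (hinv x0) y)).

Lemma hmollb_ge0 y : 0 <= hmollb y. Proof. exact: efam_ge0. Qed.

Lemma hmollb_le1 y : hmollb y <= 1.
Proof. exact: le_trans (efam_le _ _) _. Qed.

Lemma hmollb_eq0 y : d <= hdist y x0 -> hmollb y = 0.
Proof.
move=> dy; rewrite /hmollb /efam ltNge ifF//; apply/negbF.
by rewrite subr_le0 -hnormX4 ler_pXn2r// nnegrE ?hnorm_ge0// ltW.
Qed.

Lemma measurable_hmollb : measurable_fun setT hmollb.
Proof.
apply: (measurableT_comp (measurable_efam 0)).
apply: measurable_funB; first exact: measurable_cst.
rewrite (_ : (fun x => _) = fun x => hnorm (hmul (hinv x0) x) ^+ 4); last first.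
  by apply/funext => x; rewrite hnormX4.
by mfun.
Qed.

Lemma hmollb_mass : exists2 c : R, 0 < c & (\int[mu]_y (hmollb y)%:E = c%:E)%E.
Proof.
have fin := integral_supp_le d0 measurable_hmollb hmollb_ge0 hmollb_le1 hmollb_eq0.
have c0 : (0 <= \int[mu]_y (hmollb y)%:E)%E.
  by apply: integral_ge0 => y _; rewrite lee_fin hmollb_ge0.
exists (fine (\int[mu]_y (hmollb y)%:E)); last first.
  by rewrite fineK// ge0_fin_numE// (le_lt_trans fin)// ltry.
have d20 : 0 < d / 2 by rewrite divr_gt0.
(* A lower bound for the bump on the ball of radius [d / 2], where
   [d^4 - |x0^-1 y|^4 >= d^4 / 2]. *)
pose b : R := expR (- (d ^+ 4 / 2)^-1).
have b0 : 0 < b by rewrite expR_gt0.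
apply: (@lt_le_trans _ _ (b * (hvol (n := n) * (d / 2) ^+ (2 * n + 2)))).
  by rewrite mulr_gt0// mulr_gt0 ?hvol_gt0// exprn_gt0.
rewrite -lee_fin fineK; last by rewrite ge0_fin_numE// (le_lt_trans fin)// ltry.
have mI : measurable_fun setT (fun h : H => (\1_(hball x0 (d / 2)) h : R)%:E).
  by apply/measurable_EFinP; apply: measurable_indic; exact: measurable_hball.
rewrite EFinM -(integral_indic_hball x0 d20) -(ge0_integralZl _ measurableT mI)//; last first.
  by rewrite lee_fin ltW.
apply: ge0_le_integral => //.
- by move=> y _; rewrite -EFinM lee_fin mulr_ge0// ltW.
- exact: measurable_funeM.
- by apply/measurable_EFinP; exact: measurable_hmollb.
- move=> y _; rewrite -EFinM lee_fin indicE; case: (boolP (y \in _)) => yB; last first.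
    by rewrite mulr0 hmollb_ge0.
  move: yB; rewrite inE /hball/= mulr1 => yB.
  have d4 : 0 < d ^+ 4 by rewrite exprn_gt0.
  have y4 : hnorm4 (hmul (hinv x0) y) <= d ^+ 4 / 2.
    rewrite -hnormX4 (@le_trans _ _ ((d / 2) ^+ 4))//.
      by rewrite ler_pXn2r ?nnegrE ?hnorm_ge0// ltW.
    by rewrite expr_div_n ler_pM2l// lef_pV2 ?posrE ?exprn_gt0// -[leLHS]expr1 ler_eXn2l// ltr1n.
  have h1 : d ^+ 4 / 2 <= d ^+ 4 - hnorm4 (hmul (hinv x0) y) by move: (_ ^+ 4) (hnorm4 _) d4 y4 => a q; lra.
  have h2 : 0 < d ^+ 4 / 2 by rewrite divr_gt0.
  rewrite /hmollb /efam (lt_le_trans h2 h1) expr0 mul1r ler_expR lerN2.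
  by rewrite lef_pV2 ?posrE// (lt_le_trans h2 h1).
Qed.

Variable c : R.
Hypothesis c0 : 0 < c.
Hypothesis cE : (\int[mu]_y (hmollb y)%:E = c%:E)%E.

(** A weight on translations rather than on points: it charges those [z] that move [x0] by less than
    [d]. By left invariance of [hdist], such translations keep the ball of radius [rho] about [x0]
    inside the ball of radius [rho + d]. *)
Definition hmoll (z : H) : R := hmollb (hmul z x0).

Let psi0 z : 0 <= hmoll z. Proof. exact: hmollb_ge0. Qed.
Let mpsi : measurable_fun setT hmoll.
Proof. by apply: (measurableT_comp measurable_hmollb); mfun. Qed.
Let psic : (\int[mu]_z (hmoll z)%:E = c%:E)%E.
Proof.
have mb : measurable_fun setT (fun y => (hmollb y)%:E).
  by apply/measurable_EFinP; exact: measurable_hmollb.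
have b0 y : (0 <= (hmollb y)%:E)%E by rewrite lee_fin hmollb_ge0.
by apply: etrans (ge0_integral_hmulr x0 mb b0) cE.
Qed.

Lemma hmoll_eq0 z : d <= hnorm (hmul (hmul (hinv x0) z) x0) -> hmoll z = 0.
Proof. by move=> dz; apply: hmollb_eq0; rewrite /hdist hmulA. Qed.

(* Averaging over left translates, so that the energy is not increased. *)
Definition lmoll (x : H) : R := avg mu hmoll c (fun z => w (hmul (hinv z) x)).

Lemma measurable_lmoll : measurable_fun setT lmoll.
Proof.
apply: (@measurable_avg _ _ _ _ _ _ _ _ (fun p : H * H => w (hmul (hinv p.2) p.1))) => //.
by mfun.
Qed.

Lemma lmoll_ge0 x : 0 <= lmoll x. Proof. exact: avg_ge0. Qed.

Let mwx x : measurable_fun setT (fun z => w (hmul (hinv z) x)). Proof. by mfun. Qed.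

Lemma lmoll_le x : lmoll x <= K.
Proof. by apply: (avg_le mpsi psi0 psic c0). Qed.

Lemma lmoll_supp x : rho + d <= hdist x x0 -> lmoll x = 0.
Proof.
move=> xr; apply: avg_eq0 => z.
have [zd|zd] := ltP (hnorm (hmul (hmul (hinv x0) z) x0)) d; last first.
  by rewrite hmoll_eq0// mul0r.
have E : w (hmul (hinv z) x) = 0; last by rewrite E mulr0.
apply: wsupp; rewrite -(lerD2r d); apply: le_trans xr _.
apply: le_trans (hdist_triangle (hmul z x0) x x0) _; apply: lerD.
  by rewrite -(hdistM (hinv z)) hmulKg.
by rewrite {1}/hdist hmulA ltW.
Qed.

(** [hdist] and the measure are left invariant, so every left translate of [w] has the energy of
    [w]; Jensen carries the bound to their average. *)
Lemma gagliardo2_lmoll : (gagliardo2 s lmoll <= gagliardo2 s w)%E.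
Proof.
pose G (q : (H * H) * H) := w (hmul (hinv q.2) q.1.1) - w (hmul (hinv q.2) q.1.2).
have mG : measurable_fun setT G.
  by apply: measurable_funB; apply: (measurableT_comp mw); mfun.
have GK q : `|G q| <= K.
  rewrite /G ler_norml; apply/andP; split.
    by rewrite lerBrDl (le_trans _ (w0 _))// subr_le0.
  by rewrite lerBlDr (le_trans (wK _))// lerDl.
have avgE p : lmoll p.1 - lmoll p.2 = avg mu hmoll c (fun z => G (p, z)).
  exact: (esym (avgB mpsi psi0 psic (mwx p.1) (fun=> w_le _) (mwx p.2) (fun=> w_le _))).
have mavg : measurable_fun setT (fun p => avg mu hmoll c (fun z => G (p, z))).
  rewrite (_ : (fun p => _) = fun p => lmoll p.1 - lmoll p.2); last first.
    by apply/funext => p; rewrite avgE.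
  have ml := measurable_lmoll; by mfun.
have mk : measurable_fun setT (fun p : H * H => hkernel s p.1 p.2) by mfun.
have k0 (p : H * H) : 0 <= hkernel s p.1 p.2 by exact: hkernel_ge0.
have := @avg_sq_integral _ _ _ _ _ (mu \x mu)%E mu hmoll c G _ K mpsi psi0 psic c0 mG GK mk k0
  (fun F mF F0 => fubini_tonelli_prod mu mu mu mF F0) mavg.
have -> : (\int[mu \x mu]_p (avg mu hmoll c (fun z => G (p, z)) ^+ 2 * hkernel s p.1 p.2)%:E =
    gagliardo2 s lmoll)%E.
  by apply: eq_integral => p _; rewrite -avgE real_normK ?num_real.
move=> /le_trans; apply.
pose F (p : H * H) := (`|w p.1 - w p.2| ^+ 2 * hkernel s p.1 p.2)%:E.
have mF : measurable_fun setT F by rewrite /F; mfun.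
have F0 p : (0 <= F p)%E by rewrite lee_fin mulr_ge0 ?hkernel_ge0// exprn_ge0.
have FG (p : H * H) z : F (hmul (hinv z) p.1, hmul (hinv z) p.2) = (G (p, z) ^+ 2 * hkernel s p.1 p.2)%:E.
  have KE : hkernel s (hmul (hinv z) p.1) (hmul (hinv z) p.2) = hkernel s p.1 p.2.
    by rewrite /hkernel hdistM.
  rewrite /F /G [(_, _).1]/= [(_, _).2]/= KE; congr (_ * _)%:E.
  exact: real_normK (num_real _).
have inner z : (\int[mu \x mu]_p (hmoll z * (G (p, z) ^+ 2 * hkernel s p.1 p.2))%:E =
    gagliardo2 s w * (hmoll z)%:E)%E.
  have mFz : measurable_fun setT (fun p : H * H => F (hmul (hinv z) p.1, hmul (hinv z) p.2)).
    by rewrite /F/=; mfun.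
  rewrite muleC -[gagliardo2 s w](ge0_integral_hpair_hmul (hinv z) mF F0).
  have z0 : (0 <= (hmoll z)%:E)%E by rewrite lee_fin.
  rewrite -(ge0_integralZl _ measurableT mFz (fun p _ => F0 _) z0).
  by apply: eq_integral => p _; rewrite FG EFinM.
under eq_integral do rewrite inner.
have c1 : ((c^-1)%:E * c%:E = 1)%E by rewrite -EFinM mulVf// gt_eqF.
have mpsiE : measurable_fun setT (fun z => (hmoll z)%:E) by exact/measurable_EFinP.
have psiE0 z : setT z -> (0 <= (hmoll z)%:E)%E by rewrite lee_fin.
rewrite (ge0_integralZl _ measurableT mpsiE psiE0 (gagliardo2_ge0 s w)).
rewrite psic muleCA c1 mule1.
exact: lexx.
Qed.

Lemma lmoll_dist (e : R) : (forall z : H,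
    hnorm (hmul (hmul (hinv x0) z) x0) < d ->
    (\int[mu]_x ((w (hmul (hinv z) x) - w x) ^+ 2)%:E <= e%:E)%E) ->
  (\int[mu]_x ((lmoll x - w x) ^+ 2)%:E <= e%:E)%E.
Proof.
move=> He.
pose G (q : H * H) := w (hmul (hinv q.2) q.1) - w q.1.
have mG : measurable_fun setT G by rewrite /G; mfun.
have GK q : `|G q| <= K.
  rewrite /G ler_norml; apply/andP; split.
    by rewrite lerBrDl (le_trans _ (w0 _))// subr_le0.
  by rewrite lerBlDr (le_trans (wK _))// lerDl.
have avgE x : lmoll x - w x = avg mu hmoll c (fun z => G (x, z)).
  apply: etrans (esym (avgB mpsi psi0 psic (mwx x) (fun=> w_le _) (measurable_cst (w x)) (fun=> w_le x))).
  by congr (_ - _); rewrite (avg_cst mpsi psi0 psic c0).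
have mavg : measurable_fun setT (fun x => avg mu hmoll c (fun z => G (x, z))).
  rewrite (_ : (fun p => _) = fun p => lmoll p - w p); last first.
    by apply/funext => p; rewrite avgE.
  have ml := measurable_lmoll; by mfun.
have := @avg_sq_integral _ _ _ _ _ mu mu hmoll c G (cst 1) K mpsi psi0 psic c0 mG GK
  (measurable_cst _) (fun=> ler01) (fun F mF F0 => fubini_tonelli _ mF F0) mavg.
have -> : (\int[mu]_x (avg mu hmoll c (fun z => G (x, z)) ^+ 2 * cst 1 x)%:E =
    \int[mu]_x ((lmoll x - w x) ^+ 2)%:E)%E.
  by apply: eq_integral => x _; rewrite /= mulr1 avgE.
move=> /le_trans; apply.
have mF : measurable_fun setT (fun q : H * H => (hmoll q.2 * (G q ^+ 2 * cst 1 q.1))%:E).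
  by rewrite /cst; mfun.
have F0 (q : H * H) : (0 <= (hmoll q.2 * (G q ^+ 2 * cst 1 q.1))%:E)%E.
  by rewrite lee_fin mulr_ge0// mulr1 sqr_ge0.
have c1 : ((c^-1)%:E * c%:E = 1)%E by rewrite -EFinM mulVf// gt_eqF.
have mpsiE : measurable_fun setT (fun z => (hmoll z)%:E) by exact/measurable_EFinP.
have psiE0 z : setT z -> (0 <= (hmoll z)%:E)%E by rewrite lee_fin.
have e0 : (0 <= e%:E)%E.
  apply: le_trans (He 0 _); last by rewrite hmul0r hmulVg hnorm0.
  by apply: integral_ge0 => x _; rewrite lee_fin sqr_ge0.
have -> : e%:E = ((c^-1)%:E * \int[mu]_z (e%:E * (hmoll z)%:E))%E.
  rewrite (ge0_integralZl _ measurableT mpsiE psiE0 e0).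
  by rewrite psic muleCA c1 mule1.
apply: lee_wpmul2l; first by rewrite lee_fin invr_ge0 ltW.
apply: ge0_le_integral => //.
- by move=> z _; apply: integral_ge0 => x _; exact: F0 (x, z).
- exact: (measurable_fun_fubini_tonelli_G (m1 := mu) _ mF F0).
- exact: measurable_funeM.
move=> z _.
have [zd|zd] := ltP (hnorm (hmul (hmul (hinv x0) z) x0)) d; last first.
  rewrite hmoll_eq0// mule0 integral0_eq// => x _.
  by rewrite mul0r.
rewrite muleC; apply: (@le_trans _ _ ((hmoll z)%:E * \int[mu]_x ((w (hmul (hinv z) x) - w x) ^+ 2)%:E)%E); last first.
  by apply: lee_wpmul2l; [rewrite lee_fin|exact: He].
have mq : measurable_fun setT (fun x => ((w (hmul (hinv z) x) - w x) ^+ 2)%:E) by mfun.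
rewrite -(ge0_integralZl _ measurableT mq)//; last 2 first.
- by move=> x _; rewrite lee_fin sqr_ge0.
- by rewrite lee_fin.
rewrite le_eqVlt; apply/orP; left; apply/eqP; apply: eq_integral => x _.
by rewrite /G /= mulr1 EFinM.
Qed.

(** The substitution [y = z^-1 x] moves [x] from [w], which is not smooth, into the weight
    [hmoll (x y^-1)], which is a kernel expression. *)
Lemma Ck_lmoll k : Ck k lmoll.
Proof.
have [M HM] := hdist_le_coord x0 (ltW rho0).
have iw : mu.-integrable setT (EFin \o w).
  apply/integrableP; split; first exact/measurable_EFinP.
  under eq_integral do rewrite gee0_abs ?lee_fin//.
  exact: le_lt_trans (integral_supp_le rho0 mw w0 wK wsupp) (ltry _).
have [e E] : expressible (fun x y : H => c^-1 * hmoll (hmul x (hinv y))).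
  apply: expressibleM; first exact: expressibleC.
  apply: expressible_efam; apply: expressibleD; first exact: expressibleC.
  apply: expressibleN; apply: expressible_hnorm4.
  apply: hexpressibleM; first exact: hexpressibleC.
  apply: hexpressibleM; last exact: hexpressibleC.
  apply: hexpressibleM; first exact: hexpressibleX.
  by apply: hexpressibleV; exact: hexpressibleY.
rewrite (_ : lmoll = kint mu w e); last first.
  apply/funext => x; rewrite /lmoll /avg /kint.
  have mF : measurable_fun setT (fun y => (hmoll (hmul x (hinv y)) * w y)%:E) by mfun.
  have F0 y : (0 <= (hmoll (hmul x (hinv y)) * w y)%:E)%E by rewrite lee_fin mulr_ge0.
  have -> : \int[mu]_z (hmoll z * w (hmul (hinv z) x)) =
      \int[mu]_y (hmoll (hmul x (hinv y)) * w y).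
    rewrite /Rintegral; congr fine.
    apply: etrans (ge0_integral_hmulV x mF F0); apply: eq_integral => z _.
    by rewrite hinvM hinvK hmulA hmulgV hmul0l.
  rewrite -RintegralZl//; last first.
    apply/integrableP; split; first exact: mF.
    under eq_integral do rewrite /= ger0_norm ?mulr_ge0//.
    apply: (@le_lt_trans _ _ (\int[mu]_y (w y)%:E)%E); last first.
      exact: le_lt_trans (integral_supp_le rho0 mw w0 wK wsupp) (ltry _).
    apply: ge0_le_integral => //.
    + by apply/measurable_EFinP.
    + by move=> y _; rewrite lee_fin ler_piMl// hmollb_le1.
  by apply: eq_Rintegral => y _; rewrite E mulrA.
apply: (Ck_kint (M := M)) => // y wy; apply: HM.
by rewrite leNgt; apply: contra_neqN wy => yr; apply: wsupp; rewrite ltW.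
Qed.

Lemma Cc_infty_lmoll (Omega : set H) r : rho + d < r -> hball x0 r `<=` Omega ->
  Cc_infty Omega lmoll.
Proof.
move=> rr rO; have rd0 : 0 <= rho + d by rewrite addr_ge0// ltW.
have supp x : [set x | lmoll x != 0] x -> hdist x x0 <= rho + d.
  by rewrite /= leNgt => lx; apply: contra_neqN lx => xr; apply: lmoll_supp; rewrite ltW.
have [cpt sub] := compact_closure_hball rd0 supp.
split=> //; first by move=> k; exact: Ck_lmoll.
by move=> x /sub xr; apply: rO; exact: le_lt_trans xr rr.
Qed.

End scale.
End mollifier.

(** * Testing with functions that are not smooth *)

Lemma ge0_integralZ_le d (T : measurableType d) (R : realType)
    (m : {measure set T -> \bar R}) (a A : R) (g : T -> R) : 0 <= a ->
  measurable_fun setT g -> (forall x, 0 <= g x) -> (\int[m]_x (g x)%:E <= A%:E)%E ->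
  (\int[m]_x (a * g x)%:E <= (a * A)%:E)%E.
Proof.
move=> a0 mg g0 gA; under eq_integral do rewrite EFinM.
rewrite ge0_integralZl//; last by move=> x _; rewrite lee_fin.
  by rewrite EFinM lee_wpmul2l.
exact/measurable_EFinP.
Qed.

Lemma ge0_integral_axpy_le d (T : measurableType d) (R : realType)
    (m : {measure set T -> \bar R}) (a A B : R) (g h : T -> R) : 0 <= a ->
  measurable_fun setT g -> measurable_fun setT h ->
  (forall x, 0 <= g x) -> (forall x, 0 <= h x) ->
  (\int[m]_x (g x)%:E <= A%:E)%E -> (\int[m]_x (h x)%:E <= B%:E)%E ->
  (\int[m]_x (a * g x + h x)%:E <= (a * A + B)%:E)%E.
Proof.
move=> a0 mg mh g0 h0 gA hB.
have mgE : measurable_fun setT (fun x => (g x)%:E) by exact/measurable_EFinP.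
have mhE : measurable_fun setT (fun x => (h x)%:E) by exact/measurable_EFinP.
under eq_integral do rewrite EFinD EFinM.
rewrite ge0_integralD//; last 2 first.
- exact: measurable_funeM.
- by move=> x _; rewrite lee_fin.
- rewrite ge0_integralZl//; last by move=> x _; rewrite lee_fin.
  by rewrite EFinD EFinM leeD// lee_wpmul2l.
- by move=> x _; rewrite -EFinM lee_fin mulr_ge0.
Qed.

Lemma ge0_le_integral_EFin d (T : measurableType d) (R : realType)
    (m : {measure set T -> \bar R}) (f g : T -> R) :
  measurable_fun setT f -> measurable_fun setT g ->
  (forall x, 0 <= f x) -> (forall x, f x <= g x) ->
  (\int[m]_x (f x)%:E <= \int[m]_x (g x)%:E)%E.
Proof.
move=> mf mg f0 fg; apply: ge0_le_integral => //.
- by move=> x _; rewrite lee_fin.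
- exact/measurable_EFinP.
- exact/measurable_EFinP.
- by move=> x _; rewrite lee_fin.
Qed.

Section square_norm.
Context d {T : measurableType d} {R : realType}.
Variable m : {measure set T -> \bar R}.
Implicit Types u v : T -> R.

Lemma Lnorm2E u : ('N[m]_2%:E[EFin \o u] = (\int[m]_x (u x ^+ 2)%:E) `^ 2^-1)%E.
Proof.
rewrite unlock; congr (_ `^ _)%E; apply: eq_integral => x _ /=.
by rewrite powR_mulrn// real_normK ?num_real.
Qed.

Lemma Lnorm2_lty u : ('N[m]_2%:E[EFin \o u] < +oo)%E =
  (\int[m]_x (u x ^+ 2)%:E < +oo)%E.
Proof.
have I0 : (0 <= \int[m]_x (u x ^+ 2)%:E)%E.
  by apply: integral_ge0 => x _; rewrite lee_fin sqr_ge0.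
by rewrite Lnorm2E; apply/idP/idP; [exact: lty_poweRy|exact: poweR_lty].
Qed.
End square_norm.

Section weak_continuity.
Context {R : realType} {n : nat}.
Local Notation H := (heis R n).
Local Notation mu := (@hleb R n).
Variable s : R.
Hypothesis s01 : 0 < s < 1.

(** The energy over [hfar j] converges to the whole, finite, energy of [u]; the remainder is
    therefore small for some [j]. *)
Lemma near_energy_small (u : H -> R) (e : R) : measurable_fun setT u ->
  (gagliardo2 s u < +oo)%E -> 0 < e -> exists j,
  (\int[mu \x mu]_p ((u p.1 - u p.2) ^+ 2 * hkernel s p.1 p.2 * \1_(~` hfar j) p)%:E <= e%:E)%E.
Proof.
move=> mu_ Eu e0.
pose F (p : H * H) := (u p.1 - u p.2) * (u p.1 - u p.2) * hkernel s p.1 p.2.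
have iF : (mu \x mu)%E.-integrable setT (EFin \o F) by exact: integrable_energy.
have FE p : F p = (u p.1 - u p.2) ^+ 2 * hkernel s p.1 p.2 by rewrite /F expr2.
have mF : measurable_fun setT F by rewrite /F; mfun.
have F0 p : 0 <= F p by rewrite FE mulr_ge0 ?sqr_ge0 ?hkernel_ge0.
have FA p : F p != 0 -> exists N, forall j, (N <= j)%N -> hfar j p.
  exact: (hkernel_hfar s01 (F := fun p : H * H => (u p.1 - u p.2) * (u p.1 - u p.2))).
suff [j Hj] : exists j, (\int[mu \x mu]_p (F p * \1_(~` hfar j) p)%:E <= e%:E)%E.
  by exists j; under eq_integral do rewrite -FE.
clearbody F => {FE}.
have cv := cvg_integral_indic measurable_hfar FA iF.
have Ifin : (\int[mu \x mu]_p (F p)%:E)%E \is a fin_num by exact: integrable_fin_num.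
have := cv; rewrite -{1}(fineK Ifin) => /fine_cvgP [finj].
move=> /cvgrPdist_le /(_ _ e0) => cvj.
have [j [finj' distj]] : exists j, (\int[mu \x mu]_p (F p * \1_(hfar j) p)%:E)%E \is a fin_num /\
    `|fine (\int[mu \x mu]_p (F p)%:E) - fine (\int[mu \x mu]_p (F p * \1_(hfar j) p)%:E)| <= e.
  near \oo => j; exists j; split; near: j; [exact: finj|exact: cvj].
exists j.
have mj : measurable (hfar (R := R) (n := n) j) by exact: measurable_hfar.
have m1 : measurable_fun setT (fun p => F p * \1_(hfar j) p).
  by apply: measurable_funM => //; exact: measurable_indic.
have m2 : measurable_fun setT (fun p => F p * \1_(~` hfar j) p).
  by apply: measurable_funM => //; apply: measurable_indic; exact: measurableC.
have split_ : (\int[mu \x mu]_p (F p)%:E = \int[mu \x mu]_p (F p * \1_(hfar j) p)%:E +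
    \int[mu \x mu]_p (F p * \1_(~` hfar j) p)%:E)%E.
  rewrite -ge0_integralD//.
  - apply: eq_integral => p _; rewrite -EFinD -mulrDr !indicE in_setC.
    by case: (p \in hfar j); rewrite /= ?addr0 ?add0r mulr1.
  - by move=> p _; rewrite lee_fin mulr_ge0// indicE.
  - exact/measurable_EFinP.
  - by move=> p _; rewrite lee_fin mulr_ge0// indicE.
  - exact/measurable_EFinP.
have fin2 : (\int[mu \x mu]_p (F p * \1_(~` hfar j) p)%:E)%E \is a fin_num.
  by move: Ifin; rewrite split_ fin_numD => /andP[].
rewrite -(fineK fin2) lee_fin; move: distj; rewrite split_ fineD//.
by rewrite addrAC subrr add0r; exact: le_trans (ler_norm _).
Unshelve. all: by end_near.
Qed.

(** Away from the diagonal the kernel has finite mass, so the [L^2] norm controls the energy: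
    [(v - v')^2 <= 2 v^2 + 2 v'^2], and each square contributes twice [hTail] times [D]. *)
Lemma far_energy_le (v : H -> R) (j : nat) (D : R) : measurable_fun setT v ->
  (\int[mu]_x (v x ^+ 2)%:E <= D%:E)%E ->
  (\int[mu \x mu]_p ((v p.1 - v p.2) ^+ 2 * hkernel s p.1 p.2 * \1_(hfar j) p)%:E <=
   (4 * (hTail (n := n) s j.+1%:R^-1 * D))%:E)%E.
Proof.
move=> mv vD; set ep := j.+1%:R^-1.
have ep0 : 0 < ep by rewrite invr_gt0 ltr0n.
pose K (p : H * H) := hkerT s ep (hmul (hinv p.2) p.1).
have mkT := measurable_hkerT (n := n) s ep.
have mK : measurable_fun setT K by apply: (measurableT_comp mkT); mfun.
have K0 p : 0 <= K p by exact: hkerT_ge0.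
have KC x y : K (x, y) = K (y, x) by rewrite /K/= -hkerTV hinvM hinvK.
have KM (p : H * H) : K (p.1, hmul p.1 p.2) = hkerT s ep p.2 by rewrite KC /K/= hmulKg.
have KE p : hkernel s p.1 p.2 * \1_(hfar j) p = K p by [].
clearbody K.
have m1 : measurable_fun setT (fun p : H * H => v p.1 ^+ 2 * K p) by mfun.
have m2 : measurable_fun setT (fun p : H * H => v p.2 ^+ 2 * K p) by mfun.
have p1 (p : H * H) : 0 <= v p.1 ^+ 2 * K p by rewrite mulr_ge0 ?sqr_ge0.
have p2 (p : H * H) : 0 <= v p.2 ^+ 2 * K p by rewrite mulr_ge0 ?sqr_ge0.
have T0 := integral_hkerT (n := n) s01 ep0.
have I1 : (\int[mu \x mu]_p (v p.1 ^+ 2 * K p)%:E <= (hTail (n := n) s ep * D)%:E)%E.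
  have m1E : measurable_fun setT (fun p : H * H => (v p.1 ^+ 2 * K p)%:E) by exact/measurable_EFinP.
  have p1E (p : H * H) : (0 <= (v p.1 ^+ 2 * K p)%:E)%E by rewrite lee_fin.
  apply: le_trans (_ : (\int[mu \x mu]_p (v p.1 ^+ 2 * hkerT s ep p.2)%:E <= _)%E).
    rewrite le_eqVlt; apply/orP; left; apply/eqP.
    by apply: etrans (ge0_integral_hpairM m1E p1E) _; apply: eq_integral => p _; rewrite KM.
  have mv2 : measurable_fun setT (fun x => v x ^+ 2) by mfun.
  have v20 x : 0 <= v x ^+ 2 by exact: sqr_ge0.
  have k0 (h : H) : 0 <= hkerT s ep h by exact: hkerT_ge0.
  rewrite (ge0_integral_sep mv2 mkT v20 k0) mulrC EFinM.
  by apply: lee_pmul => //; apply: integral_ge0 => x _; rewrite lee_fin.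
have I2 : (\int[mu \x mu]_p (v p.2 ^+ 2 * K p)%:E <= (hTail (n := n) s ep * D)%:E)%E.
  apply: le_trans I1.
  have m2E : measurable_fun setT (fun p : H * H => (v p.2 ^+ 2 * K p)%:E) by exact/measurable_EFinP.
  have p2E (p : H * H) : (0 <= (v p.2 ^+ 2 * K p)%:E)%E by rewrite lee_fin.
  rewrite le_eqVlt; apply/orP; left; apply/eqP.
  by apply: etrans (ge0_integral_hpair_swap m2E p2E) _; apply: eq_integral => -[x y] _; rewrite KC.
set B := (hTail s ep * D) in I1 I2 *.
have -> : 4 * B = 2 * B + (1 * B + B) by ring.
have J := ge0_integral_axpy_le ler01 m2 m2 p2 p2 I2 I2.
have m2' : measurable_fun setT (fun p : H * H => 1 * (v p.2 ^+ 2 * K p) + v p.2 ^+ 2 * K p) by mfun.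
have p2' (p : H * H) : 0 <= 1 * (v p.2 ^+ 2 * K p) + v p.2 ^+ 2 * K p by rewrite mul1r addr_ge0.
apply: le_trans (ge0_integral_axpy_le (ler0n _ 2) m1 m2' p1 p2' I1 J).
apply: ge0_le_integral_EFin.
- rewrite (_ : (fun p => _) = fun p : H * H => (v p.1 - v p.2) ^+ 2 * K p); first by mfun.
  by apply/funext => p; rewrite -mulrA KE.
- by mfun.
- by move=> p; rewrite -mulrA KE mulr_ge0 ?sqr_ge0.
- move=> p; rewrite -mulrA KE mul1r -mulrDl -mulrDl mulrA -mulrDl ler_wpM2r//.
  rewrite -subr_ge0 (_ : _ - _ = (v p.1 + v p.2) ^+ 2) ?sqr_ge0//; ring.
Qed.

(** Near the diagonal the energy of the fixed [u] is small and that of [v] bounded; far from it the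
    energy of [u] is bounded and that of [v] is controlled by its [L^2] norm. So convergence in
    [L^2] with bounded energy is enough to pass to the limit in [hform s u]. *)
Lemma hform_small (u : H -> R) (M e : R) : measurable_fun setT u ->
  (gagliardo2 s u < +oo)%E -> 0 <= M -> 0 < e -> exists2 d : R, 0 < d &
  forall v, measurable_fun setT v -> (gagliardo2 s v <= M%:E)%E ->
    (\int[mu]_x (v x ^+ 2)%:E <= d%:E)%E -> (`|hform s u v| <= e%:E)%E.
Proof.
move=> mu_ Eu M0 e0.
pose A := fine (gagliardo2 s u).
have AE : gagliardo2 s u = A%:E by rewrite fineK// ge0_fin_numE ?gagliardo2_ge0.
have A0 : 0 <= A by rewrite fine_ge0// gagliardo2_ge0.
(* [tau] and [sig] are the weights of the inequality [x y <= x^2 / (2 t) + t y^2 / 2] near and far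
   from the diagonal. They, [j] and the final [d] are tuned to make each of the four resulting terms
   at most [e / 4]. *)
pose tau := e / (2 * (M + 1)).
have M1 : 0 < M + 1 by rewrite ltr_wpDl.
have tau0 : 0 < tau by rewrite divr_gt0// mulr_gt0.
pose sig := e / (2 * (A + 1)).
have A1 : 0 < A + 1 by rewrite ltr_wpDl.
have sig0 : 0 < sig by rewrite divr_gt0// mulr_gt0.
have te0 : 0 < tau * e / 2 by rewrite divr_gt0// mulr_gt0.
have [j Nj] := near_energy_small mu_ Eu te0.
pose hT := hTail (R := R) (n := n) s j.+1%:R^-1.
have hT0 : 0 <= hT.
  by rewrite mulr_ge0 ?hTheta_ge0// invr_ge0 le_min ler01 sqr_ge0.
have hT1 : 0 < hT + 1 by rewrite ltr_wpDl.
exists (sig * e / (8 * (hT + 1))); first by apply: divr_gt0; apply: mulr_gt0.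
move=> v mv vM vd; have Fj := far_energy_le j mv vd.
have Ev : (gagliardo2 s v < +oo)%E by exact: le_lt_trans vM (ltry _).
have iF := integrable_energy mu_ mv Eu Ev.
pose k (p : H * H) := hkernel s p.1 p.2.
pose a (p : H * H) := u p.1 - u p.2.
pose b (p : H * H) := v p.1 - v p.2.
pose I (p : H * H) : R := \1_(~` hfar j) p.
pose J (p : H * H) : R := \1_(hfar j) p.
have IJ p : I p + J p = 1.
  by rewrite /I /J !indicE in_setC; case: (p \in _); rewrite /= ?addr0 ?add0r.
have I0 p : 0 <= I p by rewrite /I indicE.
have J0 p : 0 <= J p by rewrite /J indicE.
have k0 p : 0 <= k p by exact: hkernel_ge0.
have mk : measurable_fun setT k by rewrite /k; mfun.
have ma : measurable_fun setT a by rewrite /a; mfun.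
have mb : measurable_fun setT b by rewrite /b; mfun.
have mI : measurable_fun setT I.
  by apply: measurable_indic; apply: measurableC; exact: measurable_hfar.
have mJ : measurable_fun setT J by apply: measurable_indic; exact: measurable_hfar.
have g1 : (\int[mu \x mu]_p (a p ^+ 2 * k p * I p)%:E <= (tau * e / 2)%:E)%E by [].
have g2 : (\int[mu \x mu]_p (b p ^+ 2 * k p)%:E <= M%:E)%E.
  apply: le_trans vM; rewrite le_eqVlt; apply/orP; left; apply/eqP.
  by apply: eq_integral => p _; congr (_ * _)%:E; rewrite real_normK ?num_real.
have g3 : (\int[mu \x mu]_p (a p ^+ 2 * k p)%:E <= A%:E)%E.
  rewrite -AE le_eqVlt; apply/orP; left; apply/eqP.
  by apply: eq_integral => p _; congr (_ * _)%:E; rewrite real_normK ?num_real.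
have g4 : (\int[mu \x mu]_p (b p ^+ 2 * k p * J p)%:E <=
    (4 * (hT * (sig * e / (8 * (hT + 1)))))%:E)%E by [].
have hE : hform s u v = (\int[mu \x mu]_p (a p * b p * k p)%:E)%E by [].
have {}iF : (mu \x mu)%E.-integrable setT (EFin \o (fun p => a p * b p * k p)) by [].
rewrite hE; clearbody k a b I J; clear hE Fj Nj.
have mF := measurable_int _ iF.
apply: le_trans (le_abse_integral _ measurableT mF) _.
have q1 p : 0 <= a p ^+ 2 * k p * I p by rewrite mulr3_ge0 ?sqr_ge0.
have q2 p : 0 <= b p ^+ 2 * k p by rewrite mulr_ge0 ?sqr_ge0.
have q3 p : 0 <= a p ^+ 2 * k p by rewrite mulr_ge0 ?sqr_ge0.
have q4 p : 0 <= b p ^+ 2 * k p * J p by rewrite mulr3_ge0 ?sqr_ge0.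
have n1 : measurable_fun setT (fun p => a p ^+ 2 * k p * I p) by mfun.
have n2 : measurable_fun setT (fun p => b p ^+ 2 * k p) by mfun.
have n3 : measurable_fun setT (fun p => a p ^+ 2 * k p) by mfun.
have n4 : measurable_fun setT (fun p => b p ^+ 2 * k p * J p) by mfun.
have t0 : 0 <= (2 * tau)^-1 by rewrite invr_ge0 mulr_ge0// ltW.
have t1 : 0 <= tau / 2 by rewrite divr_ge0// ltW.
have s0 : 0 <= sig / 2 by rewrite divr_ge0// ltW.
have s1 : 0 <= (2 * sig)^-1 by rewrite invr_ge0 mulr_ge0// ltW.
pose f4 (p : H * H) := (2 * sig)^-1 * (b p ^+ 2 * k p * J p).
pose f3 p := sig / 2 * (a p ^+ 2 * k p) + f4 p.
pose f2 p := tau / 2 * (b p ^+ 2 * k p) + f3 p.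
pose f1 p := (2 * tau)^-1 * (a p ^+ 2 * k p * I p) + f2 p.
have f40 p : 0 <= f4 p by rewrite /f4 mulr_ge0.
have f30 p : 0 <= f3 p by rewrite addr_ge0// mulr_ge0.
have f20 p : 0 <= f2 p by rewrite addr_ge0// mulr_ge0.
have m4 : measurable_fun setT f4 by rewrite /f4; mfun.
have m3 : measurable_fun setT f3 by rewrite /f3; mfun.
have m2 : measurable_fun setT f2 by rewrite /f2; mfun.
have m1 : measurable_fun setT f1 by rewrite /f1; mfun.
have G4 := ge0_integralZ_le s1 n4 q4 g4.
have G3 := ge0_integral_axpy_le s0 n3 m4 q3 f40 g3 G4.
have G2 := ge0_integral_axpy_le t1 n2 m3 q2 f30 g2 G3.
have G1 := ge0_integral_axpy_le t0 n1 m2 q1 f20 g1 G2.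
apply: (@le_trans _ _ (\int[mu \x mu]_p (f1 p)%:E)%E).
  apply: ge0_le_integral => //.
  - by apply: measurableT_comp.
  - exact/measurable_EFinP.
  - move=> p _; rewrite abse_EFin lee_fin /f1 /f2 /f3 /f4.
    rewrite normrM (ger0_norm (k0 p)) normrM.
    have -> : `|a p| * `|b p| * k p = (`|a p| * `|b p|) * I p * k p + (`|a p| * `|b p|) * J p * k p.
      by rewrite -mulrDl -mulrDr IJ mulr1.
    have am x y t : 0 < t -> `|x| * `|y| <= (2 * t)^-1 * x ^+ 2 + t / 2 * y ^+ 2 :> R.
      move=> tp; have := sqr_ge0 (`|x| - t * `|y|); rewrite -[x ^+ 2]real_normK ?num_real//.
      rewrite -[y ^+ 2]real_normK ?num_real// => h.
      rewrite -(ler_pM2l (_ : 0 < 2 * t)) ?mulr_gt0//.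
      have -> : 2 * t * ((2 * t)^-1 * `|x| ^+ 2 + t / 2 * `|y| ^+ 2) = `|x| ^+ 2 + t ^+ 2 * `|y| ^+ 2.
        by field; rewrite gt_eqF.
      by move: h; move: (`|x|) (`|y|) => x' y'; nra.
    have I1 : I p <= 1 by rewrite -(IJ p) lerDl.
    have h1 : `|a p| * `|b p| * I p * k p <= (2 * tau)^-1 * (a p ^+ 2 * k p * I p) + tau / 2 * (b p ^+ 2 * k p).
      apply: (@le_trans _ _ (((2 * tau)^-1 * a p ^+ 2 + tau / 2 * b p ^+ 2) * (I p * k p))).
        by rewrite -mulrA ler_wpM2r ?mulr_ge0// am.
      rewrite mulrDl; apply: lerD.
        by rewrite le_eqVlt; apply/orP; left; apply/eqP; ring.
      rewrite -[leLHS]mulrA ler_wpM2l// ler_wpM2l ?sqr_ge0//.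
      by rewrite ler_piMl.
    have h2 : `|a p| * `|b p| * J p * k p <= sig / 2 * (a p ^+ 2 * k p) + (2 * sig)^-1 * (b p ^+ 2 * k p * J p).
      apply: (@le_trans _ _ (((2 * sig)^-1 * b p ^+ 2 + sig / 2 * a p ^+ 2) * (J p * k p))).
        by rewrite -mulrA ler_wpM2r ?mulr_ge0// mulrC am.
      rewrite mulrDl addrC; apply: lerD.
        rewrite -[leLHS]mulrA ler_wpM2l// ler_wpM2l ?sqr_ge0//.
        by rewrite ler_piMl// -(IJ p) lerDr.
      by rewrite le_eqVlt; apply/orP; left; apply/eqP; ring.
    by rewrite addrA; exact: lerD h1 h2.
apply: le_trans G1 _; rewrite lee_fin.
have E1 : (2 * tau)^-1 * (tau * e / 2) = e / 4 by field; rewrite gt_eqF.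
have E2 : tau / 2 * M <= e / 4.
  rewrite (_ : tau / 2 * M = e / 4 * (M / (M + 1))); last by rewrite /tau; field; rewrite gt_eqF.
  by rewrite ler_piMr ?divr_ge0 ?(ltW e0)// ler_pdivrMr// mul1r lerDl.
have E3 : sig / 2 * A <= e / 4.
  rewrite (_ : sig / 2 * A = e / 4 * (A / (A + 1))); last by rewrite /sig; field; rewrite gt_eqF.
  by rewrite ler_piMr ?divr_ge0 ?(ltW e0)// ler_pdivrMr// mul1r lerDl.
have E4 : (2 * sig)^-1 * (4 * (hT * (sig * e / (8 * (hT + 1))))) <= e / 4.
  rewrite [leLHS](_ : _ = e / 4 * (hT / (hT + 1))); last by (field; rewrite !gt_eqF).
  by rewrite ler_piMr ?divr_ge0 ?(ltW e0)// ler_pdivrMr// mul1r lerDl.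
rewrite E1; move: E2 E3 E4; set x2 := tau / 2 * M; set x3 := sig / 2 * A; set x4 := _^-1 * _.
by clearbody x2 x3 x4; lra.
Qed.
End weak_continuity.

Section supersolution_test.
Context {R : realType} {n : nat}.
Local Notation H := (heis R n).
Local Notation mu := (@hleb R n).
Variable s : R.
Hypothesis s01 : 0 < s < 1.

Lemma Hs0_Cc_infty (Omega : set H) (v : H -> R) : Hs s v -> Cc_infty Omega v -> Hs0 s Omega v.
Proof.
move=> Hv Cv; split=> // e e0; exists v; split=> //.
have -> : (v \- v)%R = cst 0 by apply/funext => x /=; rewrite subrr.
rewrite /Hs_norm Lnorm2E /gagliardo2.
have -> : (\int[mu]_x (cst (0 : R) x ^+ 2)%:E = 0)%E.
  by apply: integral0_eq => x _; rewrite /= expr0n.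
have -> : (\int[mu \x mu]_p (`|cst (0 : R) p.1 - cst 0 p.2| ^+ 2 * hkernel s p.1 p.2)%:E = 0)%E.
  by apply: integral0_eq => x _; rewrite /= subrr normr0 expr0n/= mul0r.
rewrite poweR0r ?invr_neq0// expe2 mule0 adde0 poweR0r ?invr_neq0//.
Qed.

Lemma hformD (u v w : H -> R) : measurable_fun setT u -> measurable_fun setT v ->
  measurable_fun setT w -> (gagliardo2 s u < +oo)%E -> (gagliardo2 s v < +oo)%E ->
  (gagliardo2 s w < +oo)%E ->
  (hform s u (fun x => (v x + w x)%R) = hform s u v + hform s u w)%E.
Proof.
move=> mu_ mv mw Eu Ev Ew.
have i1 := integrable_energy mu_ mv Eu Ev.
have i2 := integrable_energy mu_ mw Eu Ew.
rewrite /hform -(integralD measurableT i1 i2); apply: eq_integral => p _.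
by rewrite -EFinD; congr EFin; ring.
Qed.

Lemma gagliardo2B_le (v w : H -> R) (G : R) : measurable_fun setT v ->
  measurable_fun setT w -> (gagliardo2 s v <= G%:E)%E -> (gagliardo2 s w <= G%:E)%E ->
  (gagliardo2 s (fun x => (v x - w x)%R) <= (4 * G)%:E)%E.
Proof.
move=> mv mw vG wG.
pose F (f : H -> R) (p : H * H) := `|f p.1 - f p.2| ^+ 2 * hkernel s p.1 p.2.
have F0 f p : 0 <= F f p by rewrite mulr_ge0 ?hkernel_ge0// exprn_ge0.
have mF f : measurable_fun setT f -> measurable_fun setT (F f) by move=> mf; rewrite /F; mfun.
have mFv := mF _ mv; have mFw := mF _ mw.
have J := ge0_integral_axpy_le ler01 mFw mFw (F0 _) (F0 _) wG wG.
have m2' : measurable_fun setT (fun p : H * H => 1 * F w p + F w p) by mfun.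
have p2' (p : H * H) : 0 <= 1 * F w p + F w p by rewrite mul1r addr_ge0.
have -> : 4 * G = 2 * G + (1 * G + G) by ring.
apply: le_trans (ge0_integral_axpy_le (ler0n _ 2) mFv m2' (F0 _) p2' vG J).
have mD : measurable_fun setT (F (fun x => v x - w x)) by apply: mF; mfun.
have -> : gagliardo2 s (fun x => (v x - w x)%R) =
    (\int[mu \x mu]_p (F (fun x => v x - w x) p)%:E)%E by [].
apply: (ge0_le_integral_EFin _ mD) => //.
- by mfun.
- move=> p; rewrite mul1r /F -mulrDl mulrA -mulrDl ler_wpM2r ?hkernel_ge0//.
  rewrite !real_normK ?num_real// -subr_ge0.
  have -> : forall a b c d : R, 2 * (a - b) ^+ 2 + ((c - d) ^+ 2 + (c - d) ^+ 2) - (a - c - (b - d)) ^+ 2 =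
     (a - b + (c - d)) ^+ 2 by move=> a b c d; ring.
  exact: sqr_ge0.
Qed.

(** The form at [w] is its value at the mollified function, which is an admissible test function,
    plus its value at the difference. The difference has energy at most [4 G] and arbitrarily small
    [L^2] norm, so its contribution is at least [- e]. The gap between [rho] and [r] leaves room for
    the support to grow. *)
Lemma hform_supersolution_ge0 (Omega : set H) (g u w : H -> R) (x0 : H) (rho r K : R) :
  weak_supersolution s Omega g u -> 0 < rho -> rho < r -> hball x0 r `<=` Omega ->
  measurable_fun setT w -> (forall x, 0 <= w x) -> (forall x, w x <= K) ->
  (forall x, rho <= hdist x x0 -> w x = 0) -> (gagliardo2 s w < +oo)%E ->
  (0 <= hform s u w)%E.
Proof.
move=> [[mu_ _ Eu] _ Sol] rho0 rhor rO mw w0 wK ws Ew.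
apply/lee_addgt0Pr => e e0.
pose G := fine (gagliardo2 s w).
have GE : gagliardo2 s w = G%:E by rewrite fineK// ge0_fin_numE ?gagliardo2_ge0.
have G0 : 0 <= G by rewrite fine_ge0// gagliardo2_ge0.
have [d d0 Hd] := hform_small s01 mu_ Eu (mulr_ge0 (ler0n _ 4) G0) e0.
have [t t0 Ht] := l2_translate s01 rho0 mw w0 wK ws Ew d0.
pose del := Num.min t ((r - rho) / 2).
have del0 : 0 < del by rewrite lt_min t0 divr_gt0// subr_gt0.
have rdr : rho + del < r.
  rewrite -ltrBrDl; apply: le_lt_trans (_ : (r - rho) / 2 < _); first by rewrite ge_min lexx orbT.
  by rewrite ltr_pdivrMr// ltr_pMr ?subr_gt0// ltr1n.
have [c c0 cE] := hmollb_mass x0 del0.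
pose wd := lmoll x0 w del c.
have mwd : measurable_fun setT wd by exact: measurable_lmoll.
have Ewd : (gagliardo2 s wd <= gagliardo2 s w)%E by exact: (gagliardo2_lmoll s mw w0 wK c0 cE).
have wd0 x : 0 <= wd x by exact: lmoll_ge0.
have wdK x : wd x <= K by exact: (lmoll_le mw w0 wK c0 cE).
have Hwd : Hs s wd.
  split=> //; last exact: le_lt_trans Ewd Ew.
  rewrite Lnorm2_lty; have rd0 : 0 < rho + del by rewrite addr_gt0.
  apply: le_lt_trans (integral_supp_le (x0 := x0) (k := K ^+ 2) rd0 _ _ _ _) (ltry _).
  - by mfun.
  - by move=> x; exact: sqr_ge0.
  - by move=> x; rewrite ler_sqr ?nnegrE// (le_trans (wd0 x)).
  - by move=> x xr; rewrite /wd (lmoll_supp ws del0 c xr) expr0n.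
have Cwd : Cc_infty Omega wd.
  exact: (Cc_infty_lmoll rho0 mw w0 wK ws del0 c rdr rO).
have S := Sol _ (Hs0_Cc_infty Hwd Cwd) (aeW mu wd0).
pose v x := w x - wd x.
have mv : measurable_fun setT v by rewrite /v; mfun.
have Ev : (gagliardo2 s v <= (4 * G)%:E)%E by apply: gagliardo2B_le; rewrite -?GE.
have v2 : (\int[mu]_x (v x ^+ 2)%:E <= d%:E)%E.
  under eq_integral do rewrite -sqrrN opprB.
  apply: (lmoll_dist mw w0 wK del0 c0 cE) => z zd; apply: Ht.
  by apply: lt_le_trans zd _; rewrite ge_min lexx.
have {}Hd := Hd v mv Ev v2.
have -> : hform s u w = (hform s u wd + hform s u v)%E.
  rewrite -hformD//.
  - congr hform; apply/funext => x; rewrite /v; ring.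
  - exact: le_lt_trans Ewd Ew.
  - exact: le_lt_trans Ev (ltry _).
rewrite -addeA adde_ge0//.
move: Hd; case: (hform s u v) => [a| |]//=.
by rewrite lee_fin ler_norml -EFinD lee_fin -lerBlDr sub0r => /andP[].
Qed.

End supersolution_test.

(** * The two energy inequalities *)

(** Integrates the pointwise inequalities obtained from the supersolution property: [F1] is the
    tested form, whose nonnegative integral is dropped, [F2] pairs with the bump and [Y] carries the
    tail. Integrability of [X] follows from the inequality itself. *)
Lemma ge0_integral_le_addB d (T : measurableType d) (R : realType)
    (m : {measure set T -> \bar R}) (X F1 F2 Y : T -> R) (A B : R) :
  measurable_fun setT X -> (forall x, 0 <= X x) ->
  m.-integrable setT (EFin \o F1) -> m.-integrable setT (EFin \o F2) ->
  measurable_fun setT Y -> (forall x, 0 <= Y x) ->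
  (forall x, X x <= F2 x + Y x - F1 x) ->
  (0 <= \int[m]_x (F1 x)%:E)%E -> (\int[m]_x (F2 x)%:E <= A%:E)%E ->
  (\int[m]_x (Y x)%:E <= B%:E)%E -> (\int[m]_x (X x)%:E <= (A + B)%:E)%E.
Proof.
move=> mX X0 i1 i2 mY Y0 XF F10 F2A YB.
have iY : m.-integrable setT (EFin \o Y).
  apply/integrableP; split; first exact/measurable_EFinP.
  under eq_integral do rewrite /= ger0_norm//.
  exact: le_lt_trans YB (ltry _).
have i2Y := integrableD measurableT i2 iY.
have iX : m.-integrable setT (EFin \o X).
  apply: (le_integrable measurableT _ _ (integrableB measurableT i2Y i1)).
    exact/measurable_EFinP.
  move=> x _; rewrite /= lee_fin ger0_norm//.
  exact: le_trans (XF x) (ler_norm _).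
apply: (@le_trans _ _ (\int[m]_x ((EFin \o F2) x + (EFin \o Y) x - (EFin \o F1) x))%E).
  by apply: (le_integral measurableT iX (integrableB measurableT i2Y i1)) => x _ /=; rewrite lee_fin.
rewrite (integralB measurableT i2Y i1) (integralD measurableT i2 iY).
by rewrite EFinD -[leRHS]sube0; apply: leeB => //; exact: leeD.
Qed.

(** * Pointwise algebra of the truncations *)

Section truncation.
Context {R : realType}.
Implicit Types u l : R.

Definition tpos u : R := Num.max u 0.
Definition tneg u : R := Num.max (- u) 0.
Definition tdef u l : R := Num.max 0 (l - tpos u).
Definition tmin u l : R := Num.min (tpos u) l.

Lemma tpos_ge0 u : 0 <= tpos u. Proof. by rewrite le_max lexx orbT. Qed.
Lemma tneg_ge0 u : 0 <= tneg u. Proof. by rewrite le_max lexx orbT. Qed.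
Lemma tdef_ge0 u l : 0 <= tdef u l. Proof. by rewrite le_max lexx. Qed.
Lemma tmin_ge0 u l : 0 <= l -> 0 <= tmin u l.
Proof. by move=> l0; rewrite le_min tpos_ge0. Qed.
Lemma tmin_le u l : tmin u l <= l. Proof. by rewrite ge_min lexx orbT. Qed.
Lemma tmin_le_tpos u l : tmin u l <= tpos u. Proof. by rewrite ge_min lexx. Qed.
Lemma tminD_tdef u l : tmin u l + tdef u l = l.
Proof. by rewrite /tmin /tdef; case: leP => h; case: leP => h'; lra. Qed.
Lemma tdef_le u l : 0 <= l -> tdef u l <= l.
Proof. by move=> l0; rewrite -[leRHS](tminD_tdef u l) lerDr tmin_ge0. Qed.
Lemma tdef_eq0_le u l : tdef u l = 0 -> 0 <= u -> l <= u.
Proof.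
by move=> w0 u0; rewrite -(tminD_tdef u l) w0 addr0 (le_trans (tmin_le_tpos _ _))// /tpos (max_idPl _).
Qed.
Lemma tposE u : u = tpos u - tneg u.
Proof. by rewrite /tpos /tneg; case: leP => h; case: leP => h'; lra. Qed.
Lemma tdefM0 u l : (tpos u - tmin u l) * tdef u l = 0.
Proof.
rewrite /tmin /tdef; have [h|h] := leP (tpos u) l; first by rewrite subrr mul0r.
by rewrite (max_idPl _) ?mulr0// subr_le0 ltW.
Qed.

Lemma truncation_key u u' l l' k : 0 <= k -> 0 <= l -> 0 <= l' ->
  let w := tdef u l in let w' := tdef u' l' in
  let p := tmin u l in let p' := tmin u' l' in
  let X := (tpos u - p) * w' + (tpos u' - p') * w in
  let Y := tneg u * w' + tneg u' * w in
  X * k <= (l - l') * (w - w') * k + Y * k - (u - u') * (w - w') * k /\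
  (p - p') ^+ 2 * k <= (p - p') * (l - l') * k + Y * k - (u - u') * (w - w') * k.
Proof.
move=> k0 l0 l'0 w w' p p' X Y.
have E : (u - u') * (w - w') = (p - p') * (w - w') - X + Y - (tneg u * w + tneg u' * w').
  rewrite {1}(tposE u) {1}(tposE u') /X /Y.
  have := tdefM0 u l; have := tdefM0 u' l'; rewrite -/w -/w' -/p -/p'.
  move: (tpos u) (tpos u') (tneg u) (tneg u') => a a' b b' h h'.
  have h1 : a' * w' = p' * w' by apply/eqP; rewrite -subr_eq0 -mulrBl h.
  have h2 : a * w = p * w by apply/eqP; rewrite -subr_eq0 -mulrBl h'.
  by ring: h1 h2.
have Z0 : 0 <= tneg u * w + tneg u' * w' by rewrite addr_ge0 ?mulr_ge0 ?tneg_ge0 ?tdef_ge0.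
have X0 : 0 <= X.
  by rewrite addr_ge0// mulr_ge0 ?tdef_ge0// subr_ge0 tmin_le_tpos.
have lE : l = p + w by rewrite tminD_tdef.
have lE' : l' = p' + w' by rewrite tminD_tdef.
(* After substituting [l = p + w] on both sides, the right side exceeds the left one by
   [(w - w')^2 + Z] in the first inequality and by [X + Z] in the second, [Z] being the sum in
   [Z0]. *)
rewrite -!mulrDl -!mulrBl; split; apply: ler_wpM2r => //; rewrite E.
- rewrite lE lE'; have := sqr_ge0 (w - w'); move: Z0 => {E}; nra.
- rewrite lE lE'; move: Z0 X0 => {E}; set Z := _ + _ => *; nra.
Qed.

Lemma max0_Lipschitz u l : `|Num.max 0 u - Num.max 0 l| <= `|u - l|.
Proof.
wlog ul : u l / l <= u.
  by move=> hw; have [|/ltW] := leP l u; [|rewrite distrC (distrC u)]; exact: hw.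
rewrite (ger0_norm (_ : 0 <= u - l)) ?subr_ge0//.
rewrite ger0_norm; last by rewrite subr_ge0 le_max2.
by case: (leP 0 u) => h; case: (leP 0 l) => h'; lra.
Qed.

Lemma tdef_Lipschitz u u' l l' : `|tdef u l - tdef u' l'| <= `|l - l'| + `|u - u'|.
Proof.
apply: le_trans (max0_Lipschitz _ _) _.
rewrite (_ : _ - _ = (l - l') - (tpos u - tpos u')); last by ring.
apply: le_trans (ler_normB _ _) _; rewrite lerD2l /tpos !(maxC _ 0).
exact: max0_Lipschitz.
Qed.

End truncation.

Lemma invr_powR_ratio (R : realType) (a b q : R) : 0 <= q -> 0 < a ->
  a * (2 / 3) <= b -> (b `^ q)^-1 <= (3 / 2) `^ q * (a `^ q)^-1.
Proof.
move=> q0 a0 ab; have c0 : 0 < a * (2 / 3) by rewrite mulr_gt0// divr_gt0.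
apply: le_trans (invr_powR_anti q0 c0 ab) _.
rewrite powRM ?(ltW a0) ?divr_ge0// invfM mulrC -[2 / 3]invf_div.
by rewrite -[(3 / 2)^-1]powR_inv1 ?divr_ge0// -powRrM mulN1r powRN invrK.
Qed.

(** For [x] within [2 r] of the centre and [y] at distance at least [6 r] from it, the distance from
    [x] to [y] is at least two thirds of that from the centre to [y]. This is where the factor 6
    between the radii enters: the tail seen from [x] is comparable to the tail seen from the
    centre. *)
Lemma two_thirds_le (R : realFieldType) (a b c r : R) :
  a <= b + c -> c < 2 * r -> 6 * r <= a -> a * (2 / 3) <= b.
Proof. lra. Qed.

Lemma hbump_ge (R : realType) (n : nat) (x0 x : heis R n) (rho a : R) : 0 < rho ->
  hdist x x0 <= a * rho -> 1 - a ^+ 4 <= hbump x0 rho x.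
Proof.
move=> rho0 xa; rewrite /hbump le_max; apply/orP; right.
rewrite lerD2l lerN2 -hnormX4 -expr_div_n ler_pXn2r// ?nnegrE ?divr_ge0 ?hnorm_ge0 ?(ltW rho0)//.
  by rewrite ler_pdivrMr.
by rewrite -(pmulr_rge0 _ rho0) mulrC (le_trans _ xa)// hdist_ge0.
Qed.

(** [3 / 4] is the ratio of the radius [3 r / 2] to the radius [2 r] of the bump. *)
Lemma half_le_quartic (R : realFieldType) : 2^-1 <= 1 - (3 / 4) ^+ 4 :> R.
Proof. by rewrite !exprS expr0; lra. Qed.

(** * The energy inequalities at a fixed level *)

Section main_inequalities.
Context {R : realType} {n : nat}.
Local Notation H := (heis R n).
Local Notation mu := (@hleb R n).
Variables (s : R) (x0 : H) (r Rad I0 : R) (u : H -> R).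
Hypothesis s01 : 0 < s < 1.
Hypothesis r0 : 0 < r.
Hypothesis rRad : 6 * r <= Rad.
Hypothesis mu_ : measurable_fun setT u.
Hypothesis Eu : (gagliardo2 s u < +oo)%E.
Hypothesis upos : {ae mu, forall x, hball x0 Rad x -> 0 <= u x}.
Hypothesis test : forall (w : H -> R) (K : R), measurable_fun setT w ->
  (forall x, 0 <= w x) -> (forall x, w x <= K) ->
  (forall x, 2 * r <= hdist x x0 -> w x = 0) -> (gagliardo2 s w < +oo)%E ->
  (0 <= hform s u w)%E.
Hypothesis I0E :
  (\int[mu]_(y in ~` hball x0 Rad) (tneg (u y) * hkernel s x0 y)%:E = I0%:E)%E.

Local Notation eta := (hbump x0 (2 * r)).

Let r20 : 0 < 2 * r. Proof. by rewrite mulr_gt0. Qed.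

Definition hsolT : R := (3 / 2) `^ (hQ R n + 2 * s) * I0.

Let I00 : 0 <= I0.
Proof.
rewrite -lee_fin -I0E; apply: integral_ge0 => y _.
by rewrite lee_fin mulr_ge0 ?tneg_ge0 ?hkernel_ge0.
Qed.

Lemma hsolT_ge0 : 0 <= hsolT. Proof. by rewrite mulr_ge0 ?powR_ge0. Qed.

(** Inside the ball of radius [Rad] the negative part vanishes almost everywhere; outside it the
    kernels at [x] and at [x0] are comparable. *)
Lemma tail_le x : hdist x x0 < 2 * r ->
  (\int[mu]_y (tneg (u y) * hkernel s x y)%:E <= hsolT%:E)%E.
Proof.
move=> xr.
have mB : measurable (hball x0 Rad) by exact: measurable_hball.
have mBC : measurable (~` hball x0 Rad) by exact: measurableC.
have mF (z : H) : measurable_fun setT (fun y => (tneg (u y) * hkernel s z y)%:E).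
  by rewrite /tneg; mfun.
have F0 (z y : H) : (0 <= (tneg (u y) * hkernel s z y)%:E)%E.
  by rewrite lee_fin mulr_ge0 ?tneg_ge0 ?hkernel_ge0.
rewrite -(setUv (hball x0 Rad)) (ge0_integral_setU mu mB mBC)//; last 2 first.
- by rewrite setUv; exact: mF.
- by apply/disj_setPCl.
rewrite [X in (X + _)%E](_ : _ = 0%E); last first.
  apply: etrans (_ : \int[mu]_(y in hball x0 Rad) cst 0%E y = 0)%E; last by rewrite integral0_eq.
  apply: ae_eq_integral => //.
  - exact: (measurable_funTS (mF x)).
  - apply: filterS upos => y uy yB; rewrite /tneg (max_idPr _) ?mul0r//.
    by rewrite oppr_le0 uy.
rewrite add0e /hsolT EFinM -I0E.
rewrite -(ge0_integralZl _ mBC (measurable_funTS (mF x0)) (fun y _ => F0 x0 y)) ?lee_fin ?powR_ge0//.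
apply: ge0_le_integral => //.
- exact: (measurable_funTS (mF x)).
- by apply: measurable_funeM; exact: (measurable_funTS (mF x0)).
move=> y; rewrite /hball/= => /negP; rewrite -leNgt => yR.
rewrite -EFinM lee_fin mulrCA ler_wpM2l ?tneg_ge0//.
have d0 : 0 < hdist y x0 by apply: lt_le_trans yR; apply: lt_le_trans rRad; rewrite mulr_gt0.
have dd : hdist x0 y * (2 / 3) <= hdist x y.
  have := hdist_triangle x y x0; rewrite (hdistC y x) (hdistC x0 y) => h.
  exact: two_thirds_le h xr (le_trans rRad yR).
have q0 : 0 <= hQ R n + 2 * s by apply: ltW; exact: hQ2s_gt0.
rewrite hdistC in d0; exact: (invr_powR_ratio q0 d0 dd).
Qed.

Section level.
Variable l : R.
Hypothesis l0 : 0 <= l.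

(* The functions [w = (l eta - u_+)_+], [p = min (u_+, l eta)] and [a = u_+ - p]
   of the proof, at level [l]. *)
Definition hsw (x : H) : R := tdef (u x) (l * eta x).
Definition hsp (x : H) : R := tmin (u x) (l * eta x).
Definition hsa (x : H) : R := tpos (u x) - hsp x.

Let le0 x : 0 <= l * eta x. Proof. by rewrite mulr_ge0 ?hbump_ge0. Qed.
Let me := measurable_hbump x0 (2 * r).

Lemma measurable_hsw : measurable_fun setT hsw.
Proof. by rewrite /hsw /tdef /tpos; mfun. Qed.
Lemma measurable_hsp : measurable_fun setT hsp.
Proof. by rewrite /hsp /tmin /tpos; mfun. Qed.
Lemma measurable_hsa : measurable_fun setT hsa.
Proof. by have mp := measurable_hsp; rewrite /hsa /tpos; mfun. Qed.

Lemma hsw_ge0 x : 0 <= hsw x. Proof. exact: tdef_ge0. Qed.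
Lemma hsp_ge0 x : 0 <= hsp x. Proof. exact: tmin_ge0. Qed.
Lemma hsa_ge0 x : 0 <= hsa x. Proof. by rewrite subr_ge0 tmin_le_tpos. Qed.
Lemma hsw_le x : hsw x <= l * eta x. Proof. exact: tdef_le. Qed.
Lemma hsp_le x : hsp x <= l * eta x. Proof. exact: tmin_le. Qed.

Lemma hsw_eq0 x : 2 * r <= hdist x x0 -> hsw x = 0.
Proof.
move=> xr; apply/eqP; rewrite eq_le hsw_ge0 andbT.
by apply: le_trans (hsw_le x) _; rewrite hbump_eq0// mulr0.
Qed.

Lemma gagliardo2_hsw_fin : (gagliardo2 s hsw < +oo)%E.
Proof.
have Ee := gagliardo2_bump_fin x0 s01 r20.
pose F (f : H -> R) (p : H * H) := `|f p.1 - f p.2| ^+ 2 * hkernel s p.1 p.2.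
have F0 f p : 0 <= F f p by rewrite mulr_ge0 ?hkernel_ge0// exprn_ge0.
have mF f : measurable_fun setT f -> measurable_fun setT (F f) by move=> mf; rewrite /F; mfun.
have fE (f : H -> R) : (gagliardo2 s f < +oo)%E ->
    (\int[mu \x mu]_p (F f p)%:E <= (fine (gagliardo2 s f))%:E)%E.
  by move=> Ef; rewrite fineK ?ge0_fin_numE ?gagliardo2_ge0.
have mFe := mF _ me; have mFu := mF _ mu_.
have J := ge0_integralZ_le (ler0n _ 2) mFu (F0 u) (fE _ Eu).
have m2 : measurable_fun setT (fun p => 2 * F u p) by mfun.
have p2 p : 0 <= 2 * F u p by rewrite mulr_ge0.
have l20 : 0 <= 2 * l ^+ 2 by rewrite mulr_ge0// sqr_ge0.
have := ge0_integral_axpy_le l20 mFe m2 (F0 _) p2 (fE _ Ee) J.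
move=> h; apply: le_lt_trans (le_trans _ h) (ltry _).
have mw := mF _ measurable_hsw.
have -> : gagliardo2 s hsw = (\int[mu \x mu]_p (F hsw p)%:E)%E by [].
apply: (ge0_le_integral_EFin _ mw _ (F0 _)); first by mfun.
move=> p; rewrite /F [leRHS](_ : _ = (2 * l ^+ 2 * `|eta p.1 - eta p.2| ^+ 2 +
  2 * `|u p.1 - u p.2| ^+ 2) * hkernel s p.1 p.2); last by ring.
rewrite ler_wpM2r ?hkernel_ge0//.
have := tdef_Lipschitz (u p.1) (u p.2) (l * eta p.1) (l * eta p.2).
rewrite -[tdef _ _]/(hsw p.1) -[tdef (u p.2) _]/(hsw p.2) -mulrBr normrM (ger0_norm l0).
have := normr_ge0 (hsw p.1 - hsw p.2).
move: (`|hsw _ - _|) (`|eta _ - _|) (`|u _ - _|) => A B C A0 h'.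
apply: (@le_trans _ _ ((l * B + C) ^+ 2)).
  by rewrite ler_sqr ?nnegrE// (le_trans A0).
rewrite -subr_ge0 (_ : _ - _ = (l * B - C) ^+ 2) ?sqr_ge0//; ring.
Qed.

Lemma gagliardo2_hsp_fin : (gagliardo2 s hsp < +oo)%E.
Proof.
have Ee := gagliardo2_bump_fin x0 s01 r20.
have -> : hsp = fun x => (l * eta x - hsw x)%R.
  by apply/funext => x; rewrite -(tminD_tdef (u x) (l * eta x)) addrK.
have Ele : (gagliardo2 s (fun x => (l * eta x)%R) < +oo)%E.
  have e1 x : l * eta x <= l * eta x by [].
  have -> : gagliardo2 s (fun x => (l * eta x)%R) = ((l ^+ 2)%:E * gagliardo2 s eta)%E.
    rewrite /gagliardo2 -ge0_integralZl//; last 3 first.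
    - by mfun.
    - by move=> p _; rewrite lee_fin mulr_ge0 ?hkernel_ge0// exprn_ge0.
    - by rewrite lee_fin sqr_ge0.
    apply: eq_integral => p _; rewrite -mulrBr normrM exprMn (ger0_norm l0) -mulrA.
    by rewrite EFinM.
  by apply: lte_mul_pinfty => //; rewrite ?lee_fin ?sqr_ge0.
have mle : measurable_fun setT (fun x => l * eta x) by mfun.
pose G := Num.max (fine (gagliardo2 s (fun x => (l * eta x)%R))) (fine (gagliardo2 s hsw)).
apply: le_lt_trans (gagliardo2B_le (G := G) mle measurable_hsw _ _) (ltry _).
- by rewrite -[leLHS]fineK ?lee_fin ?le_max ?lexx// ge0_fin_numE ?gagliardo2_ge0.
- by rewrite -[leLHS]fineK ?lee_fin ?le_max ?lexx ?orbT ?ge0_fin_numE ?gagliardo2_ge0 ?gagliardo2_hsw_fin.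
Qed.

Let sup_w := hform_bump_le s01 r20 measurable_hsw hsw_ge0 hsw_le gagliardo2_hsw_fin.
Let sup_p := hform_bump_le s01 r20 measurable_hsp hsp_ge0 hsp_le gagliardo2_hsp_fin.

Definition hsW : R := fine (\int[mu]_x (hsw x)%:E).
Definition hsP : R := fine (\int[mu]_x (hsp x)%:E).

Lemma hsWE : (\int[mu]_x (hsw x)%:E = hsW%:E)%E.
Proof.
rewrite fineK// ge0_fin_numE; first exact: (integral_bump_fin r20 measurable_hsw hsw_ge0 hsw_le).
by apply: integral_ge0 => x _; rewrite lee_fin hsw_ge0.
Qed.

Lemma hsPE : (\int[mu]_x (hsp x)%:E = hsP%:E)%E.
Proof.
rewrite fineK// ge0_fin_numE; first exact: (integral_bump_fin r20 measurable_hsp hsp_ge0 hsp_le).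
by apply: integral_ge0 => x _; rewrite lee_fin hsp_ge0.
Qed.

Let k (p : H * H) := hkernel s p.1 p.2.
Let Y (p : H * H) := (tneg (u p.1) * hsw p.2 + tneg (u p.2) * hsw p.1) * k p.
Let mneg : measurable_fun setT (@tneg R). Proof. by rewrite /tneg; mfun. Qed.

Let mw := measurable_hsw.
Let mp := measurable_hsp.
Let ma := measurable_hsa.

Lemma integral_half_le :
  (\int[mu \x mu]_p (hsw p.1 * tneg (u p.2) * k p)%:E <= (hsolT * hsW)%:E)%E.
Proof.
have mF : measurable_fun setT (fun p : H * H => (hsw p.1 * tneg (u p.2) * k p)%:E).
  by rewrite /k; mfun.
have F0 (p : H * H) : (0 <= (hsw p.1 * tneg (u p.2) * k p)%:E)%E.
  by rewrite lee_fin mulr3_ge0 ?hsw_ge0 ?tneg_ge0 ?hkernel_ge0.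
apply: le_trans (_ : (\int[mu]_x \int[mu]_y (hsw x * tneg (u y) * hkernel s x y)%:E <= _)%E).
  by rewrite le_eqVlt; apply/orP; left; apply/eqP; exact: (fubini_tonelli1 _ mF F0).
have mwE : measurable_fun setT (fun x => (hsw x)%:E) by exact/measurable_EFinP.
have wE0 x : setT x -> (0 <= (hsw x)%:E)%E by rewrite lee_fin hsw_ge0.
have T0 : (0 <= hsolT%:E)%E by rewrite lee_fin hsolT_ge0.
rewrite EFinM -hsWE -(ge0_integralZl _ measurableT mwE wE0 T0).
apply: ge0_le_integral => //.
- by move=> x _; apply: integral_ge0 => y _; exact: (F0 (x, y)).
- exact: (measurable_fun_fubini_tonelli_F (m2 := mu) _ mF F0).
- exact: measurable_funeM.
move=> x _.
have mG : measurable_fun setT (fun y => (tneg (u y) * hkernel s x y)%:E) by mfun.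
have G0 y : setT y -> (0 <= (tneg (u y) * hkernel s x y)%:E)%E.
  by rewrite lee_fin mulr_ge0 ?tneg_ge0 ?hkernel_ge0.
have -> : (\int[mu]_y (hsw x * tneg (u y) * hkernel s x y)%:E =
    (hsw x)%:E * \int[mu]_y (tneg (u y) * hkernel s x y)%:E)%E.
  rewrite -(ge0_integralZl _ measurableT mG G0 (wE0 x I)).
  by apply: eq_integral => y _; rewrite -EFinM mulrA.
rewrite muleC; have [xr|xr] := ltP (hdist x x0) (2 * r); last first.
  by rewrite hsw_eq0// !mule0.
by apply: lee_wpmul2r; [exact: wE0|exact: tail_le].
Qed.

Lemma integral_Y_le : (\int[mu \x mu]_p (Y p)%:E <= (2 * (hsolT * hsW))%:E)%E.
Proof.
pose h1 (p : H * H) := hsw p.1 * tneg (u p.2) * k p.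
pose h2 (p : H * H) := hsw p.2 * tneg (u p.1) * k p.
have m1 : measurable_fun setT h1 by rewrite /h1 /k; mfun.
have m2 : measurable_fun setT h2 by rewrite /h2 /k; mfun.
have p1 p : 0 <= h1 p by rewrite mulr3_ge0 ?hsw_ge0 ?tneg_ge0 ?hkernel_ge0.
have p2 p : 0 <= h2 p by rewrite mulr3_ge0 ?hsw_ge0 ?tneg_ge0 ?hkernel_ge0.
have i1 : (\int[mu \x mu]_p (h1 p)%:E <= (hsolT * hsW)%:E)%E by exact: integral_half_le.
have i2 : (\int[mu \x mu]_p (h2 p)%:E <= (hsolT * hsW)%:E)%E.
  apply: le_trans i1; rewrite le_eqVlt; apply/orP; left; apply/eqP.
  have m2E : measurable_fun setT (fun p => (h2 p)%:E) by exact/measurable_EFinP.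
  have p2E p : (0 <= (h2 p)%:E)%E by rewrite lee_fin.
  apply: etrans (ge0_integral_hpair_swap m2E p2E) _; apply: eq_integral => -[x y] _.
  by rewrite /h1 /h2 /k/= hkernelC.
have -> : 2 * (hsolT * hsW) = 1 * (hsolT * hsW) + hsolT * hsW by ring.
apply: le_trans (ge0_integral_axpy_le ler01 m1 m2 p1 p2 i1 i2).
rewrite le_eqVlt; apply/orP; left; apply/eqP; apply: eq_integral => p _.
by rewrite /Y /h1 /h2; congr EFin; ring.
Qed.

Let k0 p : 0 <= k p. Proof. exact: hkernel_ge0. Qed.
Let mk : measurable_fun setT k. Proof. by rewrite /k; mfun. Qed.
Let mY : measurable_fun setT Y. Proof. by rewrite /Y; mfun. Qed.
Let Y0 p : 0 <= Y p.
Proof. by rewrite mulr_ge0// addr_ge0// mulr_ge0 ?tneg_ge0 ?hsw_ge0. Qed.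

Let key p := truncation_key (u p.1) (u p.2) (k0 p) (le0 p.1) (le0 p.2).

Let F1 (p : H * H) := (u p.1 - u p.2) * (hsw p.1 - hsw p.2) * k p.
Let iF1 : (mu \x mu)%E.-integrable setT (EFin \o F1).
Proof. exact: (integrable_energy mu_ mw Eu gagliardo2_hsw_fin). Qed.
Let F10 : (0 <= \int[mu \x mu]_p (F1 p)%:E)%E.
Proof.
apply: (test (K := l)) => //.
- exact: hsw_ge0.
- move=> x; apply: le_trans (hsw_le x) _.
  by rewrite ler_piMr// hbump_le1.
- exact: hsw_eq0.
- exact: gagliardo2_hsw_fin.
Qed.

Let Ceta0 : 0 <= Ceta (n := n) s (2 * r). Proof. exact: Ceta_ge0. Qed.

Let iF2 f : measurable_fun setT f -> (gagliardo2 s f < +oo)%E ->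
  (mu \x mu)%E.-integrable setT
    (EFin \o (fun p : H * H => l * ((f p.1 - f p.2) * (eta p.1 - eta p.2) * k p))).
Proof.
move=> mf Ef; exact: (integrableZl measurableT l (integrable_energy mf me Ef (gagliardo2_bump_fin x0 s01 r20))).
Qed.

Let F2_le f B : measurable_fun setT f -> (gagliardo2 s f < +oo)%E ->
  (hform s f eta <= B%:E)%E ->
  (\int[mu \x mu]_p (l * ((f p.1 - f p.2) * (eta p.1 - eta p.2) * k p))%:E <= (l * B)%:E)%E.
Proof.
move=> mf Ef fB; under eq_integral do rewrite EFinM.
rewrite (integralZl measurableT (integrable_energy mf me Ef (gagliardo2_bump_fin x0 s01 r20))).
by rewrite EFinM lee_wpmul2l// lee_fin.
Qed.

Lemma integral_hsa_hsw_le :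
  (\int[mu \x mu]_p ((hsa p.1 * hsw p.2 + hsa p.2 * hsw p.1) * k p)%:E <=
   (l * (Ceta (n := n) s (2 * r) * hsW) + 2 * (hsolT * hsW))%:E)%E.
Proof.
have f2 := F2_le mw gagliardo2_hsw_fin (_ : _ <= (Ceta (n := n) s (2 * r) * hsW)%:E)%E.
apply: (ge0_integral_le_addB _ _ iF1 (iF2 mw gagliardo2_hsw_fin) mY Y0 _ F10 (f2 _) integral_Y_le).
- by mfun.
- by move=> p; rewrite mulr_ge0// addr_ge0// mulr_ge0 ?hsa_ge0 ?hsw_ge0.
- move=> p; have [K1 _] := key p; apply: le_trans K1 _.
  rewrite /F1 /Y /hsw le_eqVlt; apply/orP; left; apply/eqP; ring.
- by rewrite EFinM -hsWE; exact: sup_w.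
Qed.

Lemma gagliardo2_hsp_le :
  (gagliardo2 s hsp <= (l * (Ceta (n := n) s (2 * r) * hsP) + 2 * (hsolT * hsW))%:E)%E.
Proof.
have f2 := F2_le mp gagliardo2_hsp_fin (_ : _ <= (Ceta (n := n) s (2 * r) * hsP)%:E)%E.
have -> : gagliardo2 s hsp = (\int[mu \x mu]_p ((hsp p.1 - hsp p.2) ^+ 2 * k p)%:E)%E.
  by apply: eq_integral => p _; congr (_ * _)%:E; rewrite real_normK ?num_real.
apply: (ge0_integral_le_addB _ _ iF1 (iF2 mp gagliardo2_hsp_fin) mY Y0 _ F10 (f2 _) integral_Y_le).
- by mfun.
- by move=> p; rewrite mulr_ge0 ?sqr_ge0.
- move=> p; have [_ K2] := key p; apply: le_trans K2 _.
  rewrite /F1 /Y /hsw /hsp le_eqVlt; apply/orP; left; apply/eqP; ring.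
- by rewrite EFinM -hsPE; exact: sup_p.
Qed.

Let B := hball x0 (2 * r).
Let IB (x : H) : R := \1_B x.
Let mIB : measurable_fun setT IB.
Proof. by apply: measurable_indic; exact: measurable_hball. Qed.
Let IB0 x : 0 <= IB x. Proof. by rewrite /IB indicE. Qed.
Let volB : R := hvol (n := n) * (2 * r) ^+ (2 * n + 2).
Let intIB : (\int[mu]_x (IB x)%:E <= volB%:E)%E.
Proof. by rewrite /IB /B integral_indic_hball. Qed.

Lemma hbump_le_indic x : l * eta x <= l * IB x.
Proof.
rewrite ler_wpM2l// /IB indicE; have [xB|xB] := ltP (hdist x x0) (2 * r).
  by rewrite mem_set// hbump_le1.
by rewrite hbump_eq0.
Qed.

(** Bounding [p] by [u_+] instead of by the level keeps the energy bound for [p] linear in [l], and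
    this is what produces the decay in [l] of the weak-type estimate. *)
Lemma hsP_le (N : R) : (\int[mu]_x (tpos (u x) * IB x)%:E <= N%:E)%E -> hsP <= N.
Proof.
move=> uN; rewrite -lee_fin -hsPE; apply: le_trans uN.
have mt : measurable_fun setT (@tpos R) by rewrite /tpos; mfun.
apply: ge0_le_integral_EFin; [exact: mp|by mfun|exact: hsp_ge0|move=> x].
rewrite /IB indicE; have [xB|xB] := ltP (hdist x x0) (2 * r).
  by rewrite mem_set// mulr1; exact: tmin_le_tpos.
rewrite (le_trans (hsp_le x))// hbump_eq0// mulr0.
by rewrite mulr_ge0 ?tpos_ge0.
Qed.

Lemma hsW_le : hsW <= l * volB.
Proof.
rewrite -lee_fin -hsWE; apply: le_trans (ge0_integralZ_le l0 mIB IB0 intIB).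
apply: ge0_le_integral_EFin; [exact: mw|by mfun|exact: hsw_ge0|move=> x].
exact: le_trans (hsw_le x) (hbump_le_indic x).
Qed.

Let kap : R := ((4 * r) `^ (hQ R n + 2 * s))^-1.
Let kap0 : 0 < kap. Proof. by rewrite invr_gt0 powR_gt0// mulr_gt0. Qed.

(** Two points of the ball of radius [2 r] are at distance at most [4 r], so the kernel is at least
    [kap], except at coinciding points, where it is 0; there [a w = 0] saves the inequality. *)
Lemma hsa_hsw_lower (p : H * H) : kap * (hsa p.1 * IB p.1 * hsw p.2) <=
  (hsa p.1 * hsw p.2 + hsa p.2 * hsw p.1) * k p.
Proof.
have [a1 w1] := (hsa_ge0 p.1, hsw_ge0 p.1).
have [a2 w2] := (hsa_ge0 p.2, hsw_ge0 p.2).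
have R0 : 0 <= (hsa p.1 * hsw p.2 + hsa p.2 * hsw p.1) * k p.
  by apply: mulr_ge0 (k0 p); apply: addr_ge0; apply: mulr_ge0.
rewrite /IB indicE; have [x1|x1] := ltP (hdist p.1 x0) (2 * r); last first.
  by rewrite memNset ?mulr0 ?mul0r ?mulr0// /B /hball/=; apply/negP; rewrite -leNgt.
rewrite mem_set// mulr1.
have [x2|x2] := ltP (hdist p.2 x0) (2 * r); last by rewrite (hsw_eq0 x2) !mulr0 in R0 *.
have [d0|d0] := eqVneq (hdist p.1 p.2) 0.
  have E : p.1 = p.2.
    by rewrite -[LHS](hmulVKg p.2) (hnorm_eq0 d0) hmul0r.
  have := tdefM0 (u p.2) (l * eta p.2); rewrite -[tdef _ _]/(hsw p.2) -[_ - _]/(hsa p.2).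
  rewrite -E => aw; rewrite aw mulr0.
  by rewrite addr0 mul0r.
have {}d0 : 0 < hnorm (hmul (hinv p.2) p.1).
  by rewrite lt_neqAle eq_sym d0 hnorm_ge0.
have d4 : hnorm (hmul (hinv p.2) p.1) <= 4 * r.
  have := hdist_triangle x0 p.1 p.2; rewrite (hdistC x0 p.2) /hdist -/(hdist p.1 x0) -/(hdist p.2 x0) => h.
  have <- : 2 * r + 2 * r = 4 * r by rewrite -mulrDl -natrD.
  exact: le_trans h (lerD (ltW x1) (ltW x2)).
have kk : kap <= k p by rewrite /k hkernelE; exact: (hker_ge s01 d0 d4).
rewrite mulrC; apply: ler_pM => //; first exact: mulr_ge0.
  exact: ltW.
by rewrite lerDl mulr_ge0.
Qed.

(** The lower bound on the double integral factors into [hsW] times the integral of [a], and the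
    upper bound is also a multiple of [hsW], so [hsW] can be divided out. Adding [p <= l] on the
    ball turns [a] into [u_+]. *)
Lemma integral_tpos_le : 0 < hsW ->
  (\int[mu]_x (tpos (u x) * IB x)%:E <=
   ((l * Ceta (n := n) s (2 * r) + 2 * hsolT) / kap + l * volB)%:E)%E.
Proof.
move=> W0.
pose g x := hsa x * IB x.
have mg : measurable_fun setT g by rewrite /g; mfun.
have g0 x : 0 <= g x by rewrite mulr_ge0 ?hsa_ge0.
have mt : measurable_fun setT (@tpos R) by rewrite /tpos; mfun.
have gle : (\int[mu]_x (g x)%:E <= ((l * Ceta (n := n) s (2 * r) + 2 * hsolT) / kap)%:E)%E.
  have h1 : (\int[mu \x mu]_p (kap * (g p.1 * hsw p.2))%:E <=
    (l * (Ceta (n := n) s (2 * r) * hsW) + 2 * (hsolT * hsW))%:E)%E.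
    apply: le_trans integral_hsa_hsw_le.
    apply: ge0_le_integral_EFin.
    - by mfun.
    - by mfun.
    - by move=> p; rewrite mulr_ge0 ?(ltW kap0)// mulr_ge0 ?hsw_ge0.
    - exact: hsa_hsw_lower.
  have mG : measurable_fun setT (fun p : H * H => (g p.1 * hsw p.2)%:E) by mfun.
  have G0 (p : H * H) : setT p -> (0 <= (g p.1 * hsw p.2)%:E)%E by rewrite lee_fin mulr_ge0 ?hsw_ge0.
  have kapE : (0 <= kap%:E)%E by rewrite lee_fin ltW.
  move: h1; under eq_integral do rewrite EFinM.
  rewrite (ge0_integralZl _ measurableT mG G0 kapE).
  rewrite (ge0_integral_sep mg mw g0 hsw_ge0) hsWE.
  have : (0 <= \int[mu]_x (g x)%:E)%E by apply: integral_ge0 => x _; rewrite lee_fin.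
  case: (\int[mu]_x (g x)%:E)%E => [c c0| _|//].
    rewrite -!EFinM !lee_fin ler_pdivlMr// => h.
    rewrite -(ler_pM2r W0); move: h; congr (_ <= _); ring.
  (* An infinite integral of [a] would contradict the finite upper bound, as [hsW] and [kap] are
     positive. *)
  by rewrite gt0_mulye ?lte_fin// gt0_muley ?lte_fin.
have m2 : measurable_fun setT (fun x => l * IB x) by mfun.
have p2 x : 0 <= l * IB x by rewrite mulr_ge0.
have := ge0_integral_axpy_le ler01 mg m2 g0 p2 gle (ge0_integralZ_le l0 mIB IB0 intIB).
rewrite mul1r; apply: le_trans; apply: ge0_le_integral_EFin; [by mfun|by mfun| |].
- by move=> x; rewrite mulr_ge0 ?tpos_ge0.
- move=> x; rewrite mul1r /g.
  have h := le_trans (hsp_le x) (hbump_le_indic x).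
  rewrite {1}(_ : tpos (u x) = hsa x + hsp x); last by rewrite /hsa subrK.
  rewrite mulrDl lerD2l; apply: le_trans h; rewrite -[leRHS]mulr1.
  by rewrite ler_wpM2l ?hsp_ge0// /IB indicE; case: (_ \in _).
Qed.

Lemma hsW0_ae : hsW = 0 -> {ae mu, forall x, hball x0 (3 * r / 2) x -> l / 2 <= u x}.
Proof.
move=> W0.
have mwE : measurable_fun setT (EFin \o hsw) by exact/measurable_EFinP.
have w_ae : ae_eq mu setT (EFin \o hsw) (cst 0%E).
  apply/(ae_eq_integral_abs mu measurableT mwE).
  under eq_integral do rewrite /= ger0_norm ?hsw_ge0//.
  by rewrite hsWE W0.
apply: filterS2 w_ae upos => x wx ux; rewrite /hball/= => xr.
have {}wx : hsw x = 0 by have /= [] := wx I.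
have xR : hdist x x0 < Rad.
  apply: lt_le_trans xr _; apply: le_trans rRad.
  by rewrite mulrAC ler_pM2r// (_ : 6 = 3 * 2)%R ?ler_pdivrMr ?ler_peMr// -?natrM ?ler_nat//; lra.
have {}ux := ux xR.
have e1 : 1 - (3 / 4) ^+ 4 <= eta x.
  apply: hbump_ge => //; apply: ltW; apply: lt_le_trans xr _.
  by rewrite le_eqVlt; apply/orP; left; apply/eqP; field.
have e2 : 2^-1 <= eta x by apply: le_trans e1; exact: half_le_quartic.
apply: le_trans (tdef_eq0_le wx ux).
exact: ler_wpM2l.
Qed.

End level.
End main_inequalities.

(** * A fractional Sobolev inequality *)

Lemma lee_half_addr (R : realType) (a : R) (x : \bar R) :
  (0 <= x -> a%:E <= x + (a / 2)%:E -> (a / 2)%:E <= x)%E.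
Proof.
case: x => [z _| |//]; last by move=> *; rewrite leey.
by rewrite -EFinD !lee_fin; lra.
Qed.

Lemma ge0_integral_combine_le d (T : measurableType d) (R : realType)
    (m : {measure set T -> \bar R}) (c e : R) (f g h : T -> R) : 0 <= c -> 0 <= e ->
  measurable_fun setT f -> measurable_fun setT g -> measurable_fun setT h ->
  (forall x, 0 <= f x) -> (forall x, 0 <= g x) -> (forall x, 0 <= h x) ->
  (forall x, c * f x <= g x + e * h x) ->
  (c%:E * \int[m]_x (f x)%:E <= \int[m]_x (g x)%:E + e%:E * \int[m]_x (h x)%:E)%E.
Proof.
move=> c0 e0 mf mg mh f0 g0 h0 fgh.
have mE (k : T -> R) : measurable_fun setT k -> measurable_fun setT (fun x => (k x)%:E).
  by move=> mk; exact/measurable_EFinP.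
have p0 (k : T -> R) : (forall x, 0 <= k x) -> forall x, setT x -> (0 <= (k x)%:E)%E.
  by move=> k0 x _; rewrite lee_fin.
have cE : (0 <= c%:E)%E by rewrite lee_fin.
have eE : (0 <= e%:E)%E by rewrite lee_fin.
rewrite -(ge0_integralZl _ measurableT (mE _ mf) (p0 _ f0) cE).
rewrite -(ge0_integralZl _ measurableT (mE _ mh) (p0 _ h0) eE).
have eh0 x : setT x -> (0 <= e%:E * (h x)%:E)%E by rewrite -EFinM lee_fin mulr_ge0.
rewrite -(ge0_integralD _ measurableT (p0 _ g0) (mE _ mg) eh0 (measurable_funeM _ (mE _ mh))).
apply: ge0_le_integral => //.
- by move=> x _; rewrite -EFinM lee_fin mulr_ge0.
- by apply: measurable_funeM; exact: mE.
- by apply: emeasurable_funD; [exact: mE|apply: measurable_funeM; exact: mE].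
- by move=> x _; rewrite -!EFinM -EFinD lee_fin.
Qed.

Lemma half_diff_le (R : realFieldType) (a b k k' : R) : 0 < a -> b < a / 2 ->
  0 <= k' -> k' <= k -> a ^+ 2 / 4 * k' <= `|a - b| ^+ 2 * k.
Proof.
move=> a0 ba k'0 kk; rewrite ler_pM// ?divr_ge0 ?sqr_ge0//.
rewrite (_ : a ^+ 2 / 4 = (a / 2) ^+ 2); last by field.
by rewrite ler_sqr ?nnegrE ?divr_ge0 ?(ltW a0)//; apply: le_trans (ler_norm _); lra.
Qed.

Lemma powR_half_ge1 (R : realType) (a b q : R) : 0 <= q -> 0 < a -> a / 2 <= b ->
  1 <= 2 `^ q / a `^ q * b `^ q.
Proof.
move=> q0 a0 ab; have b0 : 0 <= b by apply: le_trans ab; rewrite divr_ge0 ?ltW.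
rewrite mulrAC -powRM// ler_pdivlMr ?powR_gt0// mul1r.
by rewrite ge0_ler_powR ?nnegrE ?mulr_ge0 ?(ltW a0)//; lra.
Qed.

Lemma sobolev_exponent (R : fieldType) (Q s : R) : Q - 2 * s != 0 -> Q != 0 ->
  2 * (Q / (Q - 2 * s)) = 2 + 2 * (Q / (Q - 2 * s)) * (2 * s / Q).
Proof. by move=> h1 h2; field; rewrite ?h1 ?h2. Qed.

Lemma sobolev_exponent' (R : fieldType) (Q s : R) : Q - 2 * s != 0 -> Q != 0 ->
  (1 - 2 * s / Q) * (Q / (Q - 2 * s)) = 1.
Proof. by move=> h1 h2; field; rewrite ?h1 ?h2. Qed.

Section sobolev.
Context {R : realType} {n : nat}.
Local Notation H := (heis R n).
Local Notation mu := (@hleb R n).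
Variable s : R.
Hypothesis s01 : 0 < s < 1.
Local Notation Q := (hQ R n).
Local Notation om := (hvol (R := R) (n := n)).

(** Half of the Sobolev exponent [2 Q / (Q - 2 s)]. It is also the exponent of the weak-type
    estimate, hence the bound on [t]. *)
Definition hQ2 : R := Q / (Q - 2 * s).
Local Notation theta := hQ2.
Let q : R := 2 * theta.

Lemma hQ_gt2s : 0 < Q - 2 * s.
Proof.
have /andP[s0 s1] := s01; rewrite /hQ subr_gt0.
have : (2%:R : R) <= (2 * n + 2)%:R by rewrite ler_nat leq_addl.
lra.
Qed.

Lemma hQ_gt0 : 0 < Q. Proof. by rewrite /hQ ltr0n addn2. Qed.

Lemma hQ2_gt0 : 0 < theta. Proof. by rewrite divr_gt0 ?hQ_gt0 ?hQ_gt2s. Qed.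

Let q0 : 0 < q. Proof. by rewrite mulr_gt0 ?hQ2_gt0. Qed.

Definition hsobC : R := 8 / om * (2 `^ (q + 1) / om) `^ (2 * s / Q).

Lemma hsobC_ge0 : 0 <= hsobC.
Proof. by rewrite mulr_ge0 ?powR_ge0// divr_ge0// ltW// hvol_gt0. Qed.

Variable f : H -> R.
Hypothesis mf : measurable_fun setT f.
Hypothesis f0 : forall x, 0 <= f x.
Variable S : R.
Hypothesis SE : (\int[mu]_x (f x `^ q)%:E = S%:E)%E.
Hypothesis S0 : 0 < S.

Let F (x : H) := (\int[mu]_y (`|f x - f y| ^+ 2 * hkernel s x y)%:E)%E.

(* On at least half of the ball [B_rho(x)] with [|B_rho| = 2^(q+1) S / f(x)^q]
   one has [f <= f(x)/2], by Chebyshev's inequality. *)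
Lemma hedberg x : ((f x `^ q)%:E <= (hsobC * S `^ (2 * s / Q))%:E * F x)%E.
Proof.
have [s0 s1] := andP s01.
have om0 : 0 < om by exact: hvol_gt0.
have Q0 := hQ_gt0.
have F0 : (0 <= F x)%E.
  by apply: integral_ge0 => y _; rewrite lee_fin mulr_ge0 ?hkernel_ge0// exprn_ge0.
have [fx0|fx0] := eqVneq (f x) 0.
  rewrite fx0 powR0 ?gt_eqF// mule_ge0// lee_fin mulr_ge0 ?powR_ge0//.
  exact: hsobC_ge0.
have {}fx0 : 0 < f x by rewrite lt_neqAle eq_sym fx0 f0.
set a := f x in fx0 *.
pose V := 2 `^ (q + 1) * S / a `^ q.
have V0 : 0 < V by rewrite divr_gt0 ?powR_gt0// mulr_gt0 ?powR_gt0.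
pose rho := (V / om) `^ Q^-1.
have rho0 : 0 < rho by rewrite powR_gt0// divr_gt0.
have volB : om * rho ^+ (2 * n + 2) = V.
  rewrite powRX2 ?(ltW rho0)// -/(hQ R n) /rho -powRrM mulVf ?gt_eqF// powRr1; last first.
    by rewrite divr_ge0 ?ltW.
  by rewrite mulrCA mulfV ?mulr1// gt_eqF.
pose c := a ^+ 2 / 4 * (rho `^ (Q + 2 * s))^-1.
have c0 : 0 < c by rewrite mulr_gt0 ?divr_gt0 ?exprn_gt0// invr_gt0 powR_gt0.
(* Chosen so that [d f^q >= c] wherever [f >= a / 2], and so that [d S = c V / 2]: integrating [pt]
   then leaves half of [c V] for [F x]. *)
pose d := c * (2 `^ q / a `^ q).
have d0 : 0 <= d by rewrite mulr_ge0 ?(ltW c0)// divr_ge0 ?powR_ge0.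
pose G y := `|a - f y| ^+ 2 * hkernel s x y.
have G0 y : 0 <= G y by rewrite mulr_ge0 ?hkernel_ge0// exprn_ge0.
have mG : measurable_fun setT G by rewrite /G; mfun.
have mfq : measurable_fun setT (fun y => f y `^ q) by mfun.
have fq0 y : 0 <= f y `^ q by exact: powR_ge0.
have mI : measurable_fun setT (\1_(hball x rho) : H -> R).
  by apply: measurable_indic; exact: measurable_hball.
have I0 y : 0 <= \1_(hball x rho) y :> R by rewrite indicE.
have pt y : c * \1_(hball x rho) y <= G y + d * f y `^ q.
  have dfy0 : 0 <= d * f y `^ q by exact: mulr_ge0.
  rewrite indicE; have [yB|yB] := ltP (hdist y x) rho; last first.
    have yN : ~ hball x rho y by rewrite /hball/=; apply/negP; rewrite -leNgt.
    rewrite (memNset yN) mulr0; exact: addr_ge0 (G0 y) dfy0.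
  rewrite (mem_set (yB : hball x rho y)) mulr1; have [fy|fy] := ltP (f y) (a / 2).
    apply: (ler_wpDr dfy0); apply: (half_diff_le fx0 fy).
    - by rewrite invr_ge0 powR_ge0.
    - rewrite hkernelC hkernelE; apply: (hker_ge s01) (ltW yB).
      rewrite lt_neqAle hnorm_ge0 andbT eq_sym; apply/eqP => yx.
      have E : y = x by rewrite -[LHS](hmulVKg x) (hnorm_eq0 yx) hmul0r.
      move: fy; rewrite E -/a ltNge => /negP; apply.
      by rewrite ler_pdivrMr// ler_pMr// ler1n.
  apply: (ler_wpDl (G0 y)); rewrite -[c in leLHS]mulr1 /d -mulrA.
  by apply: (ler_wpM2l (ltW c0)); exact: powR_half_ge1 (ltW q0) fx0 fy.
have int : ((c * V / 2)%:E <= F x)%E.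
  have := ge0_integral_combine_le mu (ltW c0) d0 mI mG mfq I0 G0 fq0 pt.
  rewrite integral_indic_hball// volB SE -/(F x) -!EFinM.
  have -> : d * S = c * V / 2.
    by rewrite /V /d powRDp// powRr1//; field; rewrite gt_eqF// powR_gt0.
  exact: lee_half_addr.
have const0 : (0 <= (hsobC * S `^ (2 * s / Q))%:E)%E.
  by rewrite lee_fin mulr_ge0 ?powR_ge0// hsobC_ge0.
apply: le_trans (lee_wpmul2l const0 int); rewrite -EFinM lee_fin.
pose b := 2 * s / Q; rewrite -/b.
have Qs := hQ_gt2s.
pose A := a `^ q; pose X := V / om; pose T := 2 `^ (q + 1) / om.
have A0 : 0 < A by exact: powR_gt0.
have X0 : 0 < X by rewrite divr_gt0.
have T0 : 0 < T by rewrite divr_gt0// powR_gt0.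
have e1 : rho `^ (Q + 2 * s) = X * X `^ b.
  rewrite powRDp// /rho -!powRrM mulVf ?gt_eqF// powRr1 ?(ltW X0)//.
  by congr (_ * _ `^ _); rewrite /b mulrC.
have e2 : X `^ b * A `^ b = T `^ b * S `^ b.
  rewrite -!powRM ?(ltW X0) ?(ltW A0) ?(ltW T0) ?(ltW S0)//; congr (_ `^ _).
  by rewrite /X /V /T -/A; field; rewrite !gt_eqF.
(* Since [q = 2 + q b], there is a factor [A^b] left over to combine with the [X^b] coming from the
   kernel, and [X A = T S] no longer depends on [x]. *)
have e3 : A = a ^+ 2 * A `^ b.
  rewrite /A (powRX2 2 (ltW fx0)) -powRrM -powRDp//; congr (_ `^ _).
  exact: sobolev_exponent (lt0r_neq0 Qs) (lt0r_neq0 Q0).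
rewrite -/A /hsobC -/b -/T /c e1.
have -> : V = X * om by rewrite /X divfK// gt_eqF.
rewrite -[leRHS]/(_ * (_ * _ / 2)) -(mulrA (8 / om)) -e2 [leLHS]e3.
rewrite le_eqVlt; apply/orP; left; apply/eqP.
by field; rewrite !gt_eqF// powR_gt0.
Qed.

(** Integrating [hedberg] in [x] gives [S <= hsobC S^(2s/Q) D]. As [S] is finite and positive, its
    power can be divided out, and [1 - 2 s / Q] is the inverse of [theta]. *)
Lemma sobolev_le (D : R) : (gagliardo2 s f <= D%:E)%E -> S <= (hsobC * D) `^ theta.
Proof.
move=> fD; have [s0 s1] := andP s01; have Q0 := hQ_gt0; have Qs := hQ_gt2s.
pose b := 2 * s / Q.
have mG : measurable_fun setT (fun p : H * H => (`|f p.1 - f p.2| ^+ 2 * hkernel s p.1 p.2)%:E) by mfun.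
have G0 (p : H * H) : (0 <= (`|f p.1 - f p.2| ^+ 2 * hkernel s p.1 p.2)%:E)%E.
  by rewrite lee_fin mulr_ge0 ?hkernel_ge0// exprn_ge0.
have FE : (\int[mu]_x F x <= D%:E)%E.
  apply: le_trans fD; rewrite le_eqVlt; apply/orP; left; apply/eqP.
  exact: (esym (fubini_tonelli1 _ mG G0)).
have mF : measurable_fun setT F.
  exact: (measurable_fun_fubini_tonelli_F (m2 := mu) _ mG G0).
have F0 x : setT x -> (0 <= F x)%E.
  by move=> _; apply: integral_ge0 => y _; exact: (G0 (x, y)).
have c0 : (0 <= (hsobC * S `^ b)%:E)%E by rewrite lee_fin mulr_ge0 ?powR_ge0// hsobC_ge0.
have D0 : 0 <= D.
  by rewrite -lee_fin (le_trans _ FE)// integral_ge0.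
have : S <= hsobC * S `^ b * D.
  rewrite -lee_fin -SE EFinM; apply: le_trans (lee_wpmul2l c0 FE).
  rewrite -(ge0_integralZl _ measurableT mF F0 c0); apply: ge0_le_integral => //.
  - by move=> x _; rewrite lee_fin powR_ge0.
  - by mfun.
  - exact: measurable_funeM.
  - by move=> x _; exact: hedberg.
have Sb0 : 0 < S `^ b by rewrite powR_gt0.
have -> : hsobC * S `^ b * D = hsobC * D * S `^ b by ring.
rewrite -ler_pdivrMr// => h.
have E : S = (S / S `^ b) `^ theta.
  rewrite -{2}(powRr1 (ltW S0)) -powRN -powRDp// -powRrM.
  rewrite (_ : _ * _ = 1) ?powRr1 ?(ltW S0)//.
  exact: sobolev_exponent' (lt0r_neq0 Qs) (lt0r_neq0 Q0).
rewrite {1}E; apply: ge0_ler_powR => //.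
- exact/ltW/hQ2_gt0.
- by rewrite nnegrE divr_ge0// ltW.
- by rewrite nnegrE mulr_ge0// hsobC_ge0.
Qed.
End sobolev.

(** * The weak Harnack inequality *)

Section constants.
Context {R : realType}.
Variables (n : nat) (s : R).
Hypothesis s01 : 0 < s < 1.
Local Notation Q := (hQ R n).
Local Notation om := (hvol (R := R) (n := n)).
Local Notation theta := (hQ2 (n := n) s).

Definition cT : R := (3 / 2) `^ (Q + 2 * s).
Definition cK : R := 4 `^ (Q + 2 * s).
Definition cE : R := 32 * (2 `^ (- (2 * s)) * hTheta (n := n) s).
Definition cV : R := om * 2 ^+ (2 * n + 2).
(** If [E] bounds the infimum and [r^(2s)] times the tail integral, then [cN E r^Q] bounds the
    integral of [u_+] over the ball of radius [2 r], [cD l E r^(Q-2s)] the energy of [p] at level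
    [l], and [cW r^Q (E/l)^theta] the measure of the part of the ball of radius [r] where
    [u >= l]. *)
Definition cN : R := (2 * cE + 2 * cT) * cK + 2 * cV.
Definition cD : R := cE * cN + 2 * cT * cV.
Definition cW : R := 2 `^ (2 * theta) * (hsobC (n := n) s * cD) `^ theta.

Lemma cT_gt0 : 0 < cT. Proof. by rewrite powR_gt0// divr_gt0. Qed.
Lemma cK_gt0 : 0 < cK. Proof. by rewrite powR_gt0. Qed.
Lemma cE_ge0 : 0 <= cE. Proof. by rewrite !mulr_ge0 ?powR_ge0 ?hTheta_ge0. Qed.
Lemma cV_gt0 : 0 < cV. Proof. by rewrite mulr_gt0 ?hvol_gt0// exprn_gt0. Qed.
Lemma cN_ge0 : 0 <= cN.
Proof.
have cv := ltW cV_gt0; have ct := ltW cT_gt0; have ck := ltW cK_gt0; have ce := cE_ge0.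
rewrite /cN; move: cV cT cK cE cv ct ck ce => v t k e v0 t0 k0 e0.
by rewrite addr_ge0 ?mulr_ge0 ?addr_ge0 ?mulr_ge0.
Qed.
Lemma cD_ge0 : 0 <= cD.
Proof.
have cv := ltW cV_gt0; have ct := ltW cT_gt0; have cn := cN_ge0; have ce := cE_ge0.
rewrite /cD; move: cV cT cN cE cv ct cn ce => v t k e v0 t0 k0 e0.
by rewrite addr_ge0 ?mulr_ge0.
Qed.
Lemma cW_ge0 : 0 <= cW. Proof. by rewrite mulr_ge0 ?powR_ge0. Qed.

Variable r : R.
Hypothesis r0 : 0 < r.

Lemma Ceta2r : Ceta (n := n) s (2 * r) = cE / r `^ (2 * s).
Proof. by rewrite /Ceta /cE powRM ?(ltW r0)// [r `^ _]powRN; ring. Qed.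

Lemma kap4r : ((4 * r) `^ (Q + 2 * s))^-1 = (cK * (r `^ Q * r `^ (2 * s)))^-1.
Proof. by rewrite powRM ?(ltW r0)// (powRDp Q _ r0). Qed.

Lemma vol2r : om * (2 * r) ^+ (2 * n + 2) = cV * r `^ Q.
Proof. by rewrite exprMn mulrA -(powRX2 _ (ltW r0)). Qed.

Lemma rQ_theta (a : R) : 0 <= a -> (a * (r `^ Q / r `^ (2 * s))) `^ theta = a `^ theta * r `^ Q.
Proof.
move=> a0; rewrite -powRN -powRDp// powRM ?powR_ge0// -powRrM; congr (_ * _ `^ _).
by rewrite /hQ2 mulrC divfK// gt_eqF// hQ_gt2s.
Qed.
End constants.

Lemma superlevel_bound (R : realType) (m a l th r E : R) : 0 <= a -> 0 < l ->
  0 <= E -> 0 <= r ->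
  m * (l / 2) `^ (2 * th) <= (a * (l * E)) `^ th * r ->
  m <= 2 `^ (2 * th) * a `^ th * r * (E / l) `^ th.
Proof.
move=> a0 l0 E0 r0; have lq0 : 0 < l `^ th by exact: powR_gt0.
have q0 : 0 < (l / 2) `^ (2 * th) by rewrite powR_gt0// divr_gt0.
rewrite -ler_pdivlMr// => /le_trans; apply.
rewrite ler_pdivrMr// !powRM ?mulr_ge0 ?invr_ge0 ?(ltW l0)//.
have -> : l `^ (2 * th) = l `^ th * l `^ th by rewrite mulr_natl mulr2n powRDp.
have e2 (x : R) : 0 < x -> x^-1 `^ th * x `^ th = 1.
  by move=> x0; rewrite -powRM ?invr_ge0 ?(ltW x0)// mulVf ?gt_eqF// powR1.
have e3 : 2^-1 `^ (2 * th) * 2 `^ (2 * th) = 1 :> R.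
  by rewrite -powRM ?invr_ge0// mulVf// powR1.
rewrite le_eqVlt; apply/orP; left; apply/eqP.
have -> : 2 `^ (2 * th) * a `^ th * r * (E `^ th * l^-1 `^ th) *
    (l `^ th * l `^ th * 2^-1 `^ (2 * th)) =
   (2^-1 `^ (2 * th) * 2 `^ (2 * th)) * (l^-1 `^ th * l `^ th) * (a `^ th * r * E `^ th * l `^ th) by ring.
by rewrite e2// e3; ring.
Qed.

Lemma half_le_quartic2 (R : realFieldType) : 2^-1 <= 1 - 2^-1 ^+ 4 :> R.
Proof. by rewrite !exprS expr0; lra. Qed.

Lemma pow2B_exprn (R : realType) (a b : R) j :
  (2 `^ (a - b)) ^+ j = (2 ^+ j) `^ a * ((2 ^+ j) `^ b)^-1.
Proof.
have j0 : 0 < 2 ^+ j :> R by exact: exprn_gt0.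
have E : 2 ^+ j = 2 `^ j%:R :> R by rewrite powR_mulrn.
apply: etrans (esym (powR_mulrn j (powR_ge0 2 (a - b)))) _.
rewrite -powRN -(powRDp _ _ j0) E -!powRrM.
by rewrite mulrC.
Qed.

Lemma mean_root_le (R : realType) (om M E t r X : R) : 0 < om -> 0 < r ->
  0 <= M -> 0 < E -> 0 < t -> 0 <= X -> X <= M * E `^ t * r ->
  ((om * r)^-1 * X) `^ t^-1 <= (M / om) `^ t^-1 * E.
Proof.
move=> om0 r0 M0 E0 t0 X0 XM; have omr0 : 0 < om * r by rewrite mulr_gt0.
have Mo : 0 <= M / om by rewrite divr_ge0// ltW.
have <- : (E `^ t) `^ t^-1 = E by rewrite -powRrM mulfV ?gt_eqF// powRr1// ltW.
rewrite -powRM ?powR_ge0//; apply: ge0_ler_powR.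
- by rewrite invr_ge0 ltW.
- by rewrite nnegrE mulr_ge0 ?invr_ge0 ?(ltW omr0).
- by rewrite nnegrE mulr_ge0 ?powR_ge0.
- rewrite ler_pdivrMl//; apply: le_trans XM _.
  by rewrite le_eqVlt; apply/orP; left; apply/eqP; field; rewrite gt_eqF.
Qed.

(** * The weak-type estimate and its dyadic summation *)

Section weak_type.
Context {R : realType} {n : nat}.
Local Notation H := (heis R n).
Local Notation mu := (@hleb R n).
Local Notation Q := (hQ R n).
Variables (s : R) (x0 : H) (r Rad I0 E : R) (u : H -> R).
Hypothesis s01 : 0 < s < 1.
Hypothesis r0 : 0 < r.
Hypothesis rRad : 6 * r <= Rad.
Hypothesis mu_ : measurable_fun setT u.
Hypothesis Eu : (gagliardo2 s u < +oo)%E.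
Hypothesis upos : {ae mu, forall x, hball x0 Rad x -> 0 <= u x}.
Hypothesis test : forall (w : H -> R) (K : R), measurable_fun setT w ->
  (forall x, 0 <= w x) -> (forall x, w x <= K) ->
  (forall x, 2 * r <= hdist x x0 -> w x = 0) -> (gagliardo2 s w < +oo)%E ->
  (0 <= hform s u w)%E.
Hypothesis I0E :
  (\int[mu]_(y in ~` hball x0 Rad) (tneg (u y) * hkernel s x0 y)%:E = I0%:E)%E.
Hypothesis E0 : 0 < E.
Hypothesis infE : ~ {ae mu, forall x, hball x0 (3 * r / 2) x -> E <= u x}.
Hypothesis tailE : r `^ (2 * s) * I0 <= E.

Let B := hball x0 (2 * r).
Let rs := r `^ (2 * s).
Let rQ := r `^ Q.
Let rs0 : 0 < rs. Proof. exact: powR_gt0. Qed.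
Let rQ0 : 0 < rQ. Proof. exact: powR_gt0. Qed.
Let Te : hsolT (n := n) s I0 <= cT n s * E / rs.
Proof.
rewrite /hsolT -/(cT n s) -mulrA ler_wpM2l ?(ltW (cT_gt0 _ _))//.
by rewrite ler_pdivlMr// mulrC.
Qed.

Let hsW_ge0 l : 0 <= hsW x0 r u l.
Proof. by apply: fine_ge0; apply: integral_ge0 => x _; rewrite lee_fin hsw_ge0. Qed.

(** The level is [2 E]: were [w] zero almost everywhere, [u >= E] would hold almost everywhere on
    the ball of radius [3 r / 2], against [infE]. So [hsW > 0], and the bound on the integral of
    [u_+] applies. *)
Lemma integral_tpos_bound :
  (\int[mu]_x (tpos (u x) * \1_B x)%:E <= (cN n s * E * rQ)%:E)%E.
Proof.
have l0 : 0 <= 2 * E by rewrite mulr_ge0 ?ltW.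
have W0 : 0 < hsW x0 r u (2 * E).
  rewrite lt_neqAle; apply/andP; split.
    apply/eqP => W0; apply: infE.
    have := hsW0_ae r0 rRad mu_ upos l0 (esym W0).
    by rewrite [2 * E]mulrC mulfK.
  exact: hsW_ge0.
apply: le_trans (integral_tpos_le s01 r0 rRad mu_ Eu upos test I0E l0 W0) _.
rewrite lee_fin kap4r// invrK vol2r// Ceta2r// -/rs -/rQ.
have cK0 := cK_gt0 n s.
apply: (@le_trans _ _ ((2 * E * (cE n s / rs) + 2 * (cT n s * E / rs)) * (cK n s * (rQ * rs)) +
    2 * E * (cV (R := R) n * rQ))).
  rewrite lerD2r ler_wpM2r ?mulr_ge0 ?(ltW cK0) ?(ltW rQ0) ?(ltW rs0)//.
  by rewrite lerD2l ler_wpM2l.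
rewrite /cN le_eqVlt; apply/orP; left; apply/eqP; field.
by rewrite gt_eqF.
Qed.

Lemma gagliardo2_hsp_bound l : 0 <= l ->
  (gagliardo2 s (hsp x0 r u l) <= (cD n s * (l * E) * (rQ / rs))%:E)%E.
Proof.
move=> l0; apply: le_trans (gagliardo2_hsp_le s01 r0 rRad mu_ Eu upos test I0E l0) _.
rewrite lee_fin Ceta2r// -/rs.
have P := hsP_le r0 mu_ l0 integral_tpos_bound.
have := hsW_le x0 r0 mu_ l0; rewrite vol2r// -/rQ => W.
have W0 := hsW_ge0 l.
apply: (@le_trans _ _ (l * (cE n s / rs * (cN n s * E * rQ)) + 2 * (cT n s * E / rs * (l * (cV (R := R) n * rQ))))).
  apply: lerD.
    by rewrite ler_wpM2l// ler_wpM2l// divr_ge0 ?cE_ge0// ltW.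
  by rewrite ler_wpM2l// ler_pM// (hsolT_ge0 I0E).
rewrite /cD le_eqVlt; apply/orP; left; apply/eqP; field.
by rewrite gt_eqF.
Qed.

Lemma measurable_superlevel l : measurable (hball x0 r `&` [set x | l <= u x]).
Proof.
apply: measurableI; first exact: measurable_hball.
rewrite -[X in measurable X]setTI.
rewrite (_ : [set x | l <= u x] = u @^-1` `[l, +oo[%classic); first exact: mu_.
by apply/seteqP; split => x /=; rewrite in_itv/= andbT.
Qed.

Lemma weak_type l : 0 < l ->
  (mu (hball x0 r `&` [set x | (l <= u x)%R]) <= (cW n s * rQ * (E / l) `^ hQ2 (n := n) s)%:E)%E.
Proof.
move=> l0; set A := (_ `&` _); pose th := hQ2 (n := n) s.
have th0 : 0 < th by exact: hQ2_gt0.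
have q0 : 0 < 2 * th by rewrite mulr_gt0.
pose p := hsp x0 r u l.
have mp : measurable_fun setT p by exact: measurable_hsp.
have p0 x : 0 <= p x by exact: hsp_ge0 (ltW l0) x.
have mA : measurable A by exact: measurable_superlevel.
have mIA : measurable_fun setT (\1_A : H -> R) by exact: measurable_indic.
have r20 : 0 < 2 * r by rewrite mulr_gt0.
have mq : measurable_fun setT (fun x => p x `^ (2 * th)) by mfun.
have q0' x : 0 <= p x `^ (2 * th) by exact: powR_ge0.
have pl x : p x <= l * \1_(hball x0 (2 * r)) x by apply: le_trans (hbump_le_indic x0 r0 (ltW l0) x); exact: hsp_le.
have Sfin : (\int[mu]_x (p x `^ (2 * th))%:E < +oo)%E.
  have qk x : p x `^ (2 * th) <= l `^ (2 * th).
    apply: ge0_ler_powR; rewrite ?nnegrE ?(ltW q0) ?(ltW l0)//.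
    by apply: le_trans (pl x) _; rewrite indicE; case: (_ \in _); rewrite ?mulr1// mulr0 ltW.
  have qs x : 2 * r <= hdist x x0 -> p x `^ (2 * th) = 0.
    move=> xr; have -> : p x = 0.
      apply/eqP; rewrite eq_le p0 andbT; apply: le_trans (pl x) _.
      rewrite indicE memNset ?mulr0//.
      by rewrite /hball/=; apply/negP; rewrite -leNgt.
    by rewrite powR0// gt_eqF.
  exact: le_lt_trans (integral_supp_le r20 mq q0' qk qs) (ltry _).
pose S := fine (\int[mu]_x (p x `^ (2 * th))%:E)%E.
have I0' : (0 <= \int[mu]_x (p x `^ (2 * th))%:E)%E.
  by apply: integral_ge0 => x _; rewrite lee_fin.
have SE : (\int[mu]_x (p x `^ (2 * th))%:E = S%:E)%E by rewrite fineK// ge0_fin_numE.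
have D0 : 0 <= cD n s * (l * E) * (rQ / rs).
  by rewrite !mulr_ge0 ?cD_ge0 ?invr_ge0 ?(ltW l0) ?(ltW E0) ?(ltW rQ0) ?(ltW rs0).
have sob : S <= (hsobC (n := n) s * (cD n s * (l * E) * (rQ / rs))) `^ th.
  (* The Sobolev inequality divides by a power of [S], so [S = 0] is treated apart. *)
  have [S0|S0] := leP S 0; first exact: le_trans S0 (powR_ge0 _ _).
  exact: (sobolev_le s01 mp p0 SE S0 (gagliardo2_hsp_bound (ltW l0))).
(* On the ball of radius [r], half the radius of the bump, [eta >= 1 - 1/16]. Hence [p >= l / 2]
   where [u >= l], and Chebyshev's inequality follows. *)
have lower x : (l / 2) `^ (2 * th) * \1_A x <= p x `^ (2 * th).
  rewrite indicE; have [/set_mem[xr ux]|xA] := boolP (x \in A); last by rewrite mulr0.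
  rewrite mulr1; apply: ge0_ler_powR; rewrite ?nnegrE ?(ltW q0) ?divr_ge0 ?(ltW l0)//.
  have e1 : 1 - 2^-1 ^+ 4 <= hbump x0 (2 * r) x.
    by apply: hbump_ge => //; rewrite mulrA mulVf// mul1r; exact: ltW.
  have e2 : 2^-1 <= hbump x0 (2 * r) x.
    by apply: le_trans e1; exact: half_le_quartic2.
  rewrite /p /hsp /tmin le_min; apply/andP; split.
    rewrite /tpos le_max; apply/orP; left; apply: le_trans ux.
    by rewrite ler_pdivrMr// ler_pMr// ler1n.
  by rewrite ler_pM2l.
have cheb : (((l / 2) `^ (2 * th))%:E * mu A <= S%:E)%E.
  have k0 : (0 <= ((l / 2) `^ (2 * th))%:E)%E by rewrite lee_fin powR_ge0.
  have mIE : measurable_fun setT (fun x : H => (\1_A x : R)%:E) by exact/measurable_EFinP.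
  have IE0 x : setT x -> (0 <= (\1_A x : R)%:E)%E by rewrite lee_fin indicE.
  rewrite -SE -[A in mu A]setIT -(integral_indic mu measurableT mA).
  rewrite -(ge0_integralZl _ measurableT mIE IE0 k0).
  apply: ge0_le_integral => //.
  - by move=> x _; apply: mule_ge0 => //; exact: IE0.
  - exact: measurable_funeM.
  - exact/measurable_EFinP.
  - by move=> x _; rewrite -EFinM lee_fin.
have mufin : (mu A < +oo)%E.
  apply: (@le_lt_trans _ _ (mu (hball x0 r))).
    by apply: le_measure; rewrite ?inE//; [exact: measurable_hball|apply: subIsetl].
  by rewrite mu_hball// ltry.
have muE : mu A = (fine (mu A))%:E by rewrite fineK// ge0_fin_numE.
rewrite muE in cheb *; rewrite -EFinM lee_fin in cheb; rewrite lee_fin.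
have -> : cW n s * rQ * (E / l) `^ th =
    2 `^ (2 * th) * (hsobC (n := n) s * cD n s) `^ th * rQ * (E / l) `^ th by [].
have CD0 : 0 <= hsobC (n := n) s * cD n s by rewrite mulr_ge0 ?hsobC_ge0 ?cD_ge0.
apply: superlevel_bound (l0) _ _ _ => //; rewrite ?(ltW E0) ?(ltW rQ0)//.
rewrite mulrC; apply: le_trans cheb _; apply: le_trans sob _.
have -> : hsobC (n := n) s * (cD n s * (l * E) * (rQ / rs)) =
   (hsobC (n := n) s * cD n s * (l * E)) * (rQ / rs) by ring.
by rewrite /rQ /rs rQ_theta// mulr_ge0// mulr_ge0 ?(ltW l0) ?(ltW E0).
Qed.
Variable t : R.
Hypothesis t0 : 0 < t.
Hypothesis tth : t < hQ2 (n := n) s.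

(** The sum of the geometric series of ratio [2^(t - theta)], convergent because [t < theta]. The
    volume of the unit ball is added to [cW] to cover the first dyadic piece, which is the whole
    ball. *)
Definition cM : R := 2 `^ t * (cW n s + hvol (n := n)) / (1 - 2 `^ (t - hQ2 (n := n) s)).

Let om := hvol (R := R) (n := n).
Let om0 : 0 < om. Proof. exact: hvol_gt0. Qed.

Lemma cM_ge0 : 0 <= cM.
Proof.
rewrite /cM; have cw := cW_ge0 n s.
apply: divr_ge0; first by rewrite mulr_ge0 ?powR_ge0// addr_ge0// ltW// hvol_gt0.
by rewrite subr_ge0 ltW// -(opprB (hQ2 s)) pow2N_lt1// subr_gt0.
Qed.

Lemma integral_powR_le :
  (\int[mu]_(x in hball x0 r) (tpos (u x) `^ t)%:E <= (cM * E `^ t * rQ)%:E)%E.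
Proof.
pose th := hQ2 (n := n) s.
have cw := cW_ge0 n s.
(* For [j = 0] no superlevel set is imposed, since [u] may lie below [E]; this index also serves
   points with [E <= u < 2 E]. For [j >= 1] the points with [2^j E <= u < 2^(j+1) E] lie in [A j],
   where [c j] bounds the integrand. *)
pose A (j : nat) : set H := if j is 0 then hball x0 r
  else hball x0 r `&` [set x | E * 2 ^+ j <= u x].
pose c (j : nat) : R := (E * 2 ^+ j.+1) `^ t.
pose q : R := 2 `^ (t - th).
pose Bc : R := 2 `^ t * (cW n s + om) * E `^ t * rQ.
have -> : cM * E `^ t * rQ = Bc / (1 - q) by rewrite /cM /Bc -/om -/th -/q; ring.
have q1 : 0 <= q < 1.
  by rewrite powR_ge0 /q -(opprB th) pow2N_lt1// subr_gt0.
have q_j j : q ^+ j = (2 ^+ j) `^ t * ((2 ^+ j) `^ th)^-1 by exact: pow2B_exprn.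
have cE_ j : c j = E `^ t * (2 `^ t * (2 ^+ j) `^ t).
  by rewrite /c exprS !powRM ?(ltW E0) ?mulr_ge0 ?exprn_ge0.
have mt : measurable_fun setT (@tpos R) by rewrite /tpos; mfun.
have mA j : measurable (A j).
  by case: j => [|j]; [exact: measurable_hball|exact: measurable_superlevel].
have muA j : (mu (A j) <= ((cW n s + om) * rQ * ((2 ^+ j) `^ th)^-1)%:E)%E.
  case: j => [|j].
    rewrite /A mu_hball// lee_fin expr0 powR1 invr1 mulr1.
    by rewrite (powRX2 _ (ltW r0)) -/rQ ler_pM2r// lerDr.
  have El : 0 < E * 2 ^+ j.+1 by rewrite mulr_gt0 ?exprn_gt0.
  apply: le_trans (weak_type El) _; rewrite lee_fin.
  have -> : E / (E * 2 ^+ j.+1) = (2 ^+ j.+1)^-1.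
    by rewrite invfM mulrA mulfV ?mul1r// gt_eqF.
  have -> : ((2 ^+ j.+1)^-1) `^ th = ((2 ^+ j.+1) `^ th)^-1 :> R.
    by rewrite -powR_inv1 ?exprn_ge0// -powRrM mulN1r powRN.
  by rewrite ler_wpM2r ?invr_ge0 ?powR_ge0// ler_wpM2r ?(ltW rQ0)// lerDl ltW.
apply: (@dyadic_integral _ _ _ mu (hball x0 r) (fun x => tpos (u x) `^ t) A c Bc q _ _ _ mA _ _ _ q1).
- exact: measurable_hball.
- by apply: measurable_funTS; mfun.
- by move=> x _; exact: powR_ge0.
- by move=> j; exact: powR_ge0.
- move=> x xr; have [uE|uE] := ltP (tpos (u x)) E.
    exists 0; split=> //; rewrite /c expr1.
    apply: ge0_ler_powR; rewrite ?nnegrE ?tpos_ge0 ?mulr_ge0 ?(ltW t0) ?(ltW E0)//.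
    by apply: le_trans (ltW uE) _; rewrite ler_peMr ?(ltW E0)// ler1n.
  have u1 : 1 <= tpos (u x) / E by rewrite ler_pdivlMr// mul1r.
  have [j /andP[j1 j2]] := dyadic_ex u1.
  exists j; split.
    case: j j1 j2 => [//|j] j1 _; split=> //=.
    have : E * 2 ^+ j.+1 <= tpos (u x) by rewrite mulrC -ler_pdivlMr.
    by rewrite /tpos le_max => /orP[//|]; rewrite leNgt mulr_gt0 ?exprn_gt0.
  apply: ge0_ler_powR; rewrite ?nnegrE ?tpos_ge0 ?(ltW t0)//.
    by rewrite mulr_ge0 ?(ltW E0) ?exprn_ge0.
  by rewrite mulrC -ler_pdivrMr// ltW.
- move=> j; apply: le_trans (_ : (c j)%:E * ((cW n s + om) * rQ * ((2 ^+ j) `^ th)^-1)%:E <= _)%E.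
    by apply: lee_wpmul2l (muA j); rewrite lee_fin powR_ge0.
  rewrite -EFinM lee_fin cE_ q_j /Bc le_eqVlt; apply/orP; left; apply/eqP; ring.
Qed.

Lemma power_mean_le :
  (power_mean t (hball x0 r) u <= ((cM / om) `^ t^-1 * E)%:E)%E.
Proof.
have mB : measurable (hball x0 r) by exact: measurable_hball.
have cM0 := cM_ge0.
have mt : measurable_fun setT (@tpos R) by rewrite /tpos; mfun.
have rR : r <= Rad by apply: le_trans rRad; rewrite ler_peMl ?(ltW r0)// ler1n.
have XE : (\int[mu]_(x in hball x0 r) (u x `^ t)%:E =
    \int[mu]_(x in hball x0 r) (tpos (u x) `^ t)%:E)%E.
  apply: ae_eq_integral => //.
  - by apply: measurable_funTS; mfun.
  - by apply: measurable_funTS; mfun.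
  - apply: filterS upos => x ux xr; rewrite /tpos (max_idPl _)//.
    by apply: ux; exact: lt_le_trans xr rR.
rewrite /power_mean XE mu_hball// (powRX2 _ (ltW r0)) -/(hQ R n) -/rQ -/om.
have X0 : (0 <= \int[mu]_(x in hball x0 r) (tpos (u x) `^ t)%:E)%E.
  by apply: integral_ge0 => x _; rewrite lee_fin powR_ge0.
have Xle := integral_powR_le.
have omr0 : 0 < om * rQ by rewrite mulr_gt0.
rewrite inver gt_eqF//.
set X := (\int[mu]_(x in _) _)%E in X0 Xle *.
have XE' : X = (fine X)%:E by rewrite fineK// ge0_fin_numE// (le_lt_trans Xle)// ltry.
have {}X0 : 0 <= fine X by exact: fine_ge0.
rewrite XE' in Xle *; rewrite lee_fin in Xle.
rewrite -EFinM poweR_EFin lee_fin.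
exact: mean_root_le.
Qed.

End weak_type.

(* The point at height [rho^2] above [xi0] is at distance [rho]. *)
Lemma hball_subset_le (R : realType) (n : nat) (xi0 : heis R n) (a rho : R) :
  0 < rho -> hball xi0 a `<=` hball xi0 rho -> a <= rho.
Proof.
move=> rho0 sub; rewrite leNgt; apply/negP => arho.
pose h : heis R n := hpt 0 0 (rho ^+ 2).
have h4 : hnorm h ^+ 4 = rho ^+ 4.
  rewrite hnormX4.
  Transparent hnorm4.
  by rewrite /hnorm4 /hz2 !hE !dotvE addr0 expr0n/= add0r -exprM.
  Opaque hnorm4.
have hr : hnorm h = rho.
  by apply: (@pexpIrn _ 4); rewrite ?nnegrE ?hnorm_ge0 ?(ltW rho0).
have : hball xi0 rho (hmul xi0 h) by apply: sub; rewrite /hball/= hdistMr hr.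
by rewrite /hball/= hdistMr hr ltxx.
Qed.

(** Passes from levels [e + d] strictly above the infimum, for which [infE] can be verified, to the
    limit level [e]. *)
Lemma lee_fin_approx (R : realType) (x : \bar R) (c e : R) : 0 <= c ->
  (forall d : R, 0 < d -> (x <= (c * (e + d))%:E)%E) -> (x <= (c * e)%:E)%E.
Proof.
move=> c0 h; apply/lee_addgt0Pr => d d0.
have c1 : 0 < c + 1 by rewrite ltr_wpDl.
apply: le_trans (h (d / (c + 1)) _) _; first by rewrite divr_gt0.
rewrite -EFinD lee_fin mulrDr lerD2l mulrCA ler_piMr ?(ltW d0)//.
by rewrite ler_pdivrMr// mul1r lerDl.
Qed.

Section tail_cases.
Context {R : realType} {n : nat}.
Local Notation H := (heis R n).
Local Notation mu := (@hleb R n).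

Lemma ess_inf_on_geP (D : set H) (u : H -> R) (m : R) :
  {ae mu, forall x, D x -> m <= u x} -> (m%:E <= ess_inf_on D u)%E.
Proof.
move=> mDu; apply/ess_infP; apply: filterS mDu => x mx.
by case: ifPn => [/set_mem/mx|_]; [rewrite lee_fin|rewrite leey].
Qed.

Lemma htail_fin (s rho : R) (x0 : H) (u : H -> R) : 0 < rho ->
  (htail s (u^\-)%R x0 rho < +oo)%E ->
  exists2 I0 : R, htail s (u^\-)%R x0 rho = (rho `^ (2 * s) * I0)%:E &
   (\int[mu]_(y in ~` hball x0 rho) (tneg (u y) * hkernel s x0 y)%:E = I0%:E)%E.
Proof.
move=> rho0; rewrite /htail.
have -> : (\int[mu]_(y in ~` hball x0 rho) (`|(u^\-)%R y| * hkernel s x0 y)%:E =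
  \int[mu]_(y in ~` hball x0 rho) (tneg (u y) * hkernel s x0 y)%:E)%E.
  apply: eq_integral => y _; congr (_ * _)%:E.
  by rewrite ger0_norm// le_max lexx orbT.
have : (0 <= \int[mu]_(y in ~` hball x0 rho) (tneg (u y) * hkernel s x0 y)%:E)%E.
  by apply: integral_ge0 => y _; rewrite lee_fin mulr_ge0 ?tneg_ge0 ?hkernel_ge0.
have p0 : 0 < rho `^ (2 * s) by exact: powR_gt0.
case: (\int[mu]_(y in _) _)%E => [I0 _ _| _|//].
  by exists I0.
by rewrite gt0_muley ?lte_fin// ltxx.
Qed.
End tail_cases.

Unset Implicit Arguments.

Theorem theorem1p5 (R : realType) (n : nat) (s t : R) :
  (0 < n)%N -> 0 < s < 1 -> 0 < t < hQ R n / (hQ R n - 2 * s) ->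
  exists2 c : R, 0 < c &
  forall (Omega : set (heis R n)) (g u : heis R n -> R) (xi0 : heis R n)
    (r rho : R),
  open Omega -> connected Omega -> bounded_set Omega ->
  Hs s g -> weak_supersolution s Omega g u ->
  0 < r -> 0 < rho ->
  hball xi0 rho `<=` Omega ->
  {ae hleb, forall xi, hball xi0 rho xi -> 0 <= u xi} ->
  hball xi0 (6 * r) `<=` hball xi0 rho ->
  (power_mean t (hball xi0 r) u <=
   c%:E * ess_inf_on (hball xi0 (3 * r / 2)) u +
   (c * (1 - s) * (r / rho) `^ (2 * s))%:E * htail s (u^\-)%R xi0 rho)%E.
Proof.
move=> _ s01 /andP[t0 tth]; have /andP[s0 s1] := s01.
have {}tth : t < hQ2 (n := n) s by [].
pose C := (cM (n := n) s t / hvol (n := n)) `^ t^-1.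
have C0 : 0 <= C by exact: powR_ge0.
have s1' : 0 < 1 - s by rewrite subr_gt0.
(* Division by [1 - s] cancels the factor of the tail term, and makes the coefficient of the infimum
   only larger; the 1 ensures positivity. *)
pose c := (C + 1) / (1 - s).
have c0 : 0 < c by rewrite divr_gt0// ltr_wpDl.
exists c => // Omega g u xi0 r rho _ _ _ _ sup r0 rho0 ballO upos sub6.
have rrho := hball_subset_le rho0 sub6.
have [[mu_ _ Eu] _ _] := sup.
have k0 : 0 < c * (1 - s) * (r / rho) `^ (2 * s).
  by rewrite mulr_gt0 ?powR_gt0 ?divr_gt0// mulr_gt0.
have T0 : (0 <= htail s (u^\-)%R xi0 rho)%E.
  rewrite mule_ge0 ?lee_fin ?powR_ge0// integral_ge0// => y _.
  by rewrite lee_fin mulr_ge0 ?hkernel_ge0.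
have sub32 x : hball xi0 (3 * r / 2) x -> hball xi0 rho x.
  rewrite /hball/= => xr; apply: lt_le_trans xr _; apply: le_trans rrho.
  by rewrite mulrAC ler_pM2r//; lra.
have inf0 : (0 <= ess_inf_on (hball xi0 (3 * r / 2)) u)%E.
  by apply: ess_inf_on_geP; apply: filterS upos => x ux /sub32.
(* If the tail or the infimum is infinite, so is the right-hand side: the other term is nonnegative
   and both coefficients are positive. *)
have [Tfin|Tinf] := ltP (htail s (u^\-)%R xi0 rho) +oo%E; last first.
  move: Tinf; rewrite leye_eq => /eqP ->.
  rewrite [X in (_ + X)%E]gt0_muley ?lte_fin// addey ?leey//.
  by rewrite gt_eqF// (lt_le_trans (ltNyr 0))// mule_ge0// lee_fin ltW.
have [I0 TE I0E] := htail_fin rho0 Tfin.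
have := inf0; case infE : (ess_inf_on _ u) => [i0| |//] i00; last first.
  rewrite gt0_muley ?lte_fin// addye ?leey//.
  by rewrite gt_eqF// (lt_le_trans (ltNyr 0))// mule_ge0// lee_fin ltW.
rewrite lee_fin in i00.
have I00 : 0 <= I0.
  by rewrite -lee_fin -I0E integral_ge0// => y _; rewrite lee_fin mulr_ge0 ?tneg_ge0 ?hkernel_ge0.
pose E := i0 + r `^ (2 * s) * I0.
have E0 : 0 <= E by rewrite addr_ge0// mulr_ge0 ?powR_ge0.
have test (w : heis R n -> R) (K : R) : measurable_fun setT w ->
    (forall x, 0 <= w x) -> (forall x, w x <= K) ->
    (forall x, 2 * r <= hdist x xi0 -> w x = 0) -> (gagliardo2 s w < +oo)%E ->
    (0 <= hform s u w)%E.
  have r2 : 0 < 2 * r by rewrite mulr_gt0.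
  have r2rho : 2 * r < rho by apply: lt_le_trans rrho; rewrite ltr_pM2r// ltr_nat.
  exact: (hform_supersolution_ge0 s01 sup r2 r2rho ballO).
have main : (power_mean t (hball xi0 r) u <= (C * E)%:E)%E.
  apply: lee_fin_approx => // d d0.
  have Ed0 : 0 < E + d by rewrite ltr_wpDl.
  apply: (power_mean_le s01 r0 rrho mu_ Eu upos test I0E Ed0 _ _ t0 tth).
  (* If [u >= E + d] held almost everywhere, the essential infimum [i0] would be at least
     [E + d > i0]. *)
  - move=> /ess_inf_on_geP; rewrite infE lee_fin leNgt => /negP; apply.
    by rewrite /E -addrA ltrDl ltr_wpDl// mulr_ge0 ?powR_ge0.
  - by rewrite /E addrAC lerDr addr_ge0// ltW.
apply: le_trans main _; rewrite TE -!EFinM -EFinD lee_fin.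
(* The factor [rho^(2s)] in the definition of the tail turns [(r / rho)^(2s)] into the [r^(2s)] of
   the estimate. *)
have -> : c * (1 - s) * (r / rho) `^ (2 * s) * (rho `^ (2 * s) * I0) =
    (C + 1) * (r `^ (2 * s) * I0).
  have rE : r `^ (2 * s) = (r / rho) `^ (2 * s) * rho `^ (2 * s).
    by rewrite -powRM ?divr_ge0 ?(ltW r0) ?(ltW rho0)// divfK// gt_eqF.
  by rewrite rE /c divfK ?gt_eqF//; ring.
rewrite /E mulrDr; apply: lerD.
  rewrite ler_wpM2r// /c ler_pdivlMr//.
  apply: (@le_trans _ _ C); last by rewrite lerDl.
  by rewrite ler_piMr// lerBlDr lerDl ltW.
by rewrite ler_wpM2r ?lerDl// mulr_ge0 ?powR_ge0.
Qed.
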